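(* Let $(R,\tilde I)\in\mathcal{W}$ with $n_t(R)=n$ and $\mathrm{ht}(R)\ge 1$. Then $(R,\tilde I)\trianglelefteq(R^J,I\oplus\tilde I)$ for all $(J,I)\in\mathcal{H}(R)$, and $$\Theta_A(R,\tilde I;\cdot)=\sum_{(J,I)\in\mathcal{H}(R)}A^{-n+2(\Vert J\Vert-\Vert I\Vert)}\,\Theta_A(R^J,I\oplus\tilde I;\cdot),$$ where $\Vert K\Vert$ denotes the sum of the elements of a finite set $K$ of integers.
   Context: **Crossingless connections.** For integers $m,a,b\ge 0$ with $a+b$ even, consider a rectangle with points $x_1,\dots,x_a$ on its top side and $x'_1,\dots,x'_b$ on its bottom side (left to right), and $y_1,\dots,y_m$ on its left side and $y'_1,\dots,y'_m$ on its right side (top to bottom). A crossingless connection $C$ is a family of pairwise disjoint arcs embedded in the rectangle joining these points in pairs, considered up to isotopy fixing boundary points (equivalently, a noncrossing perfect matching of the boundary points). Put $\mathrm{ht}(C)=m$, $n_t(C)=a$, $n_b(C)=b$. An arc joining two top (bottom) points is a top (bottom) return. A roof state has no bottom returns; a floor state has no top returns; a bottom state is a floor state with $\mathrm{ht}=0$. A Catalan state is a crossingless connection with $n_t(C)=n_b(C)$; $\mathrm{Cat}(m,n)$ is the set of those with $\mathrm{ht}=m$, $n_t=n_b=n$. **Products.** The vertical product $T_1*_vT_2$ is obtained by stacking $T_1$ on top of $T_2$ and gluing the $i$-th bottom point of $T_1$ to the $i$-th top point of $T_2$ when $n_b(T_1)=n_t(T_2)$ (side points of $T_1$ are numbered before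 those of $T_2$); if $n_b(T_1)\ne n_t(T_2)$, then $T_1*_vT_2=K_0$, a formal symbol, and any product involving $K_0$ is $K_0$. **Coefficients.** A Kauffman state $s\in\mathcal{K}(m,n)$ of the lattice crossing $L(m,n)$ is an assignment of $\pm1$ to the $mn$ crossings of the grid of $m$ horizontal and $n$ vertical segments. $D_s$ is obtained by smoothing every crossing: a crossing marked $+1$ is replaced by two disjoint arcs joining its top end to its right end and its left end to its bottom end; one marked $-1$ by arcs joining top to left and right to bottom. $|D_s|$ is the number of closed components of $D_s$, and $C_s\in\mathrm{Cat}(m,n)$ is $D_s$ with closed components removed. With $p(s),n(s)$ the numbers of $+1$'s and $-1$'s, for $C\in\mathrm{Cat}(m,n)$ put $C(A)=\sum_{s\in\mathcal{K}(m,n),\,C_s=C}A^{p(s)-n(s)}(-A^2-A^{-2})^{|D_s|}$. Set $[[C]]_A=C(A)$ if $C$ is a Catalan state, and $[[C]]_A=0$ if $C=K_0$ or $C$ is a crossingless connection that is not a Catalan state. **Index sets.** $\mathbb{N}$ is the set of positive integers, $\mathrm{Fin}(\mathbb{N})$ the set of its finite subsets. For a bottom state $F$ with $n_b(F)=n$, $\varphi_n(F)$ is the set of indices of left ends of bottom returns of $F$; $\varphi_n$ is a bijection from the set of such bottom states onto a set $\mathcal{L}_n\subset\mathrm{Fin}(\mathbb{N})$. For a crossingless connection $C$ with $n_b(C)=n$ and $I\in\mathcal{L}_n$, $C_I$ is the unique crossingless connection $C'$ with $C=C'*_v\varphi_n^{-1}(I)$ if it exists, and $C_I=K_0$ otherwise;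 also $C_I=K_0$ if $C=K_0$ or $I\notin\mathcal{L}_n$. For $I,J\in\mathrm{Fin}(\mathbb{N})$ write $J\preceq I$ if for some $n$ we have $I,J\in\mathcal{L}_n$ and $(\varphi_n^{-1}(I))_J\ne K_0$. $n_I$ is the integer with $I\in\mathcal{L}_n\iff n\ge n_I$. For any $I,J\in\mathrm{Fin}(\mathbb{N})$, with $n^*=\max\{n_I+2|J|,n_J\}$, $I\oplus J=\varphi_{n^*}\big(\varphi_{n^*-2|J|}^{-1}(I)*_v\varphi_{n^*}^{-1}(J)\big)$. For $J\preceq I$, $I\ominus J=\varphi_{n_I-2|J|}\big((\varphi_{n_I}^{-1}(I))_J\big)$. **The set $\mathcal{W}$, $\trianglelefteq$, $\Theta_A$.** $\mathcal{W}$ is the set of pairs $(R,I)$ with $R$ a roof state and $I\in\mathrm{Fin}(\mathbb{N})$. Write $(R,I)\trianglelefteq(R',I')$ if a) $I\preceq I'$ and $I'\ominus I\in\mathcal{L}_{n_t(R)}$, b) $n_t(R)+2|I|=n_t(R')+2|I'|$, and c) $n_b(R)=n_b(R')$. For $(R,I)\in\mathcal{W}$, $\Theta_A(R,I;\cdot)$ is the function $F\mapsto\Theta_A(R,I;F)=[[R*_vF_I]]_A$ of $F$, where $F$ is any floor state or $F=K_0$. **Removing top arcs.** For a crossingless connection $C$ with $\mathrm{ht}(C)\ge1$ and $n_t(C)=n$, put $x_0=y_1$, $x_{n+1}=y'_1$, let $e_j$ ($0\le j\le n$) be the arc joining $x_j$ and $x_{j+1}$, and $\mathcal{J}(C)=\{j\mid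 e_j\in C\}$. $\mathcal{U}_n$ is the set of nonempty sets $J=\{j_1<\dots<j_{t+1}\}\subseteq\{0,\dots,n\}$ ($t\ge0$) with $j_{k+1}-j_k>1$ for all $k$. For $J\in\mathcal{U}_n$, $\psi_n^{-1}(J)$ denotes the roof state of height $1$ with $n$ top points and $n-2(|J|-1)$ bottom points that contains the arcs $e_j$, $j\in J$, and whose remaining points among $x_0,x_1,\dots,x_{n+1}$ are joined, in order, to the bottom points. $C^J$ is the unique crossingless connection $C'$ with $C=\psi_n^{-1}(J)*_vC'$ if it exists, and $C^J=K_0$ otherwise. $\mathcal{D}_n$ is the set of pairs $(J,I)$ of finite subsets of $\mathbb{Z}_{\ge0}$ with $J=\{j_1,\dots,j_{t+1}\}$, $I=\{i_1,\dots,i_t\}$, $t\ge0$, $0\le j_k<i_k<j_{k+1}\le n$ for all $k$ (for $t=0$: $I=\emptyset$, $0\le j_1\le n$). For a roof state $R$ with $n_t(R)=n$, $\mathrm{ht}(R)\ge1$, $\mathcal{H}(R)=\{(J,I)\in\mathcal{D}_n\mid J\subseteq\mathcal{J}(R)\}$. *)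

(* Defs.v *)
From HB Require Import structures.
From Stdlib Require Import Relations.
From mathcomp Require Import all_boot all_order all_algebra.
From mathcomp Require Import finmap.
From mathcomp Require Import boolp.

Set Implicit Arguments.
Unset Strict Implicit.
Unset Printing Implicit Defensive.

Import GRing.Theory.

Local Open Scope fset_scope.
Local Open Scope nat_scope.

(* [the P] is [Some x] if [x] is the only object satisfying [P], and [None] if
   there is no such object. *)
Definition the (T : Type) (P : T -> Prop) : option T :=
  if pselect (exists! x, P x) is left h then Some (projT1 (cid h)) else None.

(* Indices start at 1: [Top i], [Bot i], [Lft k], [Rgt k] are the points x_i,
   x'_i, y_k, y'_k on the sides of the rectangle. *)
Inductive point := Top of nat | Bot of nat | Lft of nat | Rgt of nat.

Definition point_code (p : point) : (nat + nat) + (nat + nat) :=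
  match p with
  | Top i => inl (inl i) | Bot i => inl (inr i)
  | Lft k => inr (inl k) | Rgt k => inr (inr k)
  end.

Definition point_decode (c : (nat + nat) + (nat + nat)) : point :=
  match c with
  | inl (inl i) => Top i | inl (inr i) => Bot i
  | inr (inl k) => Lft k | inr (inr k) => Rgt k
  end.

Lemma point_codeK : cancel point_code point_decode.
Proof. by case. Qed.

HB.instance Definition _ := Countable.copy point (can_type point_codeK).

Definition on_bdry (m a b : nat) (p : point) : bool :=
  match p with
  | Top i => 0 < i <= a
  | Bot i => 0 < i <= b
  | Lft k | Rgt k => 0 < k <= m
  end.

(* Rank of a boundary point when the boundary is traversed clockwise from the
   upper left corner. *)
Definition bdry_pos (m a b : nat) (p : point) : nat :=
  match p with
  | Top i => i
  | Rgt k => a + k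
  | Bot i => a + m + (b.+1 - i)
  | Lft k => a + m + b + (m.+1 - k)
  end.

(* A crossingless connection is a noncrossing perfect matching of the boundary
   points; [mate] exchanges the two ends of each arc.  Outside the boundary
   [mate] is the identity, so that Leibniz equality of connections is equality
   of the matchings (that is, isotopy).  The number of boundary points being
   even, [nt + nb] is even. *)
Record connection := Connection {
  ht : nat;
  nt : nat;
  nb : nat;
  mate : point -> point;
  mateK : involutive mate;
  mate_fixE : forall p, (mate p == p) = ~~ on_bdry ht nt nb p;
  mate_planar : forall p q,
    on_bdry ht nt nb p -> on_bdry ht nt nb q ->
    let pos := bdry_pos ht nt nb in
    ~~ [&& pos p < pos q, pos q < pos (mate p) & pos (mate p) < pos (mate q)]
}.

Definition bdry (C : connection) (p : point) : bool :=
  on_bdry (ht C) (nt C) (nb C) p.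

Definition top_return (C : connection) (i : nat) : bool :=
  if mate C (Top i) is Top _ then 0 < i <= nt C else false.

Definition bot_return (C : connection) (i : nat) : bool :=
  if mate C (Bot i) is Bot _ then 0 < i <= nb C else false.

Definition roof (C : connection) : Prop := forall i, ~~ bot_return C i.
Definition floor (C : connection) : Prop := forall i, ~~ top_return C i.
Definition bottom (C : connection) : Prop := floor C /\ ht C = 0.

(* The formal symbol K_0 is [None : option connection]. *)

Inductive glue_step (S T : connection) : relation (point + point) :=
| glue_arc_upper p : glue_step S T (inl p) (inl (mate S p))
| glue_arc_lower p : glue_step S T (inr p) (inr (mate T p))
| glue_junction i : 0 < i <= nb S -> glue_step S T (inl (Bot i)) (inr (Top i)).

Definition glued (S T : connection) : relation (point + point) :=
  clos_refl_sym_trans _ (glue_step S T).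

(* Where the boundary points of the stacked rectangle lie in the two
   rectangles. *)
Definition outer (S : connection) (p : point) : point + point :=
  match p with
  | Top i => inl (Top i)
  | Bot i => inr (Bot i)
  | Lft k => if k <= ht S then inl (Lft k) else inr (Lft (k - ht S))
  | Rgt k => if k <= ht S then inl (Rgt k) else inr (Rgt (k - ht S))
  end.

(* Closed components created by the gluing are discarded; there are none when
   [S] is a roof state or [T] is a floor state. *)
Definition is_vprod (S T C : connection) : Prop :=
  [/\ nb S = nt T,
      [/\ ht C = ht S + ht T, nt C = nt S & nb C = nb T]
    & forall p q, bdry C p -> bdry C q -> p <> q ->
        (mate C p = q <-> glued S T (outer S p) (outer S q))].

Definition vprod (S T : option connection) : option connection :=
  match S, T with
  | Some S', Some T' => the (is_vprod S' T')
  | _, _ => None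
  end.

(* The crossing [(i, j)] lies on the i-th horizontal segment (from the top) and
   the j-th vertical one (from the left), counted from 0; [true] is the marker
   +1. *)
Definition kstate (m n : nat) := {ffun 'I_m * 'I_n -> bool}.

(* The crossings cut the i-th horizontal line into the edges
   [inl (i, 0)], ..., [inl (i, n)] from left to right, and the j-th vertical
   line into [inr (0, j)], ..., [inr (m, j)] from top to bottom. *)
Definition edge (m n : nat) : finType := ('I_m * 'I_n.+1 + 'I_m.+1 * 'I_n)%type.

Section Smoothing.

Variables (m n : nat) (s : kstate m n).
Implicit Types (c : 'I_m * 'I_n) (u v : edge m n) (p q : point).

Definition top_end c : edge m n := inr (widen_ord (leqnSn m) c.1, c.2).
Definition bot_end c : edge m n := inr (lift ord0 c.1, c.2).
Definition left_end c : edge m n := inl (c.1, widen_ord (leqnSn n) c.2).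
Definition right_end c : edge m n := inl (c.1, lift ord0 c.2).

Definition smooth_at c : seq (edge m n * edge m n) :=
  if s c then [:: (top_end c, right_end c); (left_end c, bot_end c)]
  else [:: (top_end c, left_end c); (right_end c, bot_end c)].

Definition smooth : rel (edge m n) :=
  fun u v => [exists c, ((u, v) \in smooth_at c) || ((v, u) \in smooth_at c)].

(* The edge ending at a given boundary point of the lattice crossing. *)
Definition edge_at p u : bool :=
  match p, u with
  | Top j, inr (k, l) => (k == 0 :> nat) && (l.+1 == j)
  | Bot j, inr (k, l) => (k == m :> nat) && (l.+1 == j)
  | Lft i, inl (k, l) => (k.+1 == i) && (l == 0 :> nat)
  | Rgt i, inl (k, l) => (k.+1 == i) && (l == n :> nat)
  | _, _ => false
  end.

Definition bdry_edge u : bool :=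
  match u with
  | inl (_, l) => (l == 0 :> nat) || (l == n :> nat)
  | inr (k, _) => (k == 0 :> nat) || (k == m :> nat)
  end.

Definition closed_count : nat :=
  n_comp smooth [pred u | ~~ [exists v, bdry_edge v && connect smooth u v]].

Definition is_Cs (C : connection) : Prop :=
  [/\ ht C = m, nt C = n, nb C = n
    & forall p q, bdry C p -> bdry C q -> p <> q ->
        (mate C p = q <->
         exists u v, [/\ edge_at p u, edge_at q v & connect smooth u v])].

Definition pos_count : nat := #|[pred c | s c]|.
Definition neg_count : nat := #|[pred c | ~~ s c]|.

End Smoothing.

Section Coefficient.

Variables (K : comUnitRingType) (A : K).
Local Open Scope ring_scope.

Definition catalan_coef (C : connection) : K :=
  \sum_(s : kstate (ht C) (nt C) | `[< is_Cs s C >])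
    A ^ ((pos_count s)%:Z - (neg_count s)%:Z)
    * (- A ^+ 2 - A ^- 2) ^+ closed_count s.

Definition coef (C : option connection) : K :=
  if C is Some C' then
    if nt C' == nb C' then catalan_coef C' else 0
  else 0.

End Coefficient.

Definition posset (I : {fset nat}) : Prop := 0 \notin I.

Definition phi (F : connection) : {fset nat} :=
  [fset i in iota 1 (nb F) | if mate F (Bot i) is Bot k then i < k else false].

Definition is_phi_inv (n : nat) (I : {fset nat}) (F : connection) : Prop :=
  [/\ bottom F, nb F = n & phi F = I].

Definition in_L (n : nat) (I : {fset nat}) : Prop :=
  exists F, is_phi_inv n I F.

(* [None] if [I] is not in L_n. *)
Definition phi_inv (n : nat) (I : {fset nat}) : option connection :=
  the (is_phi_inv n I).

(* C_I; it is K_0 if [I] is not in L_n since [phi_inv] is then K_0. *)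
Definition rem_bot (C : option connection) (I : {fset nat}) :
    option connection :=
  if C is Some C0 then
    the (fun C' => vprod (Some C') (phi_inv (nb C0) I) = Some C0)
  else None.

Definition preceq (J I : {fset nat}) : Prop :=
  exists n, [/\ in_L n I, in_L n J & rem_bot (phi_inv n I) J <> None].

Definition is_minwidth (I : {fset nat}) (k : nat) : Prop :=
  forall n, in_L n I <-> k <= n.

(* n_I; the junk value 0 is taken only if [I] contains 0. *)
Definition minwidth (I : {fset nat}) : nat := odflt 0 (the (is_minwidth I)).

Definition oplus (I J : {fset nat}) : {fset nat} :=
  let n := maxn (minwidth I + 2 * #|` J|) (minwidth J) in
  oapp phi fset0 (vprod (phi_inv (n - 2 * #|` J|) I) (phi_inv n J)).

Definition ominus (I J : {fset nat}) : {fset nat} :=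
  oapp phi fset0 (rem_bot (phi_inv (minwidth I) I) J).

Definition in_W (w : connection * {fset nat}) : Prop :=
  roof w.1 /\ posset w.2.

Definition W_le (w w' : connection * {fset nat}) : Prop :=
  [/\ in_W w /\ in_W w',
      preceq w.2 w'.2 /\ in_L (nt w.1) (ominus w'.2 w.2),
      nt w.1 + 2 * #|` w.2| = nt w'.1 + 2 * #|` w'.2|
    & nb w.1 = nb w'.1].

(* The domain of Theta_A(R, I; .): floor states and K_0. *)
Definition floor_or_K0 (F : option connection) : Prop :=
  if F is Some F' then floor F' else True.

Definition Theta (K : comUnitRingType) (A : K) (R : option connection)
    (I : {fset nat}) (F : option connection) : K :=
  coef A (vprod R (rem_bot F I)).

(* x_0, ..., x_{n+1}, where x_0 = y_1 and x_{n+1} = y'_1. *)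
Definition xpt (n j : nat) : point :=
  if j == 0 then Lft 1 else if j <= n then Top j else Rgt 1.

Definition has_e (C : connection) (j : nat) : bool :=
  mate C (xpt (nt C) j) == xpt (nt C) j.+1.

(* The set J(C) of the indices of the arcs e_j in C, for [0 < ht C]. *)
Definition top_arcs (C : connection) : {fset nat} :=
  [fset j in iota 0 (nt C).+1 | has_e C j].

Definition in_U (n : nat) (J : {fset nat}) : Prop :=
  [/\ J != fset0, forall j, j \in J -> j <= n
    & forall j j', j \in J -> j' \in J -> j < j' -> 1 < j' - j].

(* The indices of the points x_0, ..., x_{n+1} which are not ends of the arcs
   e_j for j in J, from left to right. *)
Definition free_idx (n : nat) (J : {fset nat}) : seq nat :=
  [seq i <- iota 0 n.+2 | (i \notin J) && ((i == 0) || (i.-1 \notin J))].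

Definition is_psi_inv (n : nat) (J : {fset nat}) (T : connection) : Prop :=
  [/\ in_U n J,
      [/\ roof T, ht T = 1, nt T = n & nb T = n - 2 * (#|` J| - 1)],
      forall j, j \in J -> has_e T j
    & forall k, k < size (free_idx n J) ->
        mate T (xpt n (nth 0 (free_idx n J) k)) = Bot k.+1].

(* [None] if [J] is not in U_n. *)
Definition psi_inv (n : nat) (J : {fset nat}) : option connection :=
  the (is_psi_inv n J).

(* C^J; it is K_0 if [ht C = 0] or [J] is not in U_n. *)
Definition rem_top (C : connection) (J : {fset nat}) : option connection :=
  the (fun C' => vprod (psi_inv (nt C) J) (Some C') = Some C).

(* j_1 < i_1 < j_2 < ... < i_t < j_{t+1} *)
Definition interlaced (J I : {fset nat}) : bool :=
  let js := sort leq J in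
  let ks := sort leq I in
  (size js == (size ks).+1) &&
  all (fun k => nth 0 js k < nth 0 ks k < nth 0 js k.+1) (iota 0 (size ks)).

(* The set D_n of the pairs (J, I); [interlaced] and the bound on [J] imply the
   one on [I]. *)
Definition Dset (n : nat) : {fset {fset nat} * {fset nat}} :=
  let P := fpowerset [fset k in iota 0 n.+1] in
  [fset w in P `*` P | interlaced w.1 w.2].

Definition Hset (R : connection) : {fset {fset nat} * {fset nat}} :=
  [fset w in Dset (nt R) | w.1 `<=` top_arcs R].

Definition sum_elts (J : {fset nat}) : nat := \sum_(k <- J) k.

(* Main.v *)
Require Import Defs.
From Stdlib Require Import Relations.
From mathcomp Require Import all_boot all_order all_algebra finmap.
From mathcomp Require Import boolp zify ring.

Set Implicit Arguments.
Unset Strict Implicit.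
Unset Printing Implicit Defensive.

Import GRing.Theory.

Local Open Scope fset_scope.
Local Open Scope nat_scope.

(* Smooth the first row of the lattice crossing of C = R *_v F_{I0}.  Giving the
   sign + to x_0 and - to x_{n+1}, a smoothed row is a sequence of signs whose
   descents are its top arcs e_j, j in J, and whose ascents are its bottom
   returns, i in I; this is a bijection onto D_n, and the row contributes
   A^{-n+2(||J||-||I||)}.  In the rows below, a return arriving at the columns
   i, i+1 meets one of four pairs of markers: (+,+), (+,-), (-,-) give the same
   connection with total weight A^2 + (-A^2-A^{-2}) + A^{-2} = 0, and (-,+) lets
   the return pass to the next row.  So only the states whose columns i, i+1 are
   constantly -, + count; deleting these columns and the first row turns them
   into the states of a smaller lattice crossing that realize (C^J)_I.  Since R
   has no bottom returns and F has no top returns, J is contained in J(R) and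
   (C^J)_I = R^J *_v F_{I (+) I0}.  Planarity is never an issue: all products
   that occur insert or delete arcs, which is monotone on boundary positions. *)

(** * Connections *)

(** Exponent and interlacing have one source. The signs from x_0 to x_{n+1} form alternating runs;
    each + run ends at an element of J, each - run but the last at an element of I. Hence ||J|| -
    ||I|| counts the + among the n markers of the row. A free top point of sign + (-) leaves the row
    one column further right (left); this matches the free points with the columns not covered by
    cups. In a lower row, deleting a pair of columns marked - and + costs no power of A. The
    obstacle is formal: a product is given by the closure of a gluing relation, wrapped in a choice
    of the unique solution with K_0 as default. The products are therefore traded for relations
    between mates, [extT] and [extB], each of which comes with an injection of the smaller boundary
    into the larger one; existence, uniqueness and associativity are proved for these. K_0 has to be
    handled in both directions: a nonzero term on the right must lift to an existing Catalan state R
    *_v F_{I0}, and an existing (C^J)_I must come from a product of R^J. *)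

Lemma the_Some (T : Type) (P : T -> Prop) (x : T) :
  P x -> (forall y, P y -> y = x) -> the P = Some x.
Proof.
move=> Px uP; rewrite /the; case: pselect => [h|nh]; last first.
  by case: nh; exists x; split=> // y /uP.
by congr Some; case: (cid h) => y /= [Py _]; exact: uP.
Qed.

Lemma the_SomeP (T : Type) (P : T -> Prop) (x : T) : the P = Some x -> P x.
Proof.
by rewrite /the; case: pselect => // h [<-]; case: (cid h) => y /= [].
Qed.

Definition bpos (C : connection) := bdry_pos (ht C) (nt C) (nb C).

(** The position function is a parameter so that the condition can also be tested with the boundary
    read from another starting point. *)
Definition noncrossing (B : pred point) (pos : point -> nat)
    (M : point -> point) :=
  forall p q, B p -> B q ->
    ~~ [&& pos p < pos q, pos q < pos (M p) & pos (M p) < pos (M q)].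

Lemma bdry_pos_inj m a b p q : on_bdry m a b p -> on_bdry m a b q ->
  bdry_pos m a b p = bdry_pos m a b q -> p = q.
Proof.
by case: p => i; case: q => j //=; move=> H1 H2 H3;
  (congr (_ _); lia) || lia.
Qed.

Lemma mate_bdry C p : bdry C p -> bdry C (mate C p).
Proof.
move=> Bp; apply: contraTT (Bp); rewrite -mate_fixE mateK => /eqP E.
by rewrite -mate_fixE -E.
Qed.

Lemma mate_off C p : ~~ bdry C p -> mate C p = p.
Proof. by rewrite -mate_fixE => /eqP. Qed.

Lemma mate_neq C p : bdry C p -> mate C p <> p.
Proof. by move=> Bp /eqP; rewrite mate_fixE -/(bdry C p) Bp. Qed.

Lemma mate_inj C : injective (mate C).
Proof. exact: can_inj (mateK C). Qed.

Lemma connection_eq C D : ht C = ht D -> nt C = nt D -> nb C = nb D ->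
  (forall p, bdry C p -> mate C p = mate D p) -> C = D.
Proof.
case: C => m a b f fK fx fp; case: D => m' a' b' g gK gx gp /= E1 E2 E3.
subst m' a' b' => H; have E : f = g.
  apply: funext => p; have [/H //|Bp] := boolP (on_bdry m a b p).
  have /eqP-> : f p == p by rewrite fx.
  by have /eqP-> : g p == p by rewrite gx.
subst g; congr Connection; exact: Prop_irrelevance.
Qed.

(** [M] is overwritten by the identity off the boundary, as the record demands, so that only the
    arcs have to be described. *)
Lemma build_connection m a b (M : point -> point) :
    let B := on_bdry m a b in
    (forall p, B p -> B (M p)) -> (forall p, B p -> M (M p) = p) ->
    (forall p, B p -> M p <> p) -> noncrossing B (bdry_pos m a b) M ->
  exists C, [/\ ht C = m, nt C = a, nb C = b
    & forall p, bdry C p -> mate C p = M p].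
Proof.
move=> B MB MK Mx Mnc.
pose f p := if B p then M p else p.
have fK : involutive f.
  move=> p; rewrite /f; case: (boolP (B p)) => Bp; last by rewrite (negbTE Bp).
  by rewrite MB // MK.
have fx p : (f p == p) = ~~ B p.
  by rewrite /f; case: ifP => Bp; [apply/eqP/Mx|rewrite eqxx].
have fp p q : B p -> B q -> let pos := bdry_pos m a b in
    ~~ [&& pos p < pos q, pos q < pos (f p) & pos (f p) < pos (f q)].
  by move=> Bp Bq; rewrite /f Bp Bq; exact: Mnc.
by exists (Connection fK fx fp); split=> //= p; rewrite /bdry /= /f /B => ->.
Qed.

(* Reading the boundary from y_1 instead of x_1 puts x_0, ..., x_{n+1} in
   consecutive positions. *)
Definition rpos (m a b : nat) (p : point) :=
  if p == Lft 1 then 0 else bdry_pos m a b p.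

Lemma rpos_max m a b p : 0 < m -> on_bdry m a b p -> p <> Lft 1 ->
  0 < rpos m a b p < bdry_pos m a b (Lft 1).
Proof.
rewrite /rpos => m0; case: eqP => // ne.
case: p ne => i /= ne; [lia|lia| |lia].
by case: (i =P 1) ne => [->//|]; lia.
Qed.

(** Only y_1 changes rank, from last to first. A crossing pattern p < q < M p < M q whose extreme
    point is moved to the other end is again such a pattern, for the pair (M q, p) or (q, M p);
    hence the three instances used. *)
Lemma noncrossing_rot m a b M :
    let B := on_bdry m a b in 0 < m ->
    (forall p, B p -> B (M p)) -> (forall p, B p -> M (M p) = p) ->
  noncrossing B (rpos m a b) M <-> noncrossing B (bdry_pos m a b) M.
Proof.
move=> B m0 MB MK.
pose L := bdry_pos m a b (Lft 1).
have step p : B p -> (rpos m a b p = 0 /\ bdry_pos m a b p = L) \/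
    (rpos m a b p = bdry_pos m a b p /\ 0 < rpos m a b p < L).
  move=> Bp; case: (p =P Lft 1) => [->|ne]; first by left; rewrite /rpos eqxx.
  by right; split; [rewrite /rpos; case: eqP|exact: rpos_max].
by split=> nc p q Bp Bq; have BMp := MB _ Bp; have BMq := MB _ Bq;
  have := nc _ _ Bp Bq; have := nc _ _ BMq Bp; have := nc _ _ Bq BMp;
  rewrite !MK //; have := step _ Bp; have := step _ Bq;
  have := step _ BMp; have := step _ BMq; lia.
Qed.

Definition pos_mono (B : pred point) (pos pos' : point -> nat)
    (rho : point -> point) :=
  forall p q, B p -> B q -> pos p < pos q -> pos' (rho p) < pos' (rho q).

Lemma pos_mono_inv B pos pos' rho : {in B &, injective pos} ->
  pos_mono B pos pos' rho ->
  forall p q, B p -> B q -> pos' (rho p) < pos' (rho q) -> pos p < pos q.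
Proof.
move=> inj mono p q Bp Bq lt; rewrite ltnNge leq_eqVlt; apply/negP=> /orP[].
  by move=> /eqP/inj e; move: lt; rewrite e ?ltnn.
by move/(mono _ _ Bq Bp); lia.
Qed.

Lemma pos_mono_inj B pos pos' rho : {in B &, injective pos} ->
  pos_mono B pos pos' rho -> {in B &, injective rho}.
Proof.
move=> inj mono p q Bp Bq e; apply: inj => //; apply/eqP.
by case: ltngtP => // /mono; rewrite e ltnn => /(_ _ _)->.
Qed.

Lemma bpos_inj C : {in bdry C &, injective (bpos C)}.
Proof. move=> p q Bp Bq; exact: bdry_pos_inj. Qed.

(** Old points are the image of [rho], new ones are paired by [arc]. Old arcs do not cross since
    [rho] is monotone. For the rest it is enough that only new points lie under a new arc and that
    arcs starting there do not end beyond it. The first hypothesis admits a rotated order [pos]. *)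
Lemma insert_arcs (C' : connection) m a b (rho arc : point -> point)
    (pos : point -> nat) :
    let B := on_bdry m a b in
    let im p := exists2 p', bdry C' p' & rho p' = p in
    (forall M, (forall p, B p -> B (M p)) -> (forall p, B p -> M (M p) = p) ->
       noncrossing B pos M -> noncrossing B (bdry_pos m a b) M) ->
    (forall p, bdry C' p -> B (rho p)) ->
    pos_mono (bdry C') (bpos C') pos rho ->
    (forall p, B p -> ~ im p ->
       [/\ B (arc p), ~ im (arc p), arc (arc p) = p & arc p <> p]) ->
    (forall p q, B p -> ~ im p -> B q -> pos p < pos q < pos (arc p) ->
       ~ im q /\ ~~ (pos (arc p) < pos (arc q))) ->
  exists C, [/\ [/\ ht C = m, nt C = a & nb C = b],
    forall p, bdry C' p -> mate C (rho p) = rho (mate C' p)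
    & forall p, B p -> ~ im p -> mate C p = arc p].
Proof.
move=> B im rot rhoB mono arcP arcN.
have rinj := pos_mono_inj (@bpos_inj C') mono.
pose M p := if pselect (im p) is left h
            then rho (mate C' (s2val (cid2 h))) else arc p.
have Mim p : bdry C' p -> M (rho p) = rho (mate C' p).
  rewrite /M => Bp; case: pselect => [h|[]]; last by exists p.
  case: (cid2 h) => q Bq /= e; congr (rho (mate C' _)); exact: rinj.
have Mni p : ~ im p -> M p = arc p by rewrite /M; case: pselect.
have MB p : B p -> B (M p).
  have [[q Bq <-] _|ni Bp] := pselect (im p).
    by rewrite Mim //; apply/rhoB/mate_bdry.
  by rewrite Mni //; case: (arcP p).
have MK p : B p -> M (M p) = p.
  have [[q Bq <-] _|ni Bp] := pselect (im p).
    by rewrite !Mim ?mateK // mate_bdry.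
  by have [? ? ? _] := arcP p Bp ni; rewrite !Mni.
have Mx p : B p -> M p <> p.
  have [[q Bq <-] _|ni Bp] := pselect (im p).
    by rewrite Mim // => /rinj e; apply: (mate_neq Bq); apply: e=> //;
      exact: mate_bdry.
  by rewrite Mni //; have [_ _ _] := arcP p Bp ni.
have Mnc : noncrossing B pos M.
  move=> p q Bp Bq; apply/negP=> /and3P[h1 h2 h3].
  have [ip|ni] := pselect (im p); last first.
    rewrite Mni // in h2 h3.
    have [|iq] := arcN p q Bp ni Bq; first by rewrite h1 h2.
    by rewrite Mni in h3 => //; rewrite h3.
  (* An old arc from p cannot end under a new arc from q, since only new points lie there. *)
  have [iq|ni] := pselect (im q); last first.
    rewrite (Mni q) // in h3.
    have [|[]//] := arcN q (M p) Bq ni (MB _ Bp); first by rewrite h2 h3.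
    case: ip => p' Bp' <-; rewrite Mim //; exists (mate C' p') => //.
    exact: mate_bdry.
  case: ip iq h1 h2 h3 => p' Bp' <- [q' Bq' <-]; rewrite !Mim //.
  have inv := pos_mono_inv (@bpos_inj C') mono.
  move=> /inv-/(_ Bp' Bq') h1 /inv-/(_ Bq' (mate_bdry Bp')) h2.
  move=> /inv-/(_ (mate_bdry Bp') (mate_bdry Bq')) h3.
  by move/negP: (@mate_planar C' _ _ Bp' Bq'); apply; apply/and3P.
have [C [e1 e2 e3 MC]] := build_connection MB MK Mx (rot _ MB MK Mnc).
have BE p : bdry C p = B p by rewrite /bdry e1 e2 e3.
exists C; split=> // p Bp; first by rewrite MC ?BE ?rhoB ?Mim.
by move=> ni; rewrite MC ?BE ?Mni.
Qed.

(** The last hypothesis says that no arc of C leaves the image of [rho]; the matching is then pulled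
    back along a monotone injection, which cannot create crossings. *)
Lemma remove_arcs C m a b (rho : point -> point) (pos : point -> nat) :
    let B := on_bdry m a b in
    noncrossing (bdry C) pos (mate C) ->
    (forall p, B p -> bdry C (rho p)) ->
    pos_mono B (bdry_pos m a b) pos rho ->
    (forall p, B p -> exists2 q, B q & mate C (rho p) = rho q) ->
  exists C', [/\ ht C' = m, nt C' = a, nb C' = b
    & forall p, bdry C' p -> mate C (rho p) = rho (mate C' p)].
Proof.
move=> B nc rhoB mono cl.
have rinj : {in B &, injective rho}.
  by apply: pos_mono_inj mono => p q Bp Bq; exact: bdry_pos_inj.
pose M p := if pselect (B p) is left h then s2val (cid2 (cl p h)) else p.
have MP p : B p -> B (M p) /\ mate C (rho p) = rho (M p).
  by rewrite /M => Bp; case: pselect => // h; case: (cid2 _).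
have MB p : B p -> B (M p) by case/MP.
have ME p : B p -> mate C (rho p) = rho (M p) by case/MP.
have MK p : B p -> M (M p) = p.
  move=> Bp; apply: rinj => //; rewrite ?unfold_in ?MB //.
    exact: MB (MB _ Bp).
  by rewrite -!ME ?mateK // MB.
have Mx p : B p -> M p <> p.
  by move=> Bp e; apply: (mate_neq (rhoB _ Bp)); rewrite ME // e.
have Mnc : noncrossing B (bdry_pos m a b) M.
  move=> p q Bp Bq; apply/negP=> /and3P[h1 h2 h3].
  have := nc _ _ (rhoB _ Bp) (rhoB _ Bq); rewrite !ME //.
  by rewrite !mono ?MB.
have [C' [e1 e2 e3 MC]] := build_connection MB MK Mx Mnc.
exists C'; split=> // p; rewrite {1}/bdry e1 e2 e3 => Bp.
by rewrite MC ?ME // /bdry e1 e2 e3.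
Qed.

Definition embeds (f : point -> point) (S S' : connection) : Prop :=
  [/\ forall p, bdry S p -> bdry S' (f p), {in bdry S &, injective f}
    & forall p, bdry S p -> mate S' (f p) = f (mate S p)].

Lemma embeds_id S : embeds id S S.
Proof. by split=> // p q _ _. Qed.

(** * Vertical products *)

Lemma is_vprod_uniq S T C D : is_vprod S T C -> is_vprod S T D -> C = D.
Proof.
move=> [_ [h1 h2 h3] H] [_ [h1' h2' h3'] H'].
have [e1 e2 e3] : [/\ ht D = ht C, nt D = nt C & nb D = nb C].
  by split; congruence.
apply: connection_eq => // p Bp.
have BE q : bdry D q = bdry C q by rewrite /bdry e1 e2 e3.
have Bq := mate_bdry Bp; have ne : p <> mate C p by move/esym/(mate_neq Bp).
by symmetry; apply/H'; rewrite ?BE //; apply/H.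
Qed.

Lemma vprod_SomeP S T C : vprod (Some S) (Some T) = Some C <-> is_vprod S T C.
Proof.
split=> [H|H]; first exact: (the_SomeP H).
apply: the_Some => // D HD.
exact: is_vprod_uniq HD H.
Qed.

Lemma outer_inj S : injective (outer S).
Proof.
by move=> [i|i|i|i] [j|j|j|j] //=; do ?case: ifP => ?; case=> // e;
  f_equal; lia.
Qed.

Definition glue_bdry S T (x : point + point) :=
  match x with inl p => bdry S p | inr p => bdry T p end.

Definition glue_mate S T (x : point + point) : point + point :=
  match x with inl p => inl (mate S p) | inr p => inr (mate T p) end.

Definition glue_map (f g : point -> point) (x : point + point) :
    point + point :=
  match x with inl p => inl (f p) | inr p => inr (g p) end.

Lemma glue_mateK S T : involutive (glue_mate S T).
Proof. by case=> p /=; rewrite mateK. Qed.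

Lemma glue_mate_bdry S T x :
  glue_bdry S T x -> glue_bdry S T (glue_mate S T x).
Proof. by case: x => p /mate_bdry. Qed.

Lemma glued_mate (S T : connection) x : glued S T x (glue_mate S T x).
Proof. by apply: rst_step; case: x => p; constructor. Qed.

Lemma outer_bdry S T C p : ht C = ht S + ht T -> nt C = nt S ->
  nb C = nb T -> bdry C p -> glue_bdry S T (outer S p).
Proof.
move=> h1 h2 h3; rewrite /bdry h1 h2 h3.
by case: p => k //=; case: ifP => ? /=; rewrite /bdry /=; lia.
Qed.

Section GlueEmbedding.

Variables (S T S' T' : connection) (f g : point -> point).
Hypotheses (fS : embeds f S S') (gT : embeds g T T').
Hypotheses (nST : nb S = nt T) (nS : nb S' = nb S).
Hypotheses (fBot : forall i, 0 < i <= nb S -> f (Bot i) = Bot i)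
           (gTop : forall i, 0 < i <= nt T -> g (Top i) = Top i).
Let h := glue_map f g.

Lemma glue_map_mate x :
  glue_bdry S T x -> glue_mate S' T' (h x) = h (glue_mate S T x).
Proof.
by case: fS gT => _ _ fm [_ _ gm]; case: x => p /= Bp; rewrite (fm, gm).
Qed.

Lemma glue_map_inj : {in glue_bdry S T &, injective h}.
Proof.
case: fS gT => _ fi _ [_ gi _].
move=> [p|p] [q|q] Bp Bq //= [e]; congr (_ _); [exact: fi|exact: gi].
Qed.

(** Off the boundary the mates are the identity while [h] is controlled on the boundary only. A
    gluing step at such a point goes nowhere, whence the alternative [x = y]. *)
Lemma glued_map x y : glued S T x y -> glued S' T' (h x) (h y) \/ x = y.
Proof.
suff: glued S T x y ->
    x = y \/ [/\ glue_bdry S T x, glue_bdry S T y & glued S' T' (h x) (h y)].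
  by move=> H /H[->|[]]; [right|left].
elim=> {x y} [x y [p|p|i le]|x|x y _ [->|[? ? ?]]|x y z _ [->|[? ? xy]] _].
- have [Bp|/mate_off->] := boolP (bdry S p); last by left.
  right; split; [by []|exact: mate_bdry|].
  by have := glued_mate S' T' (h (inl p)); rewrite glue_map_mate.
- have [Bp|/mate_off->] := boolP (bdry T p); last by left.
  right; split; [by []|exact: mate_bdry|].
  by have := glued_mate S' T' (h (inr p)); rewrite glue_map_mate.
- right; split; rewrite /= /bdry /= ?le -?nST //.
  by rewrite fBot // gTop -?nST //; apply: rst_step; constructor; rewrite nS.
- by left.
- by left.
- by right; split=> //; exact: rst_sym.
- by [].
- by case=> [<-|[? ? yz]]; right; split=> //; exact: rst_trans xy yz.
Qed.

(** All junction points lie in the image of [h], so an arc outside this image is never continued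
    into the other rectangle: a gluing class either comes from the small pair or consists of a point
    and its mate. *)
Lemma glued_reflect x y : glued S' T' x y ->
  [\/ exists x' y', [/\ glue_bdry S T x', glue_bdry S T y',
        h x' = x, h y' = y & glued S T x' y'],
      y = x
    | ~ (exists2 x', glue_bdry S T x' & h x' = x) /\ y = glue_mate S' T' x].
Proof.
have im_mate z : (exists2 x', glue_bdry S T x' & h x' = glue_mate S' T' z) ->
    exists2 x', glue_bdry S T x' & h x' = z.
  case=> x' Bx' e; exists (glue_mate S T x'); first exact: glue_mate_bdry.
  by rewrite -glue_map_mate // e glue_mateK.
have stepP z : [\/ exists x' y', [/\ glue_bdry S T x', glue_bdry S T y',
        h x' = z, h y' = glue_mate S' T' z & glued S T x' y'],
      glue_mate S' T' z = z
    | ~ (exists2 x', glue_bdry S T x' & h x' = z)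
      /\ glue_mate S' T' z = glue_mate S' T' z].
  have [[x' Bx' <-]|ni] := pselect (exists2 x', glue_bdry S T x' & h x' = z).
    constructor 1; exists x', (glue_mate S T x'); split=> //.
    - exact: glue_mate_bdry.
    - by rewrite glue_map_mate.
    - exact: glued_mate.
  by constructor 3.
elim=> {x y} [x y [p|p|i le]|x|x y _ IH|x y z _ IH1 _ IH2].
- exact: (stepP (inl p)).
- exact: (stepP (inr p)).
- rewrite nS in le; constructor 1; exists (inl (Bot i)), (inr (Top i)).
  split; rewrite /= /bdry /= ?fBot ?gTop -?nST //.
  by apply: rst_step; constructor.
- by constructor 2.
- case: IH => [[x' [y' [? ? ? ? ?]]]|->|[ni ->]].
  + by constructor 1; exists y', x'; split=> //; exact: rst_sym.
  + by constructor 2.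
  + by constructor 3; rewrite glue_mateK; split=> // /im_mate.
- move: IH2; case: IH1 => [[x' [y' [Bx By hx hy xy]]]|->|[ni ey]] // IH2.
  + case: IH2 => [[y'' [z' [By2 Bz hy2 hz yz]]]|->|[ni _]].
    * constructor 1; exists x', z'; split=> //; apply: rst_trans xy _.
      by have -> : y' = y'' by apply: glue_map_inj => //; rewrite hy hy2.
    * by constructor 1; exists x', y'.
    * by case: ni; exists y'.
  + case: IH2 => [[y'' [z' [By2 Bz hy2 hz yz]]]|->|[_ ->]].
    * by case: ni; apply: im_mate; exists y''; rewrite // -ey.
    * by constructor 3.
    * by constructor 2; rewrite ey glue_mateK.
Qed.

(** The common source of associativity at the top and at the bottom: if the arcs that C' has beyond
    C are arcs of a single factor, then gluing the large factors and gluing the small ones are the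
    same problem, because the gluing classes correspond. *)
Lemma vprod_embed (C C' : connection) (rho : point -> point) :
    nt T' = nt T ->
    [/\ ht C' = ht S' + ht T', nt C' = nt S' & nb C' = nb T'] ->
    [/\ ht C = ht S + ht T, nt C = nt S & nb C = nb T] ->
    (forall p, bdry C p -> [/\ bdry C' (rho p), outer S' (rho p) = h (outer S p)
                             & mate C' (rho p) = rho (mate C p)]) ->
    (forall p, bdry C' p -> (exists2 p', bdry C p' & rho p' = p) \/
       ~ (exists2 x, glue_bdry S T x & h x = outer S' p) /\
       outer S' (mate C' p) = glue_mate S' T' (outer S' p)) ->
  is_vprod S' T' C' <-> is_vprod S T C.
Proof.
move=> nT eC' eC rhoP arcP.
have oB p : bdry C p -> glue_bdry S T (outer S p).
  by case: eC => ? ? ?; exact: outer_bdry.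
have rinj : {in bdry C &, injective rho}.
  move=> p q Bp Bq e; apply: (@outer_inj S).
  apply: glue_map_inj; [exact: oB|exact: oB|].
  have [_ ep _] := rhoP _ Bp; have [_ eq _] := rhoP _ Bq.
  by rewrite -/h -ep -eq e.
have rE p q : bdry C p -> bdry C q ->
    (mate C' (rho p) = rho q <-> mate C p = q).
  move=> Bp Bq; case: (rhoP _ Bp) => _ _ ->; split=> [|->//].
  by apply: rinj => //; exact: mate_bdry.
have gE p q : bdry C p -> bdry C q -> p <> q ->
    (glued S' T' (outer S' (rho p)) (outer S' (rho q)) <->
     glued S T (outer S p) (outer S q)).
  move=> Bp Bq ne; case: (rhoP _ Bp) (rhoP _ Bq) => _ -> _ [_ -> _].
  split=> [|/glued_map[//|/outer_inj//]].
  move=> gpq; case: (glued_reflect gpq)=> [[x [y [Bx By hx hy]]]|e|[[]]].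
  - by rewrite (glue_map_inj Bx _ hx) ?(glue_map_inj By _ hy) //; exact: oB.
  - case: ne; apply/esym/(@outer_inj S)/glue_map_inj => //; exact: oB.
  - by exists (outer S p) => //; exact: oB.
split=> [[n1 _ H]|[n1 _ H]]; split=> //; last 2 first.
- by rewrite nS nT.
- move=> p q Bp Bq ne.
  have [[p' Bp' ep]|[ni ep]] := arcP p Bp.
    have [[q' Bq' eq]|[ni eq]] := arcP q Bq.
      rewrite -ep -eq rE // gE //; first by rewrite H // => e; case: ne;
        rewrite -ep e.
      by move=> e; case: ne; rewrite -ep -eq e.
    split=> [e|].
      case: ni; exists (outer S (mate C p')); first exact/oB/mate_bdry.
      case: (rhoP _ (mate_bdry Bp')) => _ <- _; case: (rhoP _ Bp') => _ _ <-.
      by rewrite ep e.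
    move=> gpq0; have gpq : glued S' T' (outer S' q) (outer S' p) by apply:
      rst_sym.
    case: (glued_reflect gpq)=> [[x [y [Bx By hx hy]]]|/outer_inj//|[_]].
      by case: ni; exists x.
    rewrite -eq => /outer_inj e; case: ni.
    exists (outer S (mate C p')); first exact/oB/mate_bdry.
    case: (rhoP _ (mate_bdry Bp')) => _ <- _; case: (rhoP _ Bp') => _ _ <-.
    by rewrite ep e mateK.
  split=> [<-|]; first by rewrite ep; exact: glued_mate.
  move=> gpq; case: (glued_reflect gpq)=> [[x [y [Bx By hx
    hy]]]|/outer_inj/esym//|[_]].
    by case: ni; exists x.
  by rewrite -ep => /outer_inj.
- move=> p q Bp Bq ne; rewrite -rE // -gE //; apply: H.
  + by case: (rhoP _ Bp).
  + by case: (rhoP _ Bq).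
  + by move/rinj => e; case: ne; exact: e.
Qed.

End GlueEmbedding.

(** [r] retracts the glued rectangles onto the points of C. Each gluing step fixes [r] or moves it
    along an arc of C, so a gluing class meets the outer boundary in the ends of at most one arc. *)
Lemma is_vprod_intro S T C (r : point + point -> point) :
    nb S = nt T -> [/\ ht C = ht S + ht T, nt C = nt S & nb C = nb T] ->
    (forall x y, glue_step S T x y -> r y = r x \/ r y = mate C (r x)) ->
    (forall p, bdry C p -> r (outer S p) = p) ->
    (forall p, bdry C p -> glued S T (outer S p) (outer S (mate C p))) ->
  is_vprod S T C.
Proof.
move=> e1 e2 rS ro oC; split=> // p q Bp Bq ne; split=> [<-|H]; first exact: oC.
have {}H : r (outer S q) = r (outer S p) \/
           r (outer S q) = mate C (r (outer S p)).
  elim: H => [x y /rS//|x|x y _ [->|->]|x y z _ IH1 _ IH2]; rewrite ?mateK;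
    try tauto.
  by case: IH1 IH2 => -> [] ->; rewrite ?mateK; tauto.
by case: H; rewrite !ro // => e; case: ne.
Qed.

Lemma identity_exists n : exists C,
  [/\ ht C = 0, nt C = n, nb C = n & forall i, 0 < i <= n ->
      mate C (Top i) = Bot i /\ mate C (Bot i) = Top i].
Proof.
pose M p := match p with Top i => Bot i | Bot i => Top i | _ => p end.
have [||||C [e1 e2 e3 MC]] := @build_connection 0 n n M.
- by case=> i //=; lia.
- by case.
- by case=> i //=; lia.
- by move=> [i|i|i|i] [j|j|j|j] //=; lia.
- exists C; split=> // i le; split; rewrite MC // /bdry e1 ?e2 ?e3 //.
Qed.

Definition idc (n : nat) : connection := projT1 (cid (identity_exists n)).

Lemma idcP n : [/\ ht (idc n) = 0, nt (idc n) = n, nb (idc n) = n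
  & forall i, 0 < i <= n ->
      mate (idc n) (Top i) = Bot i /\ mate (idc n) (Bot i) = Top i].
Proof. exact: (projT2 (cid (identity_exists n))). Qed.

Lemma vprod_idc_l C : is_vprod (idc (nt C)) C C.
Proof.
case: (idcP (nt C)) => e1 e2 e3 me.
pose r (x : point + point) :=
  match x with inl (Bot i) => Top i | inl p => p | inr p => p end.
apply: (@is_vprod_intro _ _ _ r); rewrite ?e1 ?e2 ?e3 //.
- move=> x y [p|p|i le] /=; [left|right|left] => //.
  have [|/mate_off->//] := boolP (bdry (idc (nt C)) p).
  by case: p => i; rewrite /bdry /= ?e1 ?e2 ?e3 => le; try lia;
    case: (me i le) => et eb; rewrite ?et ?eb.
- by case=> i //=; rewrite e1; case: ifP => _ _ //=; rewrite subn0.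
- suff oE p : bdry C p -> glued (idc (nt C)) C (outer (idc (nt C)) p) (inr p).
    move=> p Bp; apply: rst_trans (oE _ Bp) _; apply: rst_trans.
      exact: (glued_mate _ _ (inr p)).
    by apply/rst_sym/oE/mate_bdry.
  case: p => i; rewrite /bdry /= => le; last 2 first.
  + by rewrite e1 subn0; case: ifP => //; [lia|move=> _; exact: rst_refl].
  + by rewrite e1 subn0; case: ifP => //; [lia|move=> _; exact: rst_refl].
  + apply: rst_trans (_ : glued _ _ _ (inl (Bot i))) _.
      have [<- _] := me i le; exact: (glued_mate _ _ (inl (Top i))).
    by apply: rst_step; constructor; rewrite e3.
  + exact: rst_refl.
Qed.

Lemma vprod_idc_r C : is_vprod C (idc (nb C)) C.
Proof.
case: (idcP (nb C)) => e1 e2 e3 me.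
pose r (x : point + point) :=
  match x with inr (Top i) => Bot i | inl p => p | inr p => p end.
apply: (@is_vprod_intro _ _ _ r); rewrite ?e1 ?e2 ?e3 ?addn0 //.
- move=> x y [p|p|i le] /=; [right|left|left] => //.
  have [|/mate_off->//] := boolP (bdry (idc (nb C)) p).
  by case: p => i; rewrite /bdry /= ?e1 ?e2 ?e3 => le; try lia;
    case: (me i le) => et eb; rewrite ?et ?eb.
- by case=> i //=; rewrite /bdry /=; case: ifP => //= ? ?; f_equal; lia.
- suff oE p : bdry C p -> glued C (idc (nb C)) (outer C p) (inl p).
    move=> p Bp; apply: rst_trans (oE _ Bp) _; apply: rst_trans.
      exact: (glued_mate _ _ (inl p)).
    by apply/rst_sym/oE/mate_bdry.
  case: p => i; rewrite /bdry /= => le; last 2 first.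
  + by case: ifP => //; [move=> _; exact: rst_refl|lia].
  + by case: ifP => //; [move=> _; exact: rst_refl|lia].
  + exact: rst_refl.
  + apply: rst_trans (_ : glued _ _ _ (inr (Top i))) _.
      have [_ <-] := me i le; exact: (glued_mate _ _ (inr (Bot i))).
    by apply: rst_sym; apply: rst_step; constructor.
Qed.

(** * Adding and removing arcs e_j at the top *)

Lemma count_mem_fset (s : seq nat) (J : {fset nat}) :
  uniq s -> {subset J <= s} -> count (fun i => i \in J) s = #|` J|.
Proof.
move=> us sJ; rewrite -size_filter; apply/perm_size/uniq_perm.
- exact: filter_uniq.
- exact: fset_uniq.
- by move=> i; rewrite mem_filter andb_idr // => /sJ.
Qed.

Lemma free_idx_sorted n J : sorted ltn (free_idx n J).
Proof. by apply: sorted_filter; [exact: ltn_trans|exact: iota_ltn_sorted]. Qed.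

Lemma free_idx_lt n J k l : l < size (free_idx n J) -> k < l ->
  nth 0 (free_idx n J) k < nth 0 (free_idx n J) l.
Proof.
move=> ls kl; apply: (sorted_ltn_nth ltn_trans) => //.
- exact: free_idx_sorted.
- exact: ltn_trans ls.
Qed.

Lemma mem_free_idx n J i : (i \in free_idx n J) =
  [&& i \notin J, (i == 0) || (i.-1 \notin J) & i <= n.+1].
Proof. by rewrite mem_filter mem_iota /= add0n ltnS andbA. Qed.

Lemma nth_free_idx n J k : k < size (free_idx n J) ->
  nth 0 (free_idx n J) k \in free_idx n J.
Proof. exact: mem_nth. Qed.

(** The gap condition of U_n makes the 2|J| ends of the arcs e_j distinct among the n+2 points x_0,
    ..., x_{n+1}. *)
Lemma size_free_idx n J : in_U n J ->
  size (free_idx n J) + 2 * #|` J| = n.+2.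
Proof.
case=> _ Jn Jgap; rewrite size_filter.
set P := fun i => _ && _; set s := iota 0 n.+2.
pose Q i := (i != 0) && (i.-1 \in J).
have sub k : {subset J <= iota 0 (n + k.+1)}.
  by move=> i /Jn le; rewrite mem_iota; lia.
have cJ : count (fun i => i \in J) s = #|` J|.
  by apply: count_mem_fset; [exact: iota_uniq|rewrite /s -addn2;
    exact: (sub 1)].
have cQ : count Q s = #|` J|.
  have -> : s = 0 :: [seq 1 + i | i <- iota 0 n.+1] by rewrite -(iotaDl 1 0).
  have <- : count (fun i => i \in J) (iota 0 n.+1) = #|` J|.
    by apply: count_mem_fset; [exact: iota_uniq|rewrite -addn1; exact: (sub 0)].
  by move: (iota 0 n.+1) => t; rewrite /= add0n count_map; apply: eq_count.
have c0 : count (predI (fun i => i \in J) Q) s = 0.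
  apply/eqP; rewrite -leqn0 leqNgt -has_count.
  apply/hasP => -[i _ /= /and3P[iJ i0 iJ']].
  by have := Jgap _ _ iJ' iJ; lia.
have cU : count (predC P) s = count (predU (fun i => i \in J) Q) s.
  apply: eq_count => i; rewrite /P /Q /=.
  by case: (i \in J) => //=; case: eqP => //= _; rewrite negbK.
have := count_predUI (fun i => i \in J) Q s; have := count_predC P s.
by rewrite cU size_iota cJ cQ c0 addn0 => <- ->; rewrite mul2n addnn.
Qed.

Lemma xpt_inj n i j : i <= n.+1 -> j <= n.+1 -> xpt n i = xpt n j -> i = j.
Proof.
rewrite /xpt => hi hj; case: (i =P 0) => [->|i0]; case: (j =P 0) => [->|j0] //.
- by case: ifP.
- by case: ifP.
- by case: ifP => hi'; case: ifP => hj' //; [case|move=> _; lia].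
Qed.

Lemma xpt_bdry m n b i : i <= n.+1 -> on_bdry m.+1 n b (xpt n i).
Proof. by rewrite /xpt; case: eqP => // i0; case: ifP => //=; lia. Qed.

Lemma rpos_xpt m n b i : i <= n.+1 -> rpos m n b (xpt n i) = i.
Proof.
rewrite /xpt /rpos => hi; case: (i =P 0) => [->//|i0].
by case: (leqP i n) => hi'; case: eqP => [//|_ /=]; lia.
Qed.

Lemma has_e_sym C j : has_e C j ->
  mate C (xpt (nt C) j) = xpt (nt C) j.+1 /\
  mate C (xpt (nt C) j.+1) = xpt (nt C) j.
Proof. by move=> /eqP e; rewrite -e mateK. Qed.

(** The place in psi_n^{-1}(J) *_v C' of a boundary point of C': top points climb along the strands
    to the free x_i, side points are shifted by the height 1 of the top factor. *)
Definition topmap (n : nat) (J : {fset nat}) (p : point) : point :=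
  match p with
  | Top k => xpt n (nth 0 (free_idx n J) k.-1)
  | Bot k => Bot k
  | Lft k => Lft k.+1
  | Rgt k => Rgt k.+1
  end.

Section TopMap.

Variables (n m b : nat) (J : {fset nat}).
Hypothesis UJ : in_U n J.
Let a := size (free_idx n J).

Lemma topmap_bdry p : on_bdry m a b p -> on_bdry m.+1 n b (topmap n J p).
Proof.
case: p => k //= hk; last 2 first; do ?lia.
have : nth 0 (free_idx n J) k.-1 \in free_idx n J.
  by apply: nth_free_idx; rewrite -/a; lia.
by rewrite mem_free_idx => /and3P[_ _ le]; exact: xpt_bdry.
Qed.

Lemma topmap_mono :
  pos_mono (on_bdry m a b) (bdry_pos m a b) (rpos m.+1 n b) (topmap n J).
Proof.
have rT k : 0 < k <= a -> rpos m.+1 n b (topmap n J (Top k)) =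
      nth 0 (free_idx n J) k.-1 /\ nth 0 (free_idx n J) k.-1 <= n.+1.
  move=> hk; have : nth 0 (free_idx n J) k.-1 \in free_idx n J.
    by apply: nth_free_idx; rewrite -/a; lia.
  by rewrite mem_free_idx => /and3P[_ _ le]; rewrite rpos_xpt.
have rR k : 0 < k -> rpos m.+1 n b (topmap n J (Rgt k)) = n + k.+1 by [].
have rB k : rpos m.+1 n b (topmap n J (Bot k)) = n + m.+1 + (b.+1 - k) by [].
have rL k : 0 < k ->
    rpos m.+1 n b (topmap n J (Lft k)) = n + m.+1 + b + (m.+2 - k.+1).
  by rewrite /rpos /=; case: eqP => // -[->].
move=> [i|i|i|i] [j|j|j|j] /= hi hj lt; rewrite ?rR ?rB ?rL; try lia.
- case: (rT _ hi) (rT _ hj) => -> _ [-> _]; apply: free_idx_lt; rewrite -/a;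
  lia.
- by case: (rT _ hi) => ->; lia.
- by case: (rT _ hi) => ->; lia.
- by case: (rT _ hi) => ->; lia.
Qed.

Lemma topmap_cases p : on_bdry m.+1 n b p ->
  (exists2 p', on_bdry m a b p' & topmap n J p' = p) \/
  (exists2 j, j \in J & p = xpt n j \/ p = xpt n j.+1).
Proof.
have xP i : i <= n.+1 -> p = xpt n i ->
    (exists2 p', on_bdry m a b p' & topmap n J p' = p) \/
    (exists2 j, j \in J & p = xpt n j \/ p = xpt n j.+1).
  move=> hi ->; case: (boolP (i \in free_idx n J)) => [fi|].
    left; exists (Top (index i (free_idx n J)).+1);
      last by rewrite /= nth_index.
    by rewrite /= index_mem.
  rewrite mem_free_idx hi andbT negb_and negb_or !negbK =>
    /orP[iJ|/andP[i0 iJ]].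
    by right; exists i => //; left.
  by right; exists i.-1 => //; right; rewrite prednK // lt0n.
case: p xP => i xP /= hi.
- by apply: (xP i); rewrite /xpt; [lia|case: eqP => [|_];
  [lia|case: ifP => //; lia]].
- by left; exists (Bot i).
- case: (i =P 1) => [e|ne]; first by apply: (xP 0); rewrite ?e.
  by left; exists (Lft i.-1); rewrite /= ?prednK //; lia.
- case: (i =P 1) => [e|ne]; last first.
    by left; exists (Rgt i.-1); rewrite /= ?prednK //; lia.
  by apply: (xP n.+1); rewrite // e /xpt ltnn.
Qed.

Lemma topmap_free p i : on_bdry m a b p -> i <= n.+1 ->
  topmap n J p = xpt n i -> i \in free_idx n J.
Proof.
have hx j : j <= n.+1 -> (exists k, xpt n j = Top k) \/
    (xpt n j = Lft 1 \/ xpt n j = Rgt 1).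
  rewrite /xpt; case: eqP => [_|_ _]; first by right; left.
  by case: ifP; [left; exists j|right; right].
move=> + hi; case: p => k /= hk.
- move/xpt_inj => <- //; first by apply: nth_free_idx; rewrite -/a; lia.
  have : nth 0 (free_idx n J) k.-1 \in free_idx n J.
    by apply: nth_free_idx; rewrite -/a; lia.
  by rewrite mem_free_idx => /and3P[].
- by case: (hx _ hi) => [[l ->]|[->|->]].
- by case: (hx _ hi) => [[l ->]|[->|->]] // [e]; lia.
- by case: (hx _ hi) => [[l ->]|[->|->]] // [e]; lia.
Qed.

Lemma topmap_not_e p j : on_bdry m a b p -> j \in J ->
  topmap n J p <> xpt n j /\ topmap n J p <> xpt n j.+1.
Proof.
case: UJ => _ Jn _ Bp jJ; have hj := Jn _ jJ.
split=> /(topmap_free Bp); rewrite mem_free_idx jJ /=; last by rewrite andbF;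
  lia.
by move=> H; have := H (leqW hj).
Qed.

Lemma topmap_inj : {in on_bdry m a b &, injective (topmap n J)}.
Proof. by apply: pos_mono_inj topmap_mono => p q; exact: bdry_pos_inj. Qed.

End TopMap.

(* [extT J C' C] holds if C = psi_n^{-1}(J) *_v C'. *)
Definition extT (J : {fset nat}) (C' C : connection) : Prop :=
  let n := nt C in
  [/\ in_U n J,
      [/\ ht C = (ht C').+1, nt C' = size (free_idx n J) & nb C' = nb C],
      forall j, j \in J -> has_e C j
    & forall p, bdry C' p -> mate C (topmap n J p) = topmap n J (mate C' p)].

Lemma extT_bdry J C' C : extT J C' C ->
  bdry C' =1 on_bdry (ht C') (size (free_idx (nt C) J)) (nb C).
Proof. by case=> _ [_ e1 e2] _ _ p; rewrite /bdry e1 e2. Qed.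

Lemma extT_embeds J C' C : extT J C' C -> embeds (topmap (nt C) J) C' C.
Proof.
move=> E; have BE := extT_bdry E; case: E => UJ [e1 e2 e3] _ mE; split=> //.
- by move=> p; rewrite BE /bdry e1 => /topmap_bdry; apply.
- move=> p q Bp Bq; apply: (@topmap_inj (nt C) (ht C') (nb C) J p q).
    exact: etrans (esym (BE p)) Bp.
  exact: etrans (esym (BE q)) Bq.
Qed.

Lemma extT_uniq_below J C1 C2 C : extT J C1 C -> extT J C2 C -> C1 = C2.
Proof.
move=> E1 E2; have [_ i1 m1] := extT_embeds E1; have [_ _ m2] := extT_embeds E2.
have B1 := extT_bdry E1; have B2 := extT_bdry E2.
case: E1 E2 => U1 [h1 n1 b1] _ _ [_ [h2 n2 b2] _ _].
have BE : bdry C2 =1 bdry C1 by move=> p; rewrite B1 B2; congr on_bdry; lia.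
apply: connection_eq; [lia|lia|lia|move=> p Bp].
have Bp2 : bdry C2 p by rewrite BE.
apply: i1; [exact: mate_bdry| |by rewrite -m1 // -m2].
by apply: etrans (esym (BE _)) _; exact: mate_bdry.
Qed.

Lemma extT_uniq_above J C' C1 C2 : extT J C' C1 -> extT J C' C2 ->
  nt C1 = nt C2 -> C1 = C2.
Proof.
move=> E1 E2 e; have [_ _ m1] := extT_embeds E1;
  have [_ _ m2] := extT_embeds E2.
have B1 := extT_bdry E1.
case: E1 E2 => U1 [h1 n1 b1] J1 _ [_ [h2 n2 b2] J2 _].
apply: connection_eq; [lia|lia|lia|move=> p Bp].
case: (@topmap_cases (nt C1) (ht C') (nb C1) J p) => [|[p' Bp' <-]|[j jJ]].
- by rewrite -h1.
- by rewrite -B1 in Bp'; rewrite m1 // {2}e m2 // e.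
- have [ex1 ey1] := has_e_sym (J1 j jJ); have [ex2 ey2] := has_e_sym (J2 j jJ).
  by case=> ->; rewrite ?ex1 ?ey1 e ?ex2 ?ey2.
Qed.

(** In the rotated order the ends of e_j are consecutive, so no point lies under a new arc and
    planarity is immediate. *)
Lemma extT_insert n J C' : in_U n J -> nt C' = size (free_idx n J) ->
  exists2 C, nt C = n & extT J C' C.
Proof.
move=> UJ eC'; have [_ Jn Jgap] := UJ.
set m := ht C'; set b := nb C'.
have BE : bdry C' =1 on_bdry m (size (free_idx n J)) b.
  by move=> p; rewrite /bdry eC'.
(* For [rpos] the point x_i has position i. A new point is x_j or x_{j+1} with j in J, and
   membership of its position in J tells which. *)
pose arc p := let i := rpos m.+1 n b p in
  if i \in J then xpt n i.+1 else xpt n i.-1.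
have arcE j : j \in J -> arc (xpt n j) = xpt n j.+1 /\ arc (xpt n j.+1) = xpt n
  j.
  move=> jJ; have hj := Jn _ jJ; have hj' := leqW hj;
    rewrite /arc !rpos_xpt ?jJ //.
  by split=> //; case: ifP => // jJ'; have := Jgap _ _ jJ jJ'; lia.
have niE p : on_bdry m.+1 n b p ->
    ~ (exists2 p', bdry C' p' & topmap n J p' = p) ->
    exists2 j, j \in J & p = xpt n j \/ p = xpt n j.+1.
  move=> Bp ni; case: (topmap_cases J Bp) => // -[p' Bp' e]; case: ni.
  by exists p' => //; rewrite BE.
have eNi j : j \in J -> ~ (exists2 p', bdry C' p' & topmap n J p' = xpt n j) /\
                    ~ (exists2 p', bdry C' p' & topmap n J p' = xpt n j.+1).
  by move=> jJ; split=> -[p']; rewrite BE => /(topmap_not_e UJ) /(_ jJ) [].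
have := @insert_arcs C' m.+1 n b (topmap n J) arc (rpos m.+1 n b).
case=> [M MB MK|p|p q|p Bp /(niE _ Bp)[j jJ jE]|p q Bp /(niE _ Bp)[j jJ jE]
  Bq|].
- by apply: (proj1 (noncrossing_rot _ MB MK)).
- by rewrite BE; exact: topmap_bdry.
- rewrite !BE /bpos eC'; exact: topmap_mono.
- have [e1 e2] := arcE _ jJ; have [n1 n2] := eNi _ jJ; have hj := Jn _ jJ.
  case: jE => ->; rewrite ?e1 ?e2; split=> //; try by apply: xpt_bdry; lia.
    by move/xpt_inj; lia.
  by move/xpt_inj; lia.
- have [e1 e2] := arcE _ jJ; have hj := Jn _ jJ.
  by case: jE => ->; rewrite ?e1 ?e2 !rpos_xpt; lia.
- move=> C [[e1 e2 e3] mC aC]; exists C => //; split; rewrite ?e2 //.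
  move=> j jJ; have [e _] := arcE _ jJ; have [ni _] := eNi _ jJ.
  by rewrite /has_e e2 aC ?e //; apply: xpt_bdry; have := Jn _ jJ; lia.
Qed.

(** The ends of each removed e_j are mates of each other, so the mate of a remaining point
    remains. *)
Lemma extT_remove J C : 0 < ht C -> in_U (nt C) J ->
  (forall j, j \in J -> has_e C j) -> exists C', extT J C' C.
Proof.
move=> hC UJ eJ; set n := nt C; case eh: (ht C) hC => [//|m] _.
have BC : bdry C =1 on_bdry m.+1 n (nb C) by move=> p; rewrite /bdry eh.
have := @remove_arcs C m (size (free_idx n J)) (nb C) (topmap n J)
  (rpos m.+1 n (nb C)).
case=> [|p Bp|p q Bp Bq|p Bp|C' [e1 e2 e3 mC]].
- have nc : noncrossing (bdry C) (bpos C) (mate C).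
    by move=> p q Bp Bq; exact: mate_planar.
  rewrite /noncrossing => p q; rewrite !BC.
  apply: (proj2 (@noncrossing_rot m.+1 n (nb C) (mate C) _ _ _)) => //.
  + by move=> r; rewrite -!BC; exact: mate_bdry.
  + by move=> r _; rewrite mateK.
  + by move=> r s; rewrite -!BC => Br Bs; have := nc r s Br Bs;
    rewrite /bpos eh.
- by rewrite BC; exact: topmap_bdry.
- exact: topmap_mono.
- case: (@topmap_cases n m (nb C) J (mate C (topmap n J p))).
  + by rewrite -BC; apply: mate_bdry; rewrite BC; exact: topmap_bdry.
  + by case=> q Bq <-; exists q.
  + case=> j jJ; have [ex ey] := has_e_sym (eJ j jJ).
    have [n1 n2] := topmap_not_e UJ Bp jJ.
    by case=> e; [case: n2|case: n1]; rewrite -[LHS](mateK C) e.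
- by exists C'; split=> //; rewrite e1.
Qed.

Lemma outer_xpt S i : 0 < ht S -> outer S (xpt (nt S) i) = inl (xpt (nt S) i).
Proof. by rewrite /xpt => h; case: eqP => _ /=; [|case: ifP => _ /=];
  rewrite ?h. Qed.

(** Associativity for psi_n^{-1}(J) *_v R1 *_v F without gluing three rectangles: the arcs e_j stay
    inside the top factor, so [vprod_embed] applies with the identity on F. *)
Lemma vprod_extT J R1 R F X C : extT J R1 R -> extT J X C -> nt R = nt C ->
  is_vprod R F C <-> is_vprod R1 F X.
Proof.
move=> ER EX eN.
have H : is_vprod R F C \/ is_vprod R1 F X -> [/\ nb R1 = nt F,
    [/\ ht C = ht R + ht F, nt C = nt R & nb C = nb F] &
    [/\ ht X = ht R1 + ht F, nt X = nt R1 & nb X = nb F]].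
  case: (ER) (EX) => _ [h1 h2 h3] _ _ [_ [h4 h5 h6] _ _].
  rewrite -eN in h5.
  by case=> -[n1 [n2 n3 n4] _]; do !split; lia.
(* Either side of the equivalence yields all equalities of dimensions, so one of them may be
   assumed. *)
suff K : is_vprod R F C \/ is_vprod R1 F X -> is_vprod R F C <-> is_vprod R1 F
  X.
  by split=> V; apply K; auto.
move=> /H [n1 eC eX].
have fR := extT_embeds ER; have fX := extT_embeds EX.
have BR := extT_bdry ER; have BX := extT_bdry EX.
case: (ER) (EX) => UR [h1 h2 h3] eR _ [UX [h4 h5 h6] eXe _].
have hR : 0 < ht R by rewrite h1.
apply: (@vprod_embed R1 F R F (topmap (nt R) J) id _ _ _ _ _ _ X C
  (topmap (nt R) J)) => //; first exact: embeds_id.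
- move=> p Bp; case: fX => fX1 _ fX3; rewrite eN; split;
  [exact: fX1| |exact: fX3].
  case: eX => hX nX bX; case: p Bp => k Bp /=; rewrite ?eN //.
  + by rewrite -eN outer_xpt.
  + by rewrite h1 ltnS; case: ifP => //= _; rewrite subSS.
  + by rewrite h1 ltnS; case: ifP => //= _; rewrite subSS.
- move=> p Bp; have [|[p' Bp' e]|[j jJ jE]] :=
  @topmap_cases (nt C) (ht X) (nb C) J p.
  + by rewrite -h4.
  + by left; exists p'; rewrite ?BX // eN.
  + right; have [ex1 ey1] := has_e_sym (eR j jJ).
    have [ex2 ey2] := has_e_sym (eXe j jJ).
    split; last first.
      by case: jE => ->; rewrite ?ex2 ?ey2 -eN !outer_xpt //= ?ex1 ?ey1.
    have ni q : bdry R1 q -> topmap (nt R) J q <> xpt (nt R) j /\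
                             topmap (nt R) J q <> xpt (nt R) j.+1.
      by rewrite BR => Bq; exact: (topmap_not_e UR Bq jJ).
    by case: jE => ->; rewrite -eN outer_xpt // => -[[q|q] //= Bq [] e];
      case: (ni q Bq).
Qed.

(** * Products with bottom states *)

(** The foot of the k-th through strand. The default 0 is not reached for a bottom state and 0 < k
    <= nt T. *)
Definition tau (T : connection) (k : nat) : nat :=
  if mate T (Top k) is Bot j then j else 0.

Definition botmap (T : connection) (p : point) : point :=
  if p is Bot k then Bot (tau T k) else p.

Section BottomState.

Variable T : connection.
Hypothesis bT : bottom T.

Lemma bottom_bdry p : bdry T p ->
  (exists2 k, p = Top k & 0 < k <= nt T) \/ (exists2 j,
    p = Bot j & 0 < j <= nb T).
Proof.
case: bT => _ h0; case: p => i Bp; first by left; exists i.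
- by right; exists i.
- by move: Bp; rewrite /bdry /= h0; lia.
- by move: Bp; rewrite /bdry /= h0; lia.
Qed.

Lemma tauP k : 0 < k <= nt T ->
  [/\ mate T (Top k) = Bot (tau T k), mate T (Bot (tau T k)) = Top k
    & 0 < tau T k <= nb T].
Proof.
move=> hk; have Bk : bdry T (Top k) by [].
case: (bottom_bdry (mate_bdry Bk)) => [[l e _]|[j e hj]].
  by case: bT => /(_ k); rewrite /top_return e hk.
by rewrite /tau e -e mateK e.
Qed.

Lemma bot_cases j : 0 < j <= nb T ->
  (exists2 k, 0 < k <= nt T & j = tau T k) \/
  (exists i, [/\ mate T (Bot j) = Bot i, bot_return T j & 0 < i <= nb T]).
Proof.
move=> hj; have Bj : bdry T (Bot j) by [].
case: (bottom_bdry (mate_bdry Bj)) => [[k e hk]|[i e hi]].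
  by left; exists k => //; rewrite /tau -e mateK.
by right; exists i; rewrite e /bot_return e hj.
Qed.

Lemma tau_not_return k : 0 < k <= nt T -> ~~ bot_return T (tau T k).
Proof. by case/tauP => _ e _; rewrite /bot_return e. Qed.

Lemma tau_mono k l : 0 < k -> k < l -> l <= nt T -> tau T k < tau T l.
Proof.
move=> k0 kl lT; have hk : 0 < k <= nt T by lia.
have hl : 0 < l <= nt T by lia.
have [ek fk bk] := tauP hk; have [el fl bl] := tauP hl.
have := @mate_planar T (Top k) (Top l) hk hl; rewrite ek el /=.
have : tau T k <> tau T l.
  by move=> e; move: fl; rewrite -e fk => -[ekl]; lia.
lia.
Qed.

Lemma botmap_bdry m a p : on_bdry m a (nt T) p -> on_bdry m a (nb T) (botmap T
  p).
Proof. by case: p => k //= /tauP[]. Qed.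

Lemma botmap_mono m a : pos_mono (on_bdry m a (nt T))
  (bdry_pos m a (nt T)) (bdry_pos m a (nb T)) (botmap T).
Proof.
move=> [i|i|i|i] [j|j|j|j] /= hi hj lt; try lia.
- by case: (tauP hj) => _ _; lia.
- case: (tauP hi) (tauP hj) => _ _ bi [_ _ bj].
  have : tau T j < tau T i by apply: tau_mono; lia.
  lia.
- by case: (tauP hi) => _ _; lia.
- by case: (tauP hj) => _ _; lia.
Qed.

Lemma botmap_inj m a : {in on_bdry m a (nt T) &, injective (botmap T)}.
Proof. by apply: pos_mono_inj (@botmap_mono m a) => p q;
  exact: bdry_pos_inj. Qed.

Lemma botmap_cases m a p : on_bdry m a (nb T) p ->
  (exists2 p', on_bdry m a (nt T) p' & botmap T p' = p) \/
  (exists j i, [/\ p = Bot j, mate T p = Bot i,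
    bot_return T j & bot_return T i]).
Proof.
case: p => k hk; [by left; exists (Top k)| |by left; exists (Lft k)|by left;
  exists (Rgt k)].
case: (bot_cases hk) => [[l hl ->]|[i [e rj hi]]].
  by left; exists (Bot l).
right; exists k, i; split=> //; rewrite /bot_return -e mateK.
by case/andP: hi => -> ->.
Qed.

Lemma botmap_not_return m a p j : on_bdry m a (nt T) p -> bot_return T j ->
  botmap T p <> Bot j.
Proof. by case: p => k //= hk rj [e]; move: rj;
  rewrite -e (negbTE (tau_not_return hk)). Qed.

End BottomState.

(* [extB T C' C] holds if C = C' *_v T, where T is a bottom state. *)
Definition extB (T C' C : connection) : Prop :=
  [/\ bottom T,
      [/\ ht C = ht C', nt C = nt C', nb C' = nt T & nb C = nb T],
      forall i, bot_return T i -> mate C (Bot i) = mate T (Bot i)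
    & forall p, bdry C' p -> mate C (botmap T p) = botmap T (mate C' p)].

Lemma extB_bdry T C' C : extB T C' C ->
  bdry C' =1 on_bdry (ht C) (nt C) (nt T).
Proof. by case=> _ [e1 e2 e3 e4] _ _ p; rewrite /bdry e1 e2 e3. Qed.

Lemma extB_embeds T C' C : extB T C' C -> embeds (botmap T) C' C.
Proof.
move=> E; have BE := extB_bdry E; case: E => bT [e1 e2 e3 e4] _ mE; split=> //.
- by move=> p; rewrite BE /bdry e4; exact: botmap_bdry.
- move=> p q Bp Bq; apply: (@botmap_inj T bT (ht C) (nt C) p q).
    exact: etrans (esym (BE p)) Bp.
  exact: etrans (esym (BE q)) Bq.
Qed.

Lemma extB_uniq_below T C1 C2 C : extB T C1 C -> extB T C2 C -> C1 = C2.
Proof.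
move=> E1 E2; have [_ i1 m1] := extB_embeds E1; have [_ _ m2] := extB_embeds E2.
have B1 := extB_bdry E1; have B2 := extB_bdry E2.
have BE : bdry C2 =1 bdry C1 by move=> p; rewrite B1 B2.
case: E1 E2 => _ [h1 n1 b1 _] _ _ [_ [h2 n2 b2 _] _ _].
apply: connection_eq; [lia|lia|lia|move=> p Bp].
have Bp2 : bdry C2 p by rewrite BE.
apply: i1; [exact: mate_bdry| |by rewrite -m1 // -m2].
by apply: etrans (esym (BE _)) _; exact: mate_bdry.
Qed.

Lemma extB_uniq_above T C' C1 C2 : extB T C' C1 -> extB T C' C2 -> C1 = C2.
Proof.
move=> E1 E2; have [_ _ m1] := extB_embeds E1; have [_ _ m2] := extB_embeds E2.
have B1 := extB_bdry E1.
case: E1 E2 => bT [h1 n1 b1 f1] J1 _ [_ [h2 n2 b2 f2] J2 _].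
apply: connection_eq; [lia|lia|lia|move=> p Bp].
case: (@botmap_cases T bT (ht C1) (nt C1) p) =>
  [|[p' Bp' <-]|[j [i [-> _ rj _]]]].
- by rewrite -f1.
- by rewrite -B1 in Bp'; rewrite m1 // m2.
- by rewrite J1 ?J2.
Qed.

(** The new arcs are the bottom returns of T. Their nesting condition is inherited from the
    planarity of T. *)
Lemma extB_insert T C' : bottom T -> nb C' = nt T -> exists C, extB T C' C.
Proof.
move=> bT eC'; set m := ht C'; set a := nt C'.
have BE : bdry C' =1 on_bdry m a (nt T) by move=> p; rewrite /bdry eC'.
have niE p : on_bdry m a (nb T) p ->
    ~ (exists2 p', bdry C' p' & botmap T p' = p) ->
    exists j i, [/\ p = Bot j, mate T p = Bot i,
      bot_return T j & bot_return T i].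
  move=> Bp ni; case: (botmap_cases bT Bp) => // -[p' Bp' e]; case: ni.
  by exists p' => //; rewrite BE.
have rNi j : bot_return T j -> ~ (exists2 p', bdry C' p' & botmap T p' = Bot j).
  by move=> rj [p']; rewrite BE => /(botmap_not_return bT) /(_ rj).
have rB j : bot_return T j -> 0 < j <= nb T.
  by rewrite /bot_return; case: (mate _ _).
have := @insert_arcs C' m a (nb T) (botmap T) (mate T) (bdry_pos m a (nb T)).
case=> [//|p|p q|p Bp /(niE _ Bp)[j [i [-> e rj ri]]]
       |p q Bp /(niE _ Bp)[j [i [-> e rj ri]]] Bq lt|].
- by rewrite BE; exact: botmap_bdry.
- rewrite !BE /bpos eC'; exact: botmap_mono.
- rewrite e -e mateK e; split=> //; try exact: rNi.
    exact: rB.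
  by rewrite -e; apply: mate_neq; exact: rB.
- rewrite e /= in lt *; have hj := rB _ rj; have hi := rB _ ri.
  case: q Bq lt => l /= hl lt; try lia.
  have := @mate_planar T (Bot j) (Bot l) hj hl; rewrite e /=.
  (* A through strand of T ending between the ends of a return would cross it. *)
  case: (bot_cases bT hl) => [[k hk el]|[l' [el rl hl']]].
    have [ek fk bk] := tauP bT hk.
    have := @mate_planar T (Top k) (Bot j) hk hj; rewrite ek -el e /=; lia.
  by rewrite el /=; split; [exact: rNi|lia].
- move=> C [[e1 e2 e3] mC aC]; exists C; split=> //.
  move=> i ri; apply: aC; [exact: rB|exact: rNi].
Qed.

Lemma extB_remove T C : bottom T -> nb C = nb T ->
  (forall i, bot_return T i -> mate C (Bot i) = mate T (Bot i)) ->
  exists C', extB T C' C.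
Proof.
move=> bT eC rE; set m := ht C; set a := nt C.
have BC : bdry C =1 on_bdry m a (nb T) by move=> p; rewrite /bdry eC.
have := @remove_arcs C m a (nt T) (botmap T) (bdry_pos m a (nb T)).
case=> [p q Bp Bq|p Bp||p Bp|C' [e1 e2 e3 mC]].
- by have := @mate_planar C p q Bp Bq; rewrite eC.
- by rewrite BC; exact: botmap_bdry.
- exact: botmap_mono.
- case: (@botmap_cases T bT m a (mate C (botmap T p))).
  + by rewrite -BC; apply: mate_bdry; rewrite BC; exact: botmap_bdry.
  + by case=> q Bq <-; exists q.
  + case=> j [i [ej ei rj ri]]; have := rE _ rj; rewrite -ej ei mateK.
    by move/(botmap_not_return bT Bp ri).
- by exists C'; split=> //; rewrite e1.
Qed.

(** Associativity for S *_v G *_v T, the mirror image of [vprod_extT]: the returns of T stay inside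
    the lower factor. *)
Lemma vprod_extB T G F S X C : extB T G F -> extB T X C ->
  is_vprod S F C <-> is_vprod S G X.
Proof.
move=> EG EX.
have H : is_vprod S F C \/ is_vprod S G X -> [/\ nb S = nt G,
    [/\ ht C = ht S + ht F, nt C = nt S & nb C = nb F] &
    [/\ ht X = ht S + ht G, nt X = nt S & nb X = nb G]].
  case: (EG) (EX) => _ [h1 h2 h3 h4] _ _ [_ [h5 h6 h7 h8] _ _].
  by case=> -[n1 [n2 n3 n4] _]; do !split; lia.
suff K : is_vprod S F C \/ is_vprod S G X -> is_vprod S F C <-> is_vprod S G X.
  by split=> V; apply K; auto.
move=> /H [n1 eC eX].
have fG := extB_embeds EG; have fX := extB_embeds EX.
have BG := extB_bdry EG; have BX := extB_bdry EX.
case: (EG) (EX) => bT [h1 h2 h3 h4] eG _ [_ [h5 h6 h7 h8] eXe _].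
apply: (@vprod_embed S G S F id (botmap T) _ _ _ _ _ _ X C (botmap T)) => //;
  first exact: embeds_id.
- move=> p Bp; case: fX => fX1 _ fX3; split; [exact: fX1| |exact: fX3].
  by case: p Bp => k Bp //=; case: ifP.
- move=> p Bp; have [|[p' Bp' e]|[j [i [ej ei rj ri]]]] :=
  @botmap_cases T bT (ht C) (nt C) p.
  + by rewrite -h8.
  + by left; exists p'; rewrite ?BX.
  + right; subst p; rewrite eXe //= eG // ei /=; split=> //.
    case=> -[q|q] //= Bq [] e; rewrite BG in Bq.
    exact: (botmap_not_return bT Bq rj e).
Qed.

(** T arises from the identity by inserting its own returns. Associativity then reduces the claim to
    the product of C' with the identity. *)
Lemma vprod_bottom T C' C : extB T C' C -> is_vprod C' T C.
Proof.
move=> E; case: (E) => bT [h1 h2 h3 h4] _ _.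
have [e0 e1 e2 me] := idcP (nt T); have BT p := bottom_bdry bT (p := p).
have ET : extB T (idc (nt T)) T.
  split=> //; first by split=> //; case: bT => _; lia.
  move=> p; rewrite /bdry e0 e1 e2; case: p => k //= hk; try lia.
    by have [-> _] := me k hk; have [-> _ _] := tauP bT hk.
  by have [_ ->] := me k hk; have [_ -> _] := tauP bT hk.
by apply/(vprod_extB _ ET E); rewrite -h3; exact: vprod_idc_r.
Qed.

Lemma vprod_bottomP T C' C : bottom T -> is_vprod C' T C -> extB T C' C.
Proof.
move=> bT V; case: (V) => n1 _ _; have [D ED] := extB_insert bT n1.
by rewrite (is_vprod_uniq V (vprod_bottom ED)).
Qed.

(** psi_n^{-1}(J) is the identity with the arcs e_j inserted. Its defining conditions determine the
    mates of all points, so uniqueness follows from [extT_uniq_above]. *)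
Lemma psi_inv_exists n J : in_U n J -> exists P,
  [/\ psi_inv n J = Some P, nt P = n & extT J (idc (size (free_idx n J))) P].
Proof.
move=> UJ; set a := size _; have [e0 e1 e2 me] := idcP a.
have [P nP EP] := extT_insert UJ e1.
exists P; split=> //; apply: the_Some.
  case: (EP) => _ [h1 h2 h3] eJ mE; have sz := size_free_idx UJ;
    rewrite -/a in sz.
  split=> //.
  - split; rewrite // ?h1 ?e0 -?h3 ?e2 -/a //.
    + move=> i; rewrite /bot_return -h3 e2;
      case: (boolP (0 < i <= a)) => [hi|_].
        have := mE (Bot i); rewrite /bdry /= e2 => /(_ hi).
        have [_ -> ->] := me i hi.
        by rewrite /= /xpt; case: ifP => // _; case: ifP.
      by case: (mate _ _).
    + have J0 : 0 < #|` J| by rewrite cardfs_gt0; case: UJ.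
      by move: sz; lia.
  - move=> k hk; have := mE (Top k.+1); rewrite /bdry /= e1 nP => -> //.
    by have [-> _] := me k.+1 hk.
move=> T [_ [rT hT nT bT] eJ fE]; have sz := size_free_idx UJ;
  rewrite -/a in sz.
have J0 : 0 < #|` J| by rewrite cardfs_gt0; case: UJ.
have ba : nb T = a by lia.
apply: (@extT_uniq_above J (idc a)) => //; last by rewrite nP.
split; rewrite ?nT ?hT ?e0 ?e1 ?e2 //.
have fE' k : 0 < k <= a -> mate T (topmap n J (Top k)) = Bot k.
  by move=> hk; rewrite /= fE ?prednK -/a //; lia.
move=> p; rewrite /bdry e0 e1 e2; case: p => k hk //=; try by move: hk => /=;
  lia.
  by have [-> _] := me k hk; exact: fE'.
by have [_ ->] := me k hk; rewrite -(fE' k hk) mateK.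
Qed.

(** For uniqueness, another solution D is extended by J to some D'. Both D' and C are the product of
    psi_n^{-1}(J) and D, so they agree, and [extT] determines its lower term. *)
Lemma rem_top_extT J C' C : extT J C' C -> rem_top C J = Some C'.
Proof.
move=> E; case: (E) => UJ [h1 h2 h3] _ _.
have [P [eP nP EP]] := psi_inv_exists UJ.
have V D D' : nt D = size (free_idx (nt C) J) -> extT J D D' -> nt D' = nt C ->
    is_vprod P D D'.
  move=> nD ED nD'; apply/(vprod_extT D EP ED); rewrite ?nP //.
  by rewrite -nD; exact: vprod_idc_l.
rewrite /rem_top eP; apply: the_Some; first exact/vprod_SomeP/V.
move=> D /vprod_SomeP VD; have nD : nt D = size (free_idx (nt C) J).
  case: (VD) => <- _ _; case: EP => _ [_ _ <-] _ _.
  by case: (idcP (size (free_idx (nt C) J))).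
have [D' nD' ED'] := extT_insert UJ nD.
have eD : D' = C by exact: is_vprod_uniq (V _ _ nD ED' nD') VD.
by rewrite eD in ED'; exact: extT_uniq_below ED' E.
Qed.

(** * Index sets of bottom states *)

Lemma phiP T i : reflect
  (exists k, [/\ mate T (Bot i) = Bot k, i < k & 0 < i <= nb T]) (i \in phi T).
Proof.
rewrite /phi !inE /= mem_iota; apply: (iffP andP).
  case=> hi; case e: (mate T (Bot i)) => [|k||] // lt.
  by exists k; split=> //; lia.
by case=> k [-> lt hi]; split=> //; lia.
Qed.

Lemma return_inside T i k l : bottom T -> mate T (Bot i) = Bot k -> i < l < k ->
  0 < i -> k <= nb T -> exists2 l', mate T (Bot l) = Bot l' & i < l' < k.
Proof.
move=> bT e lt i0 hk; have e' : mate T (Bot k) = Bot i by rewrite -e mateK.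
have hl : 0 < l <= nb T by lia.
have Bk : bdry T (Bot k) by rewrite /bdry /=; lia.
have := @mate_planar T (Bot k) (Bot l) Bk hl; rewrite e' /=.
have := @mate_planar T _ (Bot k) (mate_bdry (hl : bdry T (Bot l))) Bk.
rewrite e' mateK; case: (bottom_bdry bT (mate_bdry (hl : bdry T (Bot l)))).
  by case=> j -> hj /=; lia.
case=> j ej hj; rewrite ej /= => h1 h2; exists j => //.
have : j <> i by move=> ji; move: ej; rewrite ji -e' => /(mate_inj)[]; lia.
have : j <> k by move=> jk; move: ej; rewrite jk -e => /(mate_inj)[]; lia.
lia.
Qed.

(** Induction on the length of the return. Let T' join i to k'. If k' < k, the shorter return of T'
    occurs in T too, a contradiction. If k < k', then T' joins k to a point l between i and k', and
    l < k because k is not a left end. So l is a left end in T as well; its return in T is nested in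
    i, k, hence shorter and ends before k, and by induction it occurs in T'. *)
Lemma phi_return d T T' i k : bottom T -> bottom T' -> nb T = nb T' ->
  phi T = phi T' -> k - i <= d -> i < k -> mate T (Bot i) = Bot k ->
  mate T' (Bot i) = Bot k.
Proof.
elim: d T T' i k => [|d IH] T T' i k bT bT' eb ep le lt e; first lia.
have Bi : bdry T (Bot i).
  by apply: contraPT e => /mate_off -> [ik]; lia.
have := mate_bdry Bi; rewrite e => Bk.
have : i \in phi T by apply/phiP; exists k.
rewrite ep => /phiP[k' [e' lt' hi]].
case: (ltngtP k k') => kk; last by rewrite kk.
- have [l el hl] : exists2 l', mate T' (Bot k) = Bot l' & i < l' < k'.
    apply: (return_inside bT' e') => //; try lia.
    by have := mate_bdry (hi : bdry T' (Bot i)); rewrite e' /bdry /=; lia.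
  have lk : l < k.
    rewrite ltnNge leq_eqVlt; apply/negP=> /orP[/eqP kl|kl].
      by apply: (@mate_neq T' (Bot k)); rewrite ?el ?kl // /bdry -?eb // -kl.
    have : k \in phi T' by apply/phiP; exists l; split=> //; rewrite -eb.
    rewrite -ep => /phiP[k2 [ek2 lt2 _]].
    by move: ek2; rewrite -e mateK => -[]; lia.
  have el' : mate T' (Bot l) = Bot k by rewrite -el mateK.
  have : l \in phi T'.
    by apply/phiP; exists k; split=> //; move: Bk; rewrite /bdry /=; lia.
  rewrite -ep => /phiP[k2 [ek2 lt2 hl2]].
  have [l' el2 hl'] : exists2 l', mate T (Bot l) = Bot l' & i < l' < k.
    by apply: (return_inside bT e) => //; move: Bk; rewrite /bdry /=; lia.
  have [k2E] : Bot k2 = Bot l' by rewrite -ek2.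
  have : mate T' (Bot l) = Bot k2 by apply: (IH T) => //; lia.
  by rewrite el' => -[]; lia.
- have : mate T (Bot i) = Bot k' by apply: (IH T') => //; lia.
  by rewrite e => -[]; lia.
Qed.

Lemma phi_return_eq T T' j : bottom T -> bottom T' -> nb T = nb T' ->
  phi T = phi T' -> bot_return T j -> mate T' (Bot j) = mate T (Bot j).
Proof.
move=> bT bT' eb ep; rewrite /bot_return;
  case e: (mate T (Bot j)) => [|i||] // hj.
case: (ltngtP i j) => ij.
- have e' : mate T (Bot i) = Bot j by rewrite -e mateK.
  have : mate T' (Bot i) = Bot j by exact: phi_return (leqnn _) ij e'.
  by move=> <-; rewrite mateK.
- exact: phi_return (leqnn _) ij e.
- by case: (@mate_neq T (Bot j)); rewrite // e ij.
Qed.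

(** The returns agree, so the feet of the through strands form the same set, which both [tau]
    enumerate increasingly. *)
Lemma phi_tau T T' : bottom T -> bottom T' -> nb T = nb T' -> phi T = phi T' ->
  forall k, 0 < k <= nt T -> k <= nt T' /\ tau T' k = tau T k.
Proof.
move=> bT bT' eb ep; have thru U U' k : bottom U -> bottom U' -> nb U = nb U' ->
    phi U = phi U' -> 0 < k <= nt U ->
    exists2 l, 0 < l <= nt U' & tau U k = tau U' l.
  move=> bU bU' eU pU hk; have [e1 e2 e3] := tauP bU hk.
  have h3 : 0 < tau U k <= nb U' by rewrite -eU.
  case: (bot_cases bU' h3) => [//|[i [_ ri _]]].
  have := @phi_return_eq U' U (tau U k) bU' bU (esym eU) (esym pU) ri.
  by rewrite e2 => e; move: ri; rewrite /bot_return -e.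
elim/ltn_ind=> k IH hk.
have [l hl el] := thru T T' k bT bT' eb ep hk.
have kl : k <= l.
  rewrite leqNgt; apply/negP => lk; have [_ e] := IH l lk ltac:(lia).
  by have := @tau_mono T bT l k; lia.
have hk' : 0 < k <= nt T' by lia.
split; first lia.
have [l2 hl2 el2] := thru T' T k bT' bT (esym eb) (esym ep) hk'.
have kl2 : k <= l2.
  rewrite leqNgt; apply/negP => lk; have [h e] := IH l2 lk ltac:(lia).
  by have := @tau_mono T' bT' l2 k; lia.
have m1 : tau T' k <= tau T' l.
  by case: (ltngtP k l) kl => // [h _|->//]; have := @tau_mono T' bT' k l; lia.
have m2 : tau T k <= tau T l2.
  by case: (ltngtP k l2) kl2 => // [h _|->//]; have := @tau_mono T bT k l2; lia.
lia.
Qed.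

Lemma phi_inj T T' : bottom T -> bottom T' -> nb T = nb T' -> phi T = phi T' ->
  T = T'.
Proof.
move=> bT bT' eb ep; have H := phi_tau bT bT' eb ep.
have H' := phi_tau bT' bT (esym eb) (esym ep).
have en : nt T = nt T'.
  apply/eqP; rewrite eqn_leq; apply/andP; split.
    by case: (posnP (nt T)) => [->//|h]; have [] := H (nt T) ltac:(lia).
  by case: (posnP (nt T')) => [->//|h]; have [] := H' (nt T') ltac:(lia).
apply: connection_eq => //; first by case: bT bT' => _ -> [_ ->].
move=> p /(bottom_bdry bT)[[k -> hk]|[j -> hj]].
  have [-> _ _] := tauP bT hk; have [_ <-] := H k hk.
  by have [-> _ _] := tauP bT' (k := k) ltac:(lia).
case: (bot_cases bT hj) => [[k hk ->]|[i [_ rj _]]].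
  have [_ -> _] := tauP bT hk; have [_ <-] := H k hk.
  by have [_ -> _] := tauP bT' (k := k) ltac:(lia).
by rewrite (phi_return_eq bT bT').
Qed.

Lemma phi_inv_Some n I T : is_phi_inv n I T -> phi_inv n I = Some T.
Proof.
move=> H; apply: the_Some => // T'; case: H => bT e1 e2 [bT' e1' e2'].
by apply: phi_inj; rewrite ?e1' ?e2' ?e1 ?e2.
Qed.

Lemma phi_invP n I T : phi_inv n I = Some T -> is_phi_inv n I T.
Proof. exact: the_SomeP. Qed.

(** This removes the choice operators from C_I. It rests on the injectivity of phi for the bottom
    state and on [extB_uniq_below] for the quotient. *)
Lemma rem_botP F I G : rem_bot (Some F) I = Some G <->
  exists2 T, is_phi_inv (nb F) I T & extB T G F.
Proof.
split=> [H|[T PT E]].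
  have {H} := the_SomeP H; case eT: (phi_inv _ _) => [T|] // /vprod_SomeP V.
  have PT := phi_invP eT; exists T => //; case: PT => bT _ _.
  exact: vprod_bottomP.
rewrite /rem_bot; apply: the_Some; rewrite (phi_inv_Some PT).
  exact/vprod_SomeP/vprod_bottom.
move=> D /vprod_SomeP V; case: (PT) => bT _ _.
exact: extB_uniq_below (vprod_bottomP bT V) E.
Qed.

Lemma uniq_map_tau T : bottom T -> uniq [seq tau T k | k <- iota 1 (nt T)].
Proof.
move=> bT; rewrite map_inj_in_uniq ?iota_uniq // => k l.
rewrite !mem_iota => hk hl e; apply/eqP; case: ltngtP => // lt.
  by have := @tau_mono T bT k l; lia.
by have := @tau_mono T bT l k; lia.
Qed.

(** Bottom points are feet of through strands, left ends of returns or right ends of returns. *)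
Lemma card_phi T : bottom T -> nb T = nt T + 2 * #|` phi T|.
Proof.
move=> bT; pose part i := if mate T (Bot i) is Bot k then k else 0.
have pP i : i \in phi T ->
    [/\ mate T (Bot i) = Bot (part i), i < part i, 0 < i & part i <= nb T].
  case/phiP=> k [e lt hi]; rewrite /part e; split=> //; first lia.
  by have := mate_bdry (hi : bdry T (Bot i)); rewrite e /bdry /=; lia.
suff P : perm_eq (iota 1 (nb T)) ([seq tau T k | k <- iota 1 (nt T)] ++
    (enum_fset (phi T) ++ [seq part i | i <- enum_fset (phi T)])).
  by have := perm_size P; rewrite !size_cat !size_map !size_iota /=; lia.
apply: uniq_perm; first exact: iota_uniq.
- rewrite !cat_uniq uniq_map_tau // fset_uniq /=.
  apply/and3P; split.
  + apply/hasPn => j; rewrite mem_cat => H; apply/mapP=> -[k].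
    rewrite mem_iota => hk ej; have [_ e _] := tauP bT (k := k) ltac:(lia).
    case/orP: H => [/pP[e']|/mapP[i /pP[e' _ _ _] ej']].
      by move: e'; rewrite ej e.
    by have := mateK T (Bot i); rewrite e' -ej' ej e.
  + apply/hasPn => j /mapP[i /pP[e lt _ _] ->]; apply/negP => /pP[e' lt' _ _].
    by move: e'; rewrite -e mateK => -[]; lia.
  + rewrite map_inj_in_uniq ?fset_uniq // => i j /pP[ei _ _ _] /pP[ej _ _ _] e.
    by have [] : Bot i = Bot j by apply: (@mate_inj T); rewrite ei ej e.
- move=> j; rewrite !mem_cat mem_iota add1n ltnS.
  apply/idP/idP => [hj|/orP[|/orP[]]].
  + case: (bot_cases bT hj) => [[k hk ->]|[i [e rj hi]]].
      by rewrite map_f ?mem_iota //; lia.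
    case: (ltngtP i j) => ij.
    * apply/orP; right; apply/orP; right; apply/mapP; exists i.
        by apply/phiP; exists j; rewrite -e mateK.
      by rewrite /part -e mateK.
    * by apply/orP; right; apply/orP; left; apply/phiP; exists i.
    * by case: (@mate_neq T (Bot j)); rewrite // e ij.
  + by case/mapP=> k; rewrite mem_iota => hk ->; case: (tauP bT (k := k)); lia.
  + by case/pP; lia.
  + by case/mapP => i /pP[_ ? ? ?] ->; lia.
Qed.

Lemma phi_pos T i : i \in phi T -> 0 < i <= nb T.
Proof. by case/phiP=> k []. Qed.

Lemma extB_floor T C' C : extB T C' C -> floor C' -> floor C.
Proof.
case=> bT [e1 e2 e3 e4] rE mE fC' i; apply: contraT.
rewrite negbK /top_return; case e: (mate C (Top i)) => [k|||] // hi.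
have hi' : 0 < i <= nt C' by rewrite -e2.
have := mE (Top i) hi'; rewrite /= e; case e': (mate C' (Top i)) => //= _.
by have := fC' i; rewrite /top_return e' hi'.
Qed.

Lemma extB_bottom T U P : extB T U P -> bottom U -> bottom P.
Proof.
by move=> E [fU h0]; split;
  [exact: (extB_floor E fU)|case: E => _ [-> _ _ _] _ _].
Qed.

(** [tau] is increasing, so it carries left ends of returns of U to left ends of returns of the
    product. *)
Lemma phi_extB T U P : extB T U P -> bottom U ->
  phi P = phi T `|` [fset tau T k | k in phi U].
Proof.
move=> E bU; have bP := extB_bottom E bU; case: E => bT [e1 e2 e3 e4] rE mE.
have mB k : 0 < k <= nb U -> mate P (Bot (tau T k)) = botmap T (mate U (Bot k)).
  exact: mE (Bot k).
apply/fsetP => i; rewrite in_fsetU; apply/phiP/orP.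
- case=> l [el lt hi]; have hi' : 0 < i <= nb T by rewrite -e4.
  case: (bot_cases bT hi') => [[k hk ik]|[j [ej ri hj]]].
    right; apply/imfsetP; exists k => //=; apply/phiP.
    rewrite -e3 in hk; have := mB k hk; rewrite -ik el.
    case ek: (mate U (Bot k)) => [|k'||] //= [lk].
    have hk' : 0 < k' <= nb U.
      by have := mate_bdry (hk : bdry U (Bot k)); rewrite ek.
    exists k'; split=> //; rewrite ltnNge leq_eqVlt;
      apply/negP=> /orP[/eqP e|h].
      by apply: (@mate_neq U (Bot k)); rewrite ?ek ?e.
    by have := @tau_mono T bT k' k; lia.
  by left; apply/phiP; exists l; rewrite -rE.
- case=> [/phiP[l [el lt hi]]|/imfsetP[k /= /phiP[l [el lt hk]] ->]].
    by exists l; rewrite rE ?e4 // /bot_return el.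
  have hl : 0 < l <= nb U.
    by have := mate_bdry (hk : bdry U (Bot k)); rewrite el.
  exists (tau T l); rewrite mB // el e4; split=> //.
    by apply: tau_mono => //; lia.
  by case: (tauP bT (k := k)); rewrite -?e3.
Qed.

Lemma card_phi_extB T U P : extB T U P -> bottom U ->
  #|` phi P| = #|` phi T| + #|` phi U|.
Proof.
move=> E bU; have := card_phi (extB_bottom E bU); have := card_phi bU.
by case: E => bT [e1 e2 e3 e4] _ _; have := card_phi bT; lia.
Qed.

(** * Adding a vertical strand; the sets L_n and the sum of index sets *)

Lemma widen_exists T : bottom T -> exists T', [/\ bottom T', nb T' = (nb T).+1,
  nt T' = (nt T).+1, mate T' (Bot (nb T).+1) = Top (nt T).+1
  & forall p, bdry T p -> mate T' p = mate T p].
Proof.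
move=> bT; case: (bT) => fT h0; set a := nt T; set b := nb T.
pose arc p := match p with Top _ => Bot b.+1 | Bot _ => Top a.+1 | _ => p end.
have BE p : bdry T p = on_bdry 0 a b p by rewrite /bdry h0.
have arcP p : on_bdry 0 a.+1 b.+1 p -> ~ (exists2 p', bdry T p' & p' = p) ->
    p = Top a.+1 \/ p = Bot b.+1.
  move=> Bp ni; have : ~ on_bdry 0 a b p by move=> H; apply: ni; exists p;
    rewrite ?BE.
  case: p Bp {ni} => k /= h1 h2; [left|right|lia|lia]; f_equal; lia.
have := @insert_arcs T 0 a.+1 b.+1 id arc (bdry_pos 0 a.+1 b.+1).
case=> [//|p|p q|p Bp ni|p q Bp /(arcP _ Bp)[]-> Bq|C [[e1 e2 e3] mC aC]].
- by rewrite BE; case: p => k /=; lia.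
- by rewrite !BE /bpos h0; case: p => i; case: q => j /=; rewrite -/a -/b; lia.
- case: (arcP p Bp ni) => -> /=; split=> // -[p']; rewrite BE => + e;
  rewrite e /=; lia.
- by case: q Bq => l /=; lia.
- by case: q Bq => l /=; lia.
- have ni p : ~ bdry T p -> ~ (exists2 p', bdry T p' & p' = p).
    by move=> nB [p' Bp' e]; apply: nB; rewrite -e.
  exists C; split=> //.
  + split=> // i; rewrite /top_return; case: (boolP (0 < i <= nt C));
    last first.
      by case: (mate _ _).
    rewrite e2 => hi; case: (boolP (i <= a)) => ia.
      have Bi : bdry T (Top i) by rewrite BE /=; lia.
      by rewrite (mC _ Bi); have [->] := tauP bT Bi.
    by rewrite aC //; apply: ni; rewrite BE /=; lia.
  + by rewrite aC //=; apply: ni; rewrite BE /=; lia.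
Qed.

Lemma unwiden_exists T n k : bottom T -> nb T = n.+1 ->
  mate T (Bot n.+1) = Top k -> nt T = k /\ exists T', [/\ bottom T', nb T' = n,
    nt T' = k.-1 & forall p, bdry T' p -> mate T p = mate T' p].
Proof.
move=> bT eb e; case: (bT) => fT h0.
have e' : mate T (Top k) = Bot n.+1 by rewrite -e mateK.
have Bk : bdry T (Top k) by rewrite -e; apply: mate_bdry; rewrite /bdry /= eb;
  lia.
have tk : tau T k = n.+1 by rewrite /tau e'.
have hk : 0 < k <= nt T := Bk.
have en : nt T = k.
  case: (ltngtP (nt T) k) => // h; first lia.
  have [_ _] := tauP bT (k := nt T) ltac:(lia); rewrite eb.
  by have := @tau_mono T bT k (nt T); lia.
split=> //; have BE p : bdry T p = on_bdry 0 k n.+1 p by rewrite /bdry h0 en eb.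
have := @remove_arcs T 0 k.-1 n id (bdry_pos 0 k n.+1).
case=> [p q Bp Bq|p|p q|p Bp|T' [e1 e2 e3 mT]].
- by have := @mate_planar T p q Bp Bq; rewrite h0 en eb.
- by rewrite BE; case: p => i /=; lia.
- by case: p => i; case: q => j /=; lia.
- exists (mate T p) => //.
  have Bp' : bdry T p by rewrite BE; case: p Bp => i /=; lia.
  have := mate_bdry Bp'; rewrite BE.
  have n1 : mate T p <> Top k by rewrite -e => /mate_inj ep; move: Bp;
    rewrite ep /=; lia.
  have n2 : mate T p <> Bot n.+1 by rewrite -e' => /mate_inj ep; move: Bp;
    rewrite ep /=; lia.
  case: (mate T p) n1 n2 => i /= n1 n2 hi; try lia.
    by case: (i =P k) n1 => [->//|]; lia.
  by case: (i =P n.+1) n2 => [->//|]; lia.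
- exists T'; split=> //; split=> // i; rewrite /top_return e2.
  case: (boolP (0 < i <= k.-1)) => hi; last by case: (mate _ _).
  have Bi : bdry T' (Top i) by rewrite /bdry e1 e2 e3.
  by rewrite -mT //; have [->] := tauP bT (k := i) ltac:(lia).
Qed.

Lemma phi_restrict T T' : nb T <= nb T' ->
  (forall p, bdry T p -> mate T' p = mate T p) ->
  (forall j, nb T < j <= nb T' -> ~~ bot_return T' j) -> phi T' = phi T.
Proof.
move=> le mE nr; apply/fsetP => i; apply/phiP/phiP => -[k [e lt hi]].
- have hi' : 0 < i <= nb T.
    case: (leqP i (nb T)) => h; first lia.
    by have := nr i; rewrite /bot_return e hi h => /(_ _); lia.
  by exists k; split=> //; rewrite -mE.
- exists k; split=> //; last lia.
  by rewrite mE.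
Qed.

Lemma is_phi_inv_widen n I T : is_phi_inv n I T -> exists T',
  [/\ is_phi_inv n.+1 I T', nt T' = (nt T).+1,
    mate T' (Bot n.+1) = Top (nt T).+1
    & forall p, bdry T p -> mate T' p = mate T p].
Proof.
case=> bT <- <-; have [T' [bT' e1 e2 e3 e4]] := widen_exists bT.
exists T'; split=> //; split=> //; apply: phi_restrict => //;
  first by rewrite e1.
by move=> j hj; rewrite (_ : j = (nb T).+1) ?/bot_return ?e3 //; lia.
Qed.

Lemma is_phi_inv_unwiden n I T k : is_phi_inv n.+1 I T ->
  mate T (Bot n.+1) = Top k -> nt T = k /\ in_L n I.
Proof.
case=> bT e1 <- e; have [e2 [T' [bT' e3 e4 mE]]] := unwiden_exists bT e1 e.
split=> //; exists T'; split=> //; symmetry; apply: phi_restrict => //.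
  by rewrite e1 e3.
by rewrite e1 e3 => j hj; rewrite (_ : j = n.+1) ?/bot_return ?e //; lia.
Qed.

Lemma in_L_leq n m I : n <= m -> in_L n I -> in_L m I.
Proof.
move=> /subnKC <-; elim: (m - n) => [|d IH]; first by rewrite addn0.
by move=> /IH[T] /is_phi_inv_widen [T' [? _ _ _]]; rewrite addnS; exists T'.
Qed.

(* The columns, counted from 0, that are not covered by the cups joining the
   points i and i+1 for i in I; these points lie on columns i-1 and i. *)
Definition kept (n : nat) (I : {fset nat}) : seq nat :=
  [seq c <- iota 0 n | (c.+1 \notin I) && (c \notin I)].

Lemma mem_kept n I c :
  (c \in kept n I) = [&& c.+1 \notin I, c \notin I & c < n].
Proof. by rewrite mem_filter mem_iota /= add0n andbA. Qed.

Lemma kept_sorted n I : sorted ltn (kept n I).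
Proof. by apply: sorted_filter; [exact: ltn_trans|exact: iota_ltn_sorted]. Qed.

Lemma nth_kept_lt n I k l : l < size (kept n I) -> k < l ->
  nth 0 (kept n I) k < nth 0 (kept n I) l.
Proof.
move=> ls kl; apply: (sorted_ltn_nth ltn_trans) => //.
- exact: kept_sorted.
- exact: ltn_trans ls.
Qed.

Lemma nth_kept n I k : k < size (kept n I) -> nth 0 (kept n I) k \in kept n I.
Proof. exact: mem_nth. Qed.

Lemma cups_exist n I : 0 \notin I -> (forall i, i \in I -> i < n) ->
    (forall i, i \in I -> i.+1 \notin I) -> exists T,
  [/\ is_phi_inv n I T, nt T = size (kept n I),
      forall i, i \in I -> mate T (Bot i) = Bot i.+1,
      forall j, bot_return T j -> j \in I \/ j.-1 \in I
    & forall k, 0 < k <= nt T -> tau T k = (nth 0 (kept n I) k.-1).+1].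
Proof.
move=> I0 In gap; set a := size (kept n I); have [e0 e1 e2 me] := idcP a.
have pos i : i \in I -> 0 < i by case: i => //; rewrite (negbTE I0).
pose rho p := if p is Bot k then Bot (nth 0 (kept n I) k.-1).+1 else p.
pose arc p := if p is Bot i then if i \in I then Bot i.+1 else Bot i.-1 else p.
have BE p : bdry (idc a) p = on_bdry 0 a a p by rewrite /bdry e0 e1 e2.
have nk k : 0 < k <= a -> let c := nth 0 (kept n I) k.-1 in
    [/\ c.+1 \notin I, c \notin I & c < n].
  move=> hk; have : nth 0 (kept n I) k.-1 \in kept n I.
    by apply: nth_kept; rewrite -/a; lia.
  by rewrite mem_kept => /and3P.
have im p : on_bdry 0 a n p -> ~ (exists2 p', bdry (idc a) p' & rho p' = p) ->
    exists2 i, i \in I & p = Bot i \/ p = Bot i.+1.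
  move=> + ni; case: p ni => j ni /= hj; try lia.
    by case: ni; exists (Top j); rewrite ?BE.
  case: (boolP (j.-1 \in kept n I)) => hc.
    case: ni; exists (Bot (index j.-1 (kept n I)).+1).
      by rewrite BE /= index_mem.
    by rewrite /= nth_index //; f_equal; lia.
  move: hc; rewrite mem_kept !negb_and !negbK prednK; last lia.
  case/or3P => h; [by exists j => //; left| |lia].
  by exists j.-1 => //; right; f_equal; lia.
have ni i : i \in I -> ~ (exists2 p', bdry (idc a) p' & rho p' = Bot i) /\
                   ~ (exists2 p', bdry (idc a) p' & rho p' = Bot i.+1).
  move=> iI; split=> -[p']; rewrite BE; case: p' => k //= /nk[c1 c2 c3] [e].
    by move: c1; rewrite e iI.
  by move: c2; rewrite e iI.
have arcE i : i \in I -> arc (Bot i) = Bot i.+1 /\ arc (Bot i.+1) = Bot i.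
  by move=> iI; rewrite /= iI (negbTE (gap _ iI)).
have := @insert_arcs (idc a) 0 a n rho arc (bdry_pos 0 a n).
case=> [//|p|p q|p Bp /(im _ Bp)[i iI iE]|p q Bp /(im _ Bp)[i iI iE] Bq|].
- by rewrite BE; case: p => k //= hk; case: (nk k hk).
- rewrite !BE /bpos e0 e1 e2; case: p => i; case: q => j /=; try lia.
    by move=> hi hj lt; have [_ _ h2] := nk _ hj; lia.
  move=> hi hj lt; have [_ _ h1] := nk _ hi; have [_ _ h2] := nk _ hj.
  by have := @nth_kept_lt n I j.-1 i.-1; rewrite -/a; lia.
- have [n1 n2] := ni i iI; have [a1 a2] := arcE i iI; have := In i iI.
  have := pos i iI.
  by case: iE => -> hi hn; rewrite ?a1 ?a2; split=> //=; do ?lia; case; lia.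
- by have [a1 a2] := arcE i iI; case: iE => ->; rewrite ?a1 ?a2 /=;
  case: q Bq => l /=; lia.
move=> T [[h1 h2 h3] mT aT]; have BT p : bdry T p = on_bdry 0 a n p.
  by rewrite /bdry h1 h2 h3.
have mI i : i \in I -> mate T (Bot i) = Bot i.+1.
  move=> iI; have [n1 n2] := ni i iI; have [a1 a2] := arcE i iI.
  by rewrite aT //=; rewrite pos //= ltnW // In.
have mTop k : 0 < k <= a -> mate T (Top k) = Bot (nth 0 (kept n I) k.-1).+1.
  move=> hk; have := mT (Top k); rewrite BE => /(_ hk).
  by have [-> _] := me k hk.
have ret j : bot_return T j -> j \in I \/ j.-1 \in I.
  move=> rj; have Bj : on_bdry 0 a n (Bot j).
    by move: rj; rewrite /bot_return h3; case: (mate _ _).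
  case: (@im (Bot j) Bj) => [[p']|i iI [[->]|[->]]]; [|by left|by right].
  rewrite BE; case: p' => k //= hk [e].
  have := mTop k hk; rewrite e => e'; move: rj.
  by rewrite /bot_return -e' mateK.
exists T; split=> //.
- split=> //.
    split=> // k; rewrite /top_return h2; case: (boolP (0 < k <= a)) => hk.
      by rewrite mTop.
    by case: (mate _ _).
  apply/fsetP => i; apply/phiP/idP => [[k [e lt hi]]|iI].
    have ri : bot_return T i by rewrite /bot_return e.
    case: (ret i ri) => // iI'; have := mI _ iI'.
    have -> : i.-1.+1 = i by lia.
    by move=> e'; move: lt; move: e; rewrite -e' mateK => -[<-]; lia.
  exists i.+1; rewrite mI //; split=> //; rewrite h3 pos //=.
  by apply: ltnW; exact: In.
- by move=> k; rewrite h2 => hk; rewrite /tau mTop.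
Qed.

Lemma tau_small T i k : bottom T -> (forall j,
  0 < j < i -> ~~ bot_return T j) ->
  i <= (nb T).+1 -> 0 < k < i -> tau T k = k /\ k <= nt T.
Proof.
move=> bT nr hi; elim/ltn_ind: k => k IH hk.
have hk' : 0 < k <= nb T by lia.
case: (bot_cases bT hk') => [[l hl e]|[j [_ rj _]]]; last first.
  by have := nr k hk; rewrite rj.
have lk : l <= k.
  elim: l {hl e} (hl) (e : k = tau T l) => // l _ hl e.
  have mono m : m <= nt T -> m <= tau T m.
    elim: m => // m IHm hm; case: m IHm hm => [|m] IHm hm.
      by case: (tauP bT (k := 1)); lia.
    by have := @tau_mono T bT m.+1 m.+2; lia.
  by rewrite e; apply: mono; lia.
case: (ltngtP l k) lk => // [lk _|lk _]; last by split; [rewrite -{1}lk -e|lia].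
by have [el _] := IH l lk ltac:(lia); lia.
Qed.

(** Remove the greatest element i, realize the rest at a width n > i, and put below it the bottom
    state of width n+2 whose only return is i, i+1. The other elements are smaller than i, where the
    strands of that state are vertical, so they keep their places. *)
Lemma in_L_exists I : posset I -> exists n, in_L n I.
Proof.
move=> pI; have [s] := ubnP #|` I|; elim: s => // s IH in I pI * => hs.
have [->|[i0 i0I]] := fset_0Vmem I.
  have [e0 e1 e2 me] := idcP 0; exists 0, (idc 0); split=> //.
    split=> // i; rewrite /top_return e1; case: (mate _ _) => // _; lia.
  by apply/fsetP => i; rewrite in_fset0; apply/negbTE/phiP => -[k []]; lia.
pose P i := i \in I; have exP : exists i, P i by exists i0.
have bP i : P i -> i <= \max_(j <- enum_fset I) j.
  by move=> iI; apply: (@leq_bigmax_seq _ _ _ id).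
pose i := ex_maxn exP bP;
  have [iI imax] : i \in I /\ forall j, j \in I -> j <= i.
  by rewrite /i; case: ex_maxnP.
have i0' : 0 < i by rewrite lt0n; apply: contraNneq pI => <-.
have pI' : posset (I `\ i) by rewrite /posset !inE negb_and (negbTE pI) orbT.
have cI' : #|` I `\ i| < s by have := cardfsD1 i I; rewrite iI; lia.
have [n0 H0] := IH _ pI' cI'.
have [T' [bT' eT' pT']] := in_L_leq (leq_maxl n0 i.+1) H0.
set n := maxn _ _ in eT'.
have [] := @cups_exist n.+2 [fset i].
- by rewrite inE; lia.
- by move=> j; rewrite inE => /eqP->; rewrite /n; lia.
- by move=> j; rewrite !inE => /eqP->; lia.
move=> Q [[bQ eQ pQ] _ mQ rQ _].
have nQ : nt Q = n by have := card_phi bQ; rewrite pQ cardfs1; lia.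
have [P' EP] := extB_insert bQ (etrans eT' (esym nQ)).
exists n.+2, P'; split; first exact: extB_bottom EP bT'.
  by case: EP => _ [_ _ _ ->].
rewrite (phi_extB EP bT') pQ pT'.
have tQ k : k \in I `\ i -> tau Q k = k.
  rewrite !inE => /andP[ne kI]; have := imax k kI => le.
  have k0 : 0 < k by rewrite lt0n; apply: contraNneq pI => <-.
  have [] := @tau_small Q i k bQ => //; last by lia.
    move=> j hj; apply/negP => /rQ; rewrite !inE => -[]/eqP; lia.
  by rewrite eQ /n; lia.
apply/fsetP => j; rewrite in_fsetU in_fset1; case: eqP => [->//|ne] /=.
apply/imfsetP/idP => [[k /= kI ->]|jI]; first by rewrite tQ //;
  case/fsetD1P: kI.
have jI' : j \in I `\ i by rewrite !inE jI andbT; apply/eqP.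
by exists j; rewrite ?tQ.
Qed.

(** The widths n with I in L_n form a nonempty up-set, whose least element is the only candidate for
    n_I. *)
Lemma minwidthP I : posset I -> forall n, in_L n I <-> minwidth I <= n.
Proof.
move=> /in_L_exists[n0 H0].
have exP : exists n, `[< in_L n I >] by exists n0; apply/asboolP.
have H : is_minwidth I (ex_minn exP).
  move=> n; case: ex_minnP => k /asboolP Hk mk; split=> [Hn|le].
    by apply: mk; apply/asboolP.
  exact: in_L_leq le Hk.
have -> : minwidth I = ex_minn exP; last exact: H.
rewrite /minwidth (_ : the _ = Some (ex_minn exP)) //.
apply: the_Some => // k Hk; apply/eqP; rewrite eqn_leq.
by apply/andP; split; [apply/Hk/H|apply/H/Hk].
Qed.

Lemma in_L_posset n I : in_L n I -> posset I.
Proof. by case=> T [_ _ <-]; apply/negP => /phi_pos. Qed.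

Lemma is_phi_inv_uniq n I T T' : is_phi_inv n I T -> is_phi_inv n I T' -> T =
  T'.
Proof. by move=> [b1 e1 p1] [b2 e2 p2]; apply: phi_inj; congruence. Qed.

Lemma tau_stable n m I T T' : n <= m -> is_phi_inv n I T -> is_phi_inv m I T' ->
  forall k, 0 < k <= nt T -> tau T' k = tau T k.
Proof.
move=> /subnKC <-; elim: (m - n) T' => [|d IH] T' H H' k hk.
  by rewrite addn0 in H'; rewrite (is_phi_inv_uniq H H').
have [T1 H1] : in_L (n + d) I by apply: in_L_leq (leq_addr d n) _; exists T.
have [T2 [H2 _ _ mE]] := is_phi_inv_widen H1.
rewrite addnS in H'; rewrite (is_phi_inv_uniq H' H2) -(IH T1 H H1) //.
rewrite /tau mE //; case: H1 H => b1 e1 p1 [b2 e2 p2].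
have := card_phi b1; have := card_phi b2; rewrite p1 p2 /bdry /=; lia.
Qed.

(** The definition of the sum fixes the least admissible width. Any larger width gives the same set,
    because widening does not move the feet of the old strands and the elements of I number such
    strands. *)
Lemma oplus_extB n I I0 T U P : is_phi_inv n I0 T -> is_phi_inv (nt T) I U ->
  extB T U P -> phi P = oplus I I0.
Proof.
move=> HT HU E.
have pI0 : posset I0 by apply: (@in_L_posset n); exists T.
have pI : posset I by apply: (@in_L_posset (nt T)); exists U.
have card T' n' : is_phi_inv n' I0 T' -> n' = nt T' + 2 * #|` I0|.
  by case=> b <- <-; exact: card_phi.
have cT := card _ _ HT.
rewrite /oplus; set m := maxn _ _.
have [T' HT'] : in_L m I0 by apply/minwidthP => //; rewrite /m; lia.
have cT' := card _ _ HT'.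
have [U' HU'] : in_L (m - 2 * #|` I0|) I by apply/minwidthP => //; rewrite /m;
  lia.
have mn : m <= n.
  have : minwidth I0 <= n by apply/minwidthP => //; exists T.
  have : minwidth I <= nt T by apply/minwidthP => //; exists U.
  by rewrite /m; lia.
have [P' E'] : exists P', extB T' U' P'.
  by apply: extB_insert; [case: HT'|case: HU' => _ -> _; lia].
rewrite (phi_inv_Some HT') (phi_inv_Some HU').
rewrite (proj2 (vprod_SomeP _ _ _) (vprod_bottom E')) /=.
case: (HU) (HU') => bU eU pU [bU' eU' pU'].
rewrite (phi_extB E bU) (phi_extB E' bU') pU pU'.
case: (HT) (HT') => _ _ -> [_ _ ->]; congr (_ `|` _).
have tE k : k \in I -> tau T k = tau T' k.
  by rewrite -pU' => /phi_pos hk; apply: tau_stable HT' HT _ _ => //; lia.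
apply/fsetP => i; apply/imfsetP/imfsetP => -[k /= kI ->]; exists k => //.
  exact: tE.
by rewrite tE.
Qed.

Lemma oplus_exists I I0 N : posset I -> posset I0 ->
    maxn (minwidth I + 2 * #|` I0|) (minwidth I0) <= N ->
  exists T U P, [/\ is_phi_inv N I0 T, is_phi_inv (nt T) I U,
    is_phi_inv N (oplus I I0) P & extB T U P].
Proof.
move=> pI pI0 mN; have [T HT] : in_L N I0 by apply/minwidthP => //; lia.
have cT : N = nt T + 2 * #|` I0| by case: (HT) => b <- <-; exact: card_phi.
have [U HU] : in_L (nt T) I by apply/minwidthP => //; lia.
have [P E] : exists P, extB T U P.
  by apply: extB_insert; [case: HT|case: HU].
exists T, U, P; split=> //; split; last exact: (oplus_extB HT HU E).
  by apply: (extB_bottom E); case: HU.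
by case: E => _ [_ _ _ ->] _ _; case: HT.
Qed.

(* If I (+) I0 is in L_N, then the strands beyond the N-th are vertical in the
   product of the bottom states of I and I0, hence in both factors. *)
Lemma in_L_oplus I I0 N : posset I -> posset I0 -> in_L N (oplus I I0) ->
  exists T U P, [/\ is_phi_inv N I0 T, is_phi_inv (nt T) I U,
    is_phi_inv N (oplus I I0) P & extB T U P].
Proof.
move=> pI pI0 HN.
pose m := maxn (minwidth I + 2 * #|` I0|) (minwidth I0).
apply: oplus_exists => //; rewrite -/m leqNgt; apply/negP => Nm.
have [T [U [P [HT HU HP E]]]] := oplus_exists pI pI0 (leqnn m).
have cT : m = nt T + 2 * #|` I0| by case: (HT) => b <- <-; exact: card_phi.
have [Q HQ] : in_L m.-1 (oplus I I0) by apply: in_L_leq HN; lia.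
have [Q' [HQ' _ eQ' _]] := is_phi_inv_widen HQ.
have m1 : m.-1.+1 = m by lia.
rewrite m1 in HQ' eQ'; rewrite (is_phi_inv_uniq HQ' HP) in eQ'.
case: (E) => bT [e1 e2 e3 e4] rE mE; case: (HT) => _ eT pT.
have hm : 0 < m <= nb T by lia.
case: (bot_cases bT hm) => [[k hk km]|[i [ei ri _]]]; last first.
  by move: (rE m ri); rewrite eQ' ei.
have eTm : mate T (Bot m) = Top k by rewrite km; case: (tauP bT hk).
rewrite -m1 in HT eTm; have [ek HI0] := is_phi_inv_unwiden HT eTm.
have := mE (Bot k); rewrite -e3 in hk; move=> /(_ hk).
rewrite /= -km eQ'; case eU: (mate U (Bot k)) => [l|||] //= _.
have nk : nt T = k.-1.+1 by lia.
have ek' : k = k.-1.+1 by lia.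
rewrite nk in HU; rewrite ek' in eU.
have [_ HI] := is_phi_inv_unwiden HU eU.
have h1 := proj1 (minwidthP pI _) HI; have h2 := proj1 (minwidthP pI0 _) HI0.
by move: h1 h2 Nm; rewrite /m in cT hm *; lia.
Qed.

(** * First rows and interlaced pairs *)

Definition desc (n : nat) (g : nat -> bool) : {fset nat} :=
  [fset j in iota 0 n.+1 | g j && ~~ g j.+1].

Definition asc (n : nat) (g : nat -> bool) : {fset nat} :=
  [fset i in iota 0 n.+1 | ~~ g i && g i.+1].

Lemma mem_desc n g j : (j \in desc n g) = [&& j <= n, g j & ~~ g j.+1].
Proof. by rewrite !inE /= -[_ || _]/(j \in iota 0 n.+1) mem_iota. Qed.

Lemma mem_asc n g j : (j \in asc n g) = [&& j <= n, ~~ g j & g j.+1].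
Proof. by rewrite !inE /= -[_ || _]/(j \in iota 0 n.+1) mem_iota. Qed.

Lemma sort_fset_filter (s : seq nat) (P : pred nat) : sorted leq s -> uniq s ->
  sort leq [fset j in s | P j] = [seq j <- s | P j].
Proof.
move=> ss us; apply: (sorted_eq leq_trans anti_leq).
- by apply: sort_sorted; exact: leq_total.
- by apply: sorted_filter => //; exact: leq_trans.
- rewrite perm_sort; apply: uniq_perm; [exact: fset_uniq|exact: filter_uniq|].
  by move=> j; rewrite mem_filter !inE /= andbC.
Qed.

Definition interl (js ks : seq nat) : Prop := size js = (size ks).+1 /\
  forall k, k < size ks -> nth 0 js k < nth 0 ks k < nth 0 js k.+1.

Lemma interlacedP (J I : {fset nat}) :
  reflect (interl (sort leq J) (sort leq I)) (interlaced J I).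
Proof.
apply: (iffP andP) => [[/eqP e /allP H]|[e H]].
  by split=> // k hk; apply: H; rewrite mem_iota.
split; first exact/eqP.
by apply/allP => k; rewrite mem_iota => hk; exact: H.
Qed.

(** The second conjunct is the state of the scan after a descent x has been passed whose matching
    ascent is still to come. *)
Lemma interl_desc_asc g l a : ~~ g (a + l) ->
  let js := [seq j <- iota a l | g j && ~~ g j.+1] in
  let ks := [seq i <- iota a l | ~~ g i && g i.+1] in
  (g a -> interl js ks) /\ (~~ g a -> forall x, x < a -> interl (x :: js) ks).
Proof.
elim: l a => [|l IH] a; first by rewrite addn0 => ga /=; rewrite (negbTE ga).
rewrite addnS -addSn => /IH /=; case ga: (g a);
  case gb: (g a.+1) => //= -[h1 h2].
- by split=> // _; exact: h1.
- by split=> // _; exact: h2.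
- split=> // _ x xa; have [e h] := h1 isT; split=> /=; first by rewrite e.
  case=> [_|k hk] /=; last exact: h.
  rewrite xa /=; set s := [seq _ <- _ | _] in e h *.
  have : nth 0 s 0 \in s by apply: mem_nth; rewrite e.
  by rewrite mem_filter mem_iota => /andP[_]; lia.
- by split=> // _ x xa; apply: h2 => //; lia.
Qed.

Lemma interlaced_desc_asc n (g : nat -> bool) : g 0 -> ~~ g n.+1 ->
  interlaced (desc n g) (asc n g).
Proof.
move=> g0 gn; apply/interlacedP; rewrite !sort_fset_filter ?iota_uniq //.
- by apply: (proj1 (@interl_desc_asc g n.+1 0 _)).
- exact: iota_sorted.
- exact: iota_sorted.
Qed.

(** Below any k the descents lead the ascents by 0 or 1; this difference is what recovers the sign
    at k. *)
Lemma interl_count js ks k : sorted ltn js -> interl js ks ->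
  count (fun x => x < k) ks <= count (fun x => x < k) js <= (count (fun x =>
    x < k) ks).+1.
Proof.
elim: ks js => [|i ks IH] [|j js] //= sj [] //=.
  by move=> [e] _; rewrite (size0nil e) /= addn0; case: (_ < _).
move=> [e] H; have sj' := path_sorted sj.
have {}IH := IH js sj' (conj e (fun k hk => H k.+1 hk)).
have /andP[ji ij] := H 0 isT.
case: (ltnP i k) => ik; first by move: IH; rewrite (ltn_trans ji ik); lia.
suff c0 : count (fun x => x < k) js = 0 by move: IH; rewrite c0;
  case: (j < k); lia.
apply/eqP; rewrite -leqn0 leqNgt -has_count; apply/hasPn => x xj;
  rewrite -leqNgt.
apply: leq_trans ik (ltnW (leq_trans ij _)).
rewrite -(nth_index 0 xj); case: (index x js) (index_mem x js) => // m.
rewrite xj => hm; apply: ltnW.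
by apply: (sorted_ltn_nth ltn_trans); rewrite ?inE //; lia.
Qed.

Lemma interl_disjoint js ks x : sorted ltn js -> interl js ks -> x \in js ->
  x \notin ks.
Proof.
move=> sj [e H] xj; apply/negP => xk.
have hl : index x ks < size ks by rewrite index_mem.
have /andP[] := H _ hl; rewrite nth_index //; have ex := nth_index 0 xj.
have hm : index x js < size js by rewrite index_mem.
have mono a b : b < size js -> a <= b -> nth 0 js a <= nth 0 js b.
  move=> hb; rewrite leq_eqVlt => /orP[/eqP->//|hab]; apply: ltnW.
  by apply: (sorted_ltn_nth ltn_trans); rewrite ?inE //; exact: ltn_trans hb.
have hl1 : (index x ks).+1 < size js by rewrite e ltnS.
case: (leqP (index x js) (index x ks)) => h lt1 lt2.
  by have := mono _ _ (ltnW hl1) h; rewrite ex leqNgt lt1.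
by have := mono _ _ hm h; rewrite ex leqNgt lt2.
Qed.

Lemma count_ltnS (s : seq nat) k : uniq s ->
  count (fun x => x < k.+1) s = count (fun x => x < k) s + (k \in s).
Proof.
move=> us; rewrite -(count_uniq_mem k us) -count_predUI addnC.
rewrite (_ : count (predI _ _) s = 0) ?add0n.
  by apply: eq_count => x /=; rewrite ltnS leq_eqVlt orbC.
apply/eqP; rewrite -leqn0 leqNgt -has_count.
by apply/hasPn => x _ /=; case: eqP => [->|]; rewrite ?ltnn ?andbF.
Qed.

Lemma sort_fset_sorted (J : {fset nat}) : sorted ltn (sort leq J).
Proof.
by rewrite ltn_sorted_uniq_leq sort_uniq fset_uniq sort_sorted //;
  exact: leq_total.
Qed.

Lemma interlaced_signs n J I : interlaced J I -> (forall j,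
  j \in J -> j <= n) ->
  exists g : nat -> bool, [/\ g 0, ~~ g n.+1, desc n g = J & asc n g = I].
Proof.
move=> /interlacedP; set js := sort leq J; set ks := sort leq I => H Jn.
have sj : sorted ltn js by exact: sort_fset_sorted.
have uj : uniq js by rewrite sort_uniq fset_uniq.
have uk : uniq ks by rewrite sort_uniq fset_uniq.
have mj x : (x \in js) = (x \in J) by rewrite mem_sort.
have mk x : (x \in ks) = (x \in I) by rewrite mem_sort.
pose cj k := count (fun x => x < k) js; pose ck k := count (fun x => x < k) ks.
have c1 k : ck k <= cj k <= (ck k).+1 by exact: interl_count.
have cjS k : cj k.+1 = cj k + (k \in J) by rewrite -mj; exact: count_ltnS.
have ckS k : ck k.+1 = ck k + (k \in I) by rewrite -mk; exact: count_ltnS.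
have dis k : k \in J -> k \in I -> False.
  by rewrite -mj -mk => /(interl_disjoint sj H)/negP.
have c0 : cj 0 = ck 0 by rewrite /cj /ck !(@eq_count _ (fun x =>
  x < 0) pred0) ?count_pred0.
have cn : cj n.+1 = (ck n.+1).+1.
  have e1 : cj n.+1 = size js.
    by apply/eqP; rewrite -all_count; apply/allP => x; rewrite mj => /Jn.
  have e2 : ck n.+1 <= size ks by exact: count_size.
  by case: H => e _; have := c1 n.+1; rewrite e1 e; lia.
have In i : i \in I -> i <= n.
  rewrite -mk => ik; case: (H) => e /(_ (index i ks)); rewrite index_mem ik.
  move=> /(_ isT); rewrite nth_index // => /andP[_ lt].
  have hi : (index i ks).+1 < size js by rewrite e ltnS index_mem.
  by apply: leq_trans (ltnW lt) (Jn _ _); rewrite -mj; exact: mem_nth.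
(* The sign at k is + if descents and ascents before k balance, and - if the descents are one
   ahead. *)
exists (fun k => cj k == ck k); split.
- exact/eqP.
- by rewrite cn; lia.
- apply/fsetP => j; rewrite mem_desc cjS ckS; have := c1 j; have := c1 j.+1.
  rewrite cjS ckS; case: (boolP (j \in J)) => jJ; case: (boolP (j \in I)) => jI.
  + by case: (dis j).
  + by rewrite (Jn j jJ); lia.
  + by lia.
  + by rewrite !addn0; case: (cj j == ck j); rewrite ?andbF.
- apply/fsetP => j; rewrite mem_asc cjS ckS; have := c1 j; have := c1 j.+1.
  rewrite cjS ckS; case: (boolP (j \in J)) => jJ; case: (boolP (j \in I)) => jI.
  + by case: (dis j).
  + by lia.
  + by rewrite (In j jI); lia.
  + by rewrite !addn0; case: (cj j == ck j); rewrite ?andbF.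
Qed.

(* The sign of the j-th top point (x_0 and x_{n+1} included) is + if the first
   row turns it to the right: the arcs e_j are the descents +-, the bottom
   returns of the row are the ascents -+. *)
Definition signs (n : nat) (r : {ffun 'I_n -> bool}) (k : nat) : bool :=
  if k is k'.+1 then if insub k' is Some i then r i else false else true.

Lemma signs_ord n (r : {ffun 'I_n -> bool}) (i : 'I_n) : signs r i.+1 = r i.
Proof. by rewrite /signs valK. Qed.

Lemma signs_last n (r : {ffun 'I_n -> bool}) k : n <= k -> signs r k.+1 = false.
Proof. by move=> h; rewrite /signs insubF //; lia. Qed.

Definition rowsets (n : nat) (r : {ffun 'I_n -> bool}) :=
  (desc n (signs r), asc n (signs r)).

Lemma mem_fset_iota n j : (j \in [fset k in iota 0 n.+1]) = (j <= n).
Proof. by rewrite in_fset -[LHS]/(j \in iota 0 n.+1) mem_iota. Qed.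

Lemma mem_Dset n J I : ((J, I) \in Dset n) =
  [&& J `<=` [fset k in iota 0 n.+1], I `<=` [fset k in iota 0 n.+1]
    & interlaced J I].
Proof. by rewrite !inE /= !fpowersetE /= andbA. Qed.

Lemma rowsets_Dset n r : @rowsets n r \in Dset n.
Proof.
rewrite mem_Dset; apply/and3P; split.
- by apply/fsubsetP => j; rewrite !inE /= => /andP[].
- by apply/fsubsetP => j; rewrite !inE /= => /andP[].
- by apply: interlaced_desc_asc => //; rewrite signs_last.
Qed.

(** Starting from the sign + of x_0, membership of k in J or I tells whether the sign changes after
    k. *)
Lemma rowsets_inj n : injective (@rowsets n).
Proof.
move=> r s [eJ eI]; apply/ffunP => i; rewrite -!signs_ord.
suff H k : k <= n.+1 -> signs r k = signs s k by apply: H; have := ltn_ord i;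
  lia.
elim: k => // k IH hk; have {}IH := IH (ltnW hk).
have := mem_desc n (signs r) k; have := mem_asc n (signs r) k.
rewrite eJ eI mem_desc mem_asc IH -ltnS hk !andTb.
by case: (signs s k); case: (signs r k.+1); case: (signs s k.+1).
Qed.

Lemma rowsets_surj n w : w \in Dset n -> exists r, @rowsets n r = w.
Proof.
case: w => J I; rewrite mem_Dset => /and3P[/fsubsetP JS _ H].
have [|g [g0 gn <- <-]] := @interlaced_signs n J I H.
  by move=> j /JS; rewrite mem_fset_iota.
exists [ffun i : 'I_n => g i.+1].
have E k : k <= n.+1 -> signs [ffun i : 'I_n => g i.+1] k = g k.
  case: k => [|k]; first by rewrite g0.
  rewrite ltnS leq_eqVlt => /orP[/eqP->|hk];
    first by rewrite signs_last // (negbTE gn).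
  by rewrite -[k]/(nat_of_ord (Ordinal hk)) signs_ord ffunE.
rewrite /rowsets; f_equal; apply/fsetP => j; rewrite ?mem_desc ?mem_asc;
  case: (leqP j n) => // hj; rewrite !E //; exact: leqW.
Qed.

Lemma big_Dset (V : nmodType) n (F : {fset nat} * {fset nat} -> V) :
  (\sum_(w <- Dset n) F w = \sum_(r : {ffun 'I_n -> bool}) F (rowsets r))%R.
Proof.
transitivity (\sum_(w <- [seq rowsets r | r <- enum {: {ffun 'I_n -> bool}}]) F
  w)%R.
  2: by rewrite big_map big_enum.
apply: perm_big; apply: uniq_perm.
- exact: fset_uniq.
- by rewrite map_inj_uniq ?enum_uniq //; exact: rowsets_inj.
- move=> w; apply/idP/mapP => [/rowsets_surj[r <-]|[r _ ->]].
    by exists r => //; rewrite mem_enum.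
  exact: rowsets_Dset.
Qed.

Lemma sum_elts_filter n (P : pred nat) :
  sum_elts [fset j in iota 0 n.+1 | P j] = \sum_(j < n.+1 | P j) j.
Proof.
rewrite /sum_elts -(big_mkord P id) /index_iota subn0 -[in RHS]big_filter.
apply: perm_big; apply: uniq_perm;
  rewrite ?fset_uniq ?filter_uniq ?iota_uniq //.
by move=> j; rewrite mem_filter !inE /= andbC.
Qed.

Lemma sum_signs n (r : {ffun 'I_n -> bool}) :
  ((\sum_(i < n) (if r i then 1 else -1 : int)) =
   - n%:Z + 2%:Z * ((sum_elts (rowsets r).1)%:Z - (sum_elts (rowsets
     r).2)%:Z))%R.
Proof.
(* Summation by parts. The boundary term [l * g l.+1] vanishes for l = n because x_{n+1} has sign
   -. *)
have H (g : nat -> bool) l : g 0 ->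
    (\sum_(j < l.+1 | g j && ~~ g j.+1) j + l * g l.+1 =
     \sum_(j < l.+1 | ~~ g j && g j.+1) j + \sum_(k < l) g k.+1)%N.
  move=> g0; elim: l => [|l IH].
    by rewrite big_ord0 mul0n !addn0 !big1 // => i; rewrite ord1.
  rewrite big_mkcond big_ord_recr /= -big_mkcond.
  rewrite [in RHS]big_mkcond big_ord_recr /= -big_mkcond [\sum_(k < l.+1)
    _]big_ord_recr /=.
  by case: (g l.+1) IH; case: (g l.+2) => /=; lia.
rewrite !sum_elts_filter.
have {}H := H (signs r) n isT; rewrite signs_last // muln0 addn0 in H.
have -> : (\sum_(i < n) (if r i then 1 else -1 : int) =
    \sum_(i < n) (2 * (signs r i.+1)%:Z - 1))%R.
  by apply: eq_bigr => i _; rewrite signs_ord; case: (r i).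
rewrite big_split /= sumr_const card_ord -GRing.mulr_sumr.
have -> : (\sum_(i < n) (signs r i.+1)%:Z = (\sum_(i < n) signs r i.+1)%N%:Z)%R.
  by rewrite (big_morph Posz PoszD (erefl _)).
rewrite GRing.mulNrn natz H PoszD /=; lia.
Qed.

Section FreeKept.

Variables (n : nat) (g : nat -> bool).
Hypotheses (g0 : g 0) (gn : ~~ g n.+1).
Let J := desc n g.
Let I := asc n g.

Lemma desc_in_U : in_U n J.
Proof.
split.
- have := interlaced_desc_asc g0 gn; case/andP => /eqP + _.
  by rewrite !size_sort -/J; case: (J =P fset0) => // ->.
- by move=> j; rewrite mem_desc => /andP[].
- move=> j j'; rewrite !mem_desc => /and3P[_ h1 h2] /and3P[_ h3 h4] lt.
  by case: (j.+1 =P j') h2 => [->|]; [rewrite h3|lia].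
Qed.

Lemma asc_bounds i : i \in I -> [/\ 0 < i, i < n, i.+1 \notin I & i \notin J].
Proof.
rewrite mem_asc => /and3P[h1 h2 h3]; split.
- by case: i h2 {h1 h3} => //; rewrite g0.
- by rewrite ltn_neqAle h1 andbT; apply: contraNneq gn => <-.
- by rewrite mem_asc h3 andbF.
- by rewrite mem_desc (negbTE h2) andbF.
Qed.

(** The strands through the first row. A free x_i with sign + turns right and meets a crossing again
    marked +, so it goes down at the point i+1; with sign - it goes down at i-1. Both lists being
    increasing, the strands arrive at the kept columns in order. *)
Lemma free_kept : [seq (if g i then i.+1 else i.-1) | i <- free_idx n J] =
  [seq c.+1 | c <- kept n I].
Proof.
have fP i : i \in free_idx n J -> i <= n.+1 /\
    (if g i then g i.+1 /\ i < n.+1 else ~~ g i.-1 /\ 0 < i).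
  rewrite mem_free_idx !mem_desc => /and3P[h1 h2 hi]; split=> //.
  case gi: (g i).
    have lt : i < n.+1.
      by rewrite ltn_neqAle hi andbT; apply: contraNneq gn => <-; rewrite gi.
    by move: h1; rewrite gi /= -ltnS lt /= negbK.
  have i0 : 0 < i by case: (i) gi => //; rewrite g0.
  move: h2; rewrite prednK // gi andbT; case: eqP => [e|_ /=]; first lia.
  by rewrite (_ : i.-1 <= n) //; lia.
apply: (irr_sorted_eq ltn_trans ltnn).
- rewrite sorted_map;
  apply: (@sub_in_sorted _ (fun i => i \in free_idx n J) ltn).
  + move=> i j /fP[hi fi] /fP[hj fj] /= ij.
    case gi: (g i) fi; case gj: (g j) fj => -[h1 h2] [h3 h4]; try lia.
    case: (ltngtP i.+2 j) => hij; try lia.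
    * have eij : i.+1 = j by lia.
      by move: h3; rewrite eij gj.
    * by move: h1; rewrite -hij /= h3.
  + by apply/allP.
  + exact: free_idx_sorted.
- by rewrite sorted_map; exact: kept_sorted.
- move=> x; apply/mapP/mapP => -[i].
  + move=> /fP[hi]; case gi: (g i) => -[h1 h2] ->.
      exists i => //; rewrite mem_kept !mem_asc gi h1 /= !andbF /=.
      by rewrite ltn_neqAle -ltnS h2 andbT; apply: contraNneq gn => <-.
    exists i.-2; last by have : i.-1 <> 0; [move=> e; move: h1;
      rewrite e g0|lia].
    have i2 : i.-2.+1 = i.-1 by have : i.-1 <> 0; [move=> e; move: h1;
      rewrite e g0|lia].
    by rewrite mem_kept !mem_asc i2 (negbTE h1) prednK // gi !andbF /=; lia.
  + rewrite mem_kept => /and3P[h1 h2 hi] ->.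
    case gi: (g i.+1).
      exists i; last first.
        by move: h2; rewrite mem_asc gi andbT negb_and negbK; case/orP;
          [lia|move->].
      rewrite mem_free_idx !mem_desc gi !andbF /=.
      move: h2; rewrite mem_asc gi andbT negb_and negbK => h2.
      have gi' : g i by case/orP: h2 => //; lia.
      by case: (i) hi gi' => //= k hk gk; rewrite gk !andbF /=; lia.
    have gi2 : ~~ g i.+2.
      move: h1; rewrite mem_asc gi /= negb_and => /orP[|//]; lia.
    exists i.+2; last by rewrite (negbTE gi2).
    by rewrite mem_free_idx !mem_desc gi (negbTE gi2) /= !andbF /=; lia.
Qed.

Lemma size_free_kept : size (free_idx n J) = size (kept n I).
Proof. by have := congr1 size free_kept; rewrite !size_map. Qed.

Lemma nth_free_kept k : k < size (kept n I) ->
  let i := nth 0 (free_idx n J) k in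
  (if g i then i.+1 else i.-1) = (nth 0 (kept n I) k).+1.
Proof.
move=> hk /=; have := congr1 (fun s => nth 0 s k) free_kept.
by rewrite !(nth_map 0) ?size_free_kept.
Qed.

End FreeKept.

(** * Smoothings *)

Local Notation vtx := ((nat * nat) + (nat * nat))%type.
Local Notation H i j := (inl (i : nat, j : nat) : vtx).
Local Notation V i j := (inr (i : nat, j : nat) : vtx).

(** The smoothing relation with natural numbers as coordinates: lattices of different sizes are
    compared below, and shifting rows or skipping columns then needs no ordinal casts. *)
Inductive sm (m n : nat) (S : nat -> nat -> bool) : relation vtx :=
| sm_pos_top i j : i < m -> j < n -> S i j -> sm m n S (V i j) (H i j.+1)
| sm_pos_bot i j : i < m -> j < n -> S i j -> sm m n S (H i j) (V i.+1 j)
| sm_neg_top i j : i < m -> j < n -> ~~ S i j -> sm m n S (V i j) (H i j)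
| sm_neg_bot i j : i < m -> j < n -> ~~ S i j -> sm m n S (H i j.+1) (V i.+1 j).

Definition linked m n S := clos_refl_sym_trans _ (sm m n S).

Definition mark m n (s : kstate m n) (i j : nat) : bool :=
  match insub i, insub j with Some i', Some j' => s (i', j') | _, _ =>
    false end.

Lemma mark_ord m n (s : kstate m n) (i : 'I_m) (j : 'I_n) :
  mark s i j = s (i, j).
Proof. by rewrite /mark !valK. Qed.

Definition edge_vtx m n (u : edge m n) : vtx :=
  match u with inl (i, j) => H i j | inr (i, j) => V i j end.

Lemma edge_vtx_inj m n : injective (@edge_vtx m n).
Proof.
move=> [[i j]|[i j]] [[k l]|[k l]] //= [/ord_inj e1 /ord_inj e2].
  by rewrite e1 e2.
by rewrite e1 e2.
Qed.

Definition vvalid m n (x : vtx) :=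
  match x with inl (i, j) => (i < m) && (j <= n)
             | inr (i, j) => (i <= m) && (j < n) end.

Lemma edge_vtx_valid m n (u : edge m n) : vvalid m n (edge_vtx u).
Proof.
by case: u => -[i j] /=; have := ltn_ord i; have := ltn_ord j;
  rewrite !ltnS => -> ->.
Qed.

Lemma edge_vtx_surj m n x : vvalid m n x -> exists u : edge m n, edge_vtx u = x.
Proof.
case: x => -[i j] /= /andP[hi hj].
- by exists (inl (Ordinal hi, Ordinal (hj : j < n.+1))).
- by exists (inr (Ordinal (hi : i < m.+1), Ordinal hj)).
Qed.

Lemma smooth_sym m n (s : kstate m n) : connect_sym (smooth s).
Proof. apply: sym_connect_sym => x y; apply: eq_existsb => c; exact: orbC. Qed.

Lemma connect_linked m n (s : kstate m n) (u v : edge m n) :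
  connect (smooth s) u v <-> linked m n (mark s) (edge_vtx u) (edge_vtx v).
Proof.
have atP c x y : (x, y) \in smooth_at s c ->
    sm m n (mark s) (edge_vtx x) (edge_vtx y).
  case: c => i j; rewrite /smooth_at; have hi := ltn_ord i;
    have hj := ltn_ord j.
  case e: (s (i, j)); rewrite !inE => /orP[] /eqP[-> ->] /=; rewrite ?lift0 /=.
  - by apply: sm_pos_top; rewrite ?mark_ord.
  - by apply: sm_pos_bot; rewrite ?mark_ord.
  - by apply: sm_neg_top; rewrite ?mark_ord ?e.
  - by apply: sm_neg_bot; rewrite ?mark_ord ?e.
have smP x y : sm m n (mark s) x y -> exists u' v',
    [/\ edge_vtx u' = x, edge_vtx v' = y & smooth s u' v'].
  case=> i j hi hj hs; pose c := (Ordinal hi, Ordinal hj);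
    have ec : mark s i j = s c by rewrite -mark_ord.
  - exists (top_end c), (right_end c); split=> //=.
    by apply/existsP; exists c; rewrite /smooth_at -ec hs !inE eqxx.
  - exists (left_end c), (bot_end c); split=> //=.
    by apply/existsP; exists c; rewrite /smooth_at -ec hs !inE eqxx orbT.
  - exists (top_end c), (left_end c); split=> //=.
    by apply/existsP; exists c; rewrite /smooth_at -ec (negbTE hs) !inE eqxx.
  - exists (right_end c), (bot_end c); split=> //=.
    by apply/existsP; exists c;
      rewrite /smooth_at -ec (negbTE hs) !inE eqxx orbT.
split.
- case/connectP => p + ->; elim: p u => [|w p IH] u /=; first by move=> _;
  exact: rst_refl.
  case/andP => /existsP[c uw] /IH; apply: rst_trans; case/orP: uw => /atP h.
    exact: rst_step.
  by apply: rst_sym; exact: rst_step.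
- suff K x y : linked m n (mark s) x y -> x = y \/ exists u' v',
      [/\ edge_vtx u' = x, edge_vtx v' = y & connect (smooth s) u' v'].
    by move=> /K[/edge_vtx_inj->|[u' [v' [/edge_vtx_inj<- /edge_vtx_inj<-]]]].
  elim=> {x y} [x y /smP[u' [v' [h1 h2 h3]]]|x|x y _|x y z _ IH1 _ IH2].
  + by right; exists u', v'; split=> //; exact: connect1.
  + by left.
  + case=> [->|[u' [v' [h1 h2 h3]]]]; first by left.
    by right; exists v', u'; split=> //; rewrite smooth_sym.
  + case: IH1 IH2 => [->//|[u' [v' [h1 h2 h3]]]].
    case=> [<-|[v'' [w' [h4 h5 h6]]]]; first by right; exists u', v'.
    right; exists u', w'; split=> //; apply: connect_trans h3 _.
    by rewrite (edge_vtx_inj (etrans h2 (esym h4))).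
Qed.

Definition vpt (m n : nat) (p : point) : vtx :=
  match p with
  | Top j => V 0 j.-1 | Bot j => V m j.-1 | Lft i => H i.-1 0 | Rgt i =>
    H i.-1 n
  end.

Lemma vpt_valid m n p : on_bdry m n n p -> vvalid m n (vpt m n p).
Proof. by case: p => k /=; lia. Qed.

Lemma edge_atE m n p (u : edge m n) : on_bdry m n n p ->
  edge_at p u <-> edge_vtx u = vpt m n p.
Proof.
case: p => k hk; case: u => -[i j] //=; split=> //.
- by move=> /andP[/eqP-> /eqP<-].
- by case=> -> ->; rewrite prednK ?eqxx //; case/andP: hk.
- by move=> /andP[/eqP-> /eqP<-].
- by case=> -> ->; rewrite prednK ?eqxx //; case/andP: hk.
- by move=> /andP[/eqP<- /eqP->].
- by case=> -> ->; rewrite prednK ?eqxx //; case/andP: hk.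
- by move=> /andP[/eqP<- /eqP->].
- by case=> -> ->; rewrite prednK ?eqxx //; case/andP: hk.
Qed.

Lemma bdry_edgeE m n (u : edge m n) :
  bdry_edge u <-> exists2 p, on_bdry m n n p & edge_vtx u = vpt m n p.
Proof.
case: u => -[i j] /=; have hi := ltn_ord i; have hj := ltn_ord j; split.
- case/orP => /eqP e; [exists (Lft i.+1)|exists (Rgt i.+1)] => //=;
  rewrite ?e //.
- by case=> -[k|k|k|k] //= hk [_ ->]; rewrite eqxx ?orbT.
- case/orP => /eqP e; [exists (Top j.+1)|exists (Bot j.+1)] => //=;
  rewrite ?e //.
- by case=> -[k|k|k|k] //= hk [-> _]; rewrite eqxx ?orbT.
Qed.

Definition matches m n (S : nat -> nat -> bool) (C : connection) : Prop :=
  forall p q, on_bdry m n n p -> on_bdry m n n q -> p <> q ->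
    (mate C p = q <-> linked m n S (vpt m n p) (vpt m n q)).

Lemma is_CsE m n (s : kstate m n) C : ht C = m -> nt C = n -> nb C = n ->
  is_Cs s C <-> matches m n (mark s) C.
Proof.
move=> e1 e2 e3; have BE p : bdry C p = on_bdry m n n p by rewrite /bdry e1 e2
  e3.
have K p q : on_bdry m n n p -> on_bdry m n n q ->
    ((exists u v, [/\ edge_at p u, edge_at q v & connect (smooth s) u v]) <->
     linked m n (mark s) (vpt m n p) (vpt m n q)).
  move=> Bp Bq; split=> [[u [v [/(edge_atE u Bp) eu /(edge_atE v Bq) ev]]]|L].
    by move/connect_linked; rewrite eu ev.
  have [u eu] := edge_vtx_surj (vpt_valid Bp).
  have [v ev] := edge_vtx_surj (vpt_valid Bq).
  exists u, v; split; [exact/(edge_atE u Bp)|exact/(edge_atE v Bq)|].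
  by apply/connect_linked; rewrite eu ev.
split=> [[_ _ _ M] p q Bp Bq ne|M]; first by rewrite M ?BE // K.
by split=> // p q; rewrite !BE => Bp Bq ne; rewrite M // K.
Qed.

Lemma closedE m n (s : kstate m n) (u : edge m n) :
  [exists v, bdry_edge v && connect (smooth s) u v] <->
  exists2 p, on_bdry m n n p & linked m n (mark s) (edge_vtx u) (vpt m n p).
Proof.
split=> [/existsP[v /andP[/bdry_edgeE[p Bp ev] /connect_linked]]|[p Bp L]].
  by rewrite ev; exists p.
have [v ev] := edge_vtx_surj (vpt_valid Bp).
apply/existsP; exists v; apply/andP; split; first by apply/bdry_edgeE; exists p.
by apply/connect_linked; rewrite ev.
Qed.

(** The class of q, which contains no boundary vertex, is absorbed into that of z. On the other
    closed components of [e0] the map [r] is the identity and an adjunction with [e1], so exactly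
    one closed component is lost. *)
Lemma n_comp_extra (T : finType) (e0 e1 : rel T) (bd : pred T) (q z : T) :
    connect_sym e0 -> connect_sym e1 ->
    let r u := if connect e0 q u then z else u in
    (forall u v, connect e1 u v = connect e0 (r u) (r v)) ->
    ~~ connect e0 q z -> (forall v, bd v -> ~~ connect e0 q v) ->
  n_comp e0 [pred u | ~~ [exists v, bd v && connect e0 u v]] =
  (n_comp e1 [pred u | ~~ [exists v, bd v && connect e1 u v]]).+1.
Proof.
move=> s0 s1 r rE nz nb; set c0 := [pred u | _]; set c1 := [pred u | _].
pose a : {pred T} := [pred u | c0 u && ~~ connect e0 q u].
have clo u v x : e0 u v -> connect e0 u x = connect e0 v x.
  by move=> uv; apply: (same_connect s0); exact: connect1.
have cla : closed e0 a.
  move=> u v uv; rewrite !inE; congr (~~ _ && ~~ _).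
    by apply: eq_existsb => x; rewrite (clo _ _ _ uv).
  by rewrite ![connect e0 q _]s0 (clo _ _ _ uv).
have radj : rel_adjunction r e0 e1 a.
  split=> [u|u v _]; last by rewrite rE.
  by rewrite inE => /andP[_ nu]; exists u; rewrite /r (negbTE nu) connect0.
have := adjunction_n_comp r s0 s1 cla radj.
have -> : n_comp e1 [preim r of a] = n_comp e1 c1.
  apply: eq_n_comp_r => u; rewrite !inE.
  have -> : ~~ connect e0 q (r u) by rewrite /r; case: ifP => [//|->].
  rewrite andbT; congr (~~ _); apply: eq_existsb => v.
  case bv: (bd v) => //=; rewrite rE; congr connect.
  by rewrite /r (negbTE (nb v bv)).
move=> <-; rewrite -[LHS](cardID (connect e0 q)) -add1n; congr (_ + _).
  rewrite -(n_comp_connect s0 q); apply: eq_card => u; rewrite !inE.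
  case: (boolP (connect e0 q u)) => qu; rewrite ?andbF //= !andbT.
  rewrite [in LHS](_ : [exists v, _] = false) ?andbT //.
  apply/existsP => -[v /andP[bv uv]].
  by have := nb v bv; rewrite (connect_trans qu uv).
by apply: eq_card => u; rewrite !inE; case: (connect e0 q u);
  rewrite ?andbF ?andbT.
Qed.

(** * Cancellation in the state sum *)

Definition sm_at (a b : nat) (e : bool) (x y : vtx) : Prop :=
  if e then (x = V a b /\ y = H a b.+1) \/ (x = H a b /\ y = V a.+1 b)
  else (x = V a b /\ y = H a b) \/ (x = H a b.+1 /\ y = V a.+1 b).

Lemma smP m n S x y : sm m n S x y <->
  exists a b, [/\ a < m, b < n & sm_at a b (S a b) x y].
Proof.
split=> [|[a [b [ha hb]]]].
  case=> a b ha hb hs; exists a, b; rewrite /sm_at ?hs ?(negbTE hs); split=> //;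
    by [left|right].
rewrite /sm_at; case e: (S a b) => -[[-> ->]|[-> ->]].
- exact: sm_pos_top.
- exact: sm_pos_bot.
- by apply: sm_neg_top; rewrite ?e.
- by apply: sm_neg_bot; rewrite ?e.
Qed.

Section Cancel.

(* S0 has a closed loop through the crossings (k, i), (k, i+1), (k+1, i),
   (k+1, i+1); S1 differs from it at one of the last two crossings only, which
   merges the loop with the strand through z. *)
Variables (m n k i : nat) (S0 S1 : nat -> nat -> bool).
Hypotheses (km : k.+1 < m) (jn : i.+1 < n).
Hypotheses (S0a : S0 k i = false) (S0b : S0 k i.+1 = true)
           (S0c : S0 k.+1 i = true) (S0d : S0 k.+1 i.+1 = false).
Variable c : bool.
Let c0 := if c then i.+1 else i.
Let z := if c then H k.+1 i.+2 else H k.+1 i.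
Hypothesis S1c : S1 k.+1 c0 = c.
Hypothesis S1e : forall a b, (a, b) <> (k.+1, c0) -> S1 a b = S0 a b.

Definition in_loop (x : vtx) : bool :=
  match x with
  | inl (a, b) => ((a == k) || (a == k.+1)) && (b == i.+1)
  | inr (a, b) => (a == k.+1) && ((b == i) || (b == i.+1))
  end.

Definition unloop (x : vtx) : vtx := if in_loop x then z else x.

Lemma in_loop_step x y : sm m n S0 x y -> in_loop x = in_loop y.
Proof.
have f a b : S0 a b -> ~ (a = k /\ b = i) /\ ~ (a = k.+1 /\ b = i.+1).
  by move=> h; split=> -[ea eb]; move: h; rewrite ea eb ?S0a ?S0d.
have f' a b : ~~ S0 a b -> ~ (a = k /\ b = i.+1) /\ ~ (a = k.+1 /\ b = i).
  by move=> h; split=> -[ea eb]; move: h; rewrite ea eb ?S0b ?S0c.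
by case=> a b _ _ => [/f|/f|/f'|/f'] /=; lia.
Qed.

Lemma in_loop_z : in_loop z = false.
Proof. by rewrite /z; case: (c) => /=; lia. Qed.

Lemma in_loop_linked x y : linked m n S0 x y -> in_loop x = in_loop y.
Proof. by elim=> // [? ? /in_loop_step|? ? ? _ -> _ ->]. Qed.

Lemma linked_loop x : in_loop x -> linked m n S0 (H k i.+1) x.
Proof.
have l1 : linked m n S0 (H k i.+1) (V k.+1 i).
  by apply: rst_step; apply: sm_neg_bot; rewrite ?S0a //; lia.
have l2 : linked m n S0 (H k i.+1) (V k.+1 i.+1).
  by apply: rst_step; apply: sm_pos_bot; rewrite ?S0b //; lia.
have l3 : linked m n S0 (H k i.+1) (H k.+1 i.+1).
  apply: rst_trans l1 _.
  by apply: rst_step; apply: sm_pos_top; rewrite ?S0c //; lia.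
case: x => -[a b] /=.
  by case/andP => /orP[] /eqP-> /eqP->; [exact: rst_refl|].
by case/andP => /eqP-> /orP[] /eqP->.
Qed.

Lemma loop_above : linked m n S1 (H k i.+1) (V k.+1 i) /\
  linked m n S1 (H k i.+1) (V k.+1 i.+1).
Proof.
have ne b : (k, b) <> (k.+1, c0) by case; lia.
split; apply: rst_step.
  by apply: sm_neg_bot; rewrite ?S1e ?S0a //; lia.
by apply: sm_pos_bot; rewrite ?S1e ?S0b //; lia.
Qed.

Lemma linked_S0_S1 x y : linked m n S0 x y -> linked m n S1 x y.
Proof.
have [u1 u2] := loop_above.
have S0S1 a b : (a, b) <> (k.+1, c0) -> S0 a b = S1 a b by move=> /S1e ->.
elim=> {x y} [x y st|x|x y _|x y w _ h1 _]; last 3 first.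
- exact: rst_refl.
- exact: rst_sym.
- exact: rst_trans.
case/smP: st => a [b [ha hb]].
have [[-> ->]|ne] := pselect ((a, b) = (k.+1, c0)); last first.
  by rewrite S0S1 // => h; apply: rst_step; apply/smP; exists a, b.
have ci : i < n by lia.
have t1 : S1 k.+1 i = (if c then true else false).
  have := S1e; have := S1c; rewrite /c0; case: (c) => // _ ->; rewrite ?S0c //.
  by case; lia.
have t2 : S1 k.+1 i.+1 = (if c then true else false).
  have := S1e; have := S1c; rewrite /c0; case: (c) => // _ ->; rewrite ?S0d //.
  by case; lia.
have b1 : linked m n S1 (V k.+1 i) (H k.+1 i.+1) /\
          linked m n S1 (V k.+1 i.+1) (H k.+1 i.+1).
  have u3 : linked m n S1 (V k.+1 i) (V k.+1 i.+1).
    by apply: rst_trans (_ : linked _ _ _ _ (H k i.+1)) u2; exact: rst_sym.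
  case: (c) t1 t2 => t1 t2.
    have h : linked m n S1 (V k.+1 i) (H k.+1 i.+1).
      by apply: rst_step; apply: sm_pos_top; rewrite ?t1.
    by split=> //; apply: rst_trans h; exact: rst_sym.
  have h : linked m n S1 (V k.+1 i.+1) (H k.+1 i.+1).
    by apply: rst_step; apply: sm_neg_top; rewrite ?t2.
  by split=> //; apply: rst_trans h.
have [b2 b3] := b1.
rewrite /c0 /sm_at; case: (c) t1 t2 => t1 t2; rewrite ?S0c ?S0d.
  case=> -[-> ->] //.
  apply: rst_trans (_ : linked _ _ _ _ (V k.+1 i.+1)) _.
    by apply: rst_sym; apply: rst_step; apply: sm_pos_top; rewrite ?t2.
  apply: rst_trans b3 _.
  by apply: rst_step; apply: sm_pos_bot; rewrite ?t2.
case=> -[-> ->] //.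
apply: rst_trans (_ : linked _ _ _ _ (V k.+1 i)) _.
  by apply: rst_sym; apply: rst_step; apply: sm_neg_top; rewrite ?t1.
apply: rst_trans b2 _.
by apply: rst_step; apply: sm_neg_bot; rewrite ?t1.
Qed.

Lemma linked_S1_z : linked m n S1 (H k i.+1) z.
Proof.
have [u1 u2] := loop_above; have := S1c; rewrite /z /c0; case: (c) => e.
  by apply: rst_trans u2 _; apply: rst_step; apply: sm_pos_top; rewrite ?e.
by apply: rst_trans u1 _; apply: rst_step; apply: sm_neg_top; rewrite ?e //;
  lia.
Qed.

Lemma linked_S1_S0 x y : linked m n S1 x y -> linked m n S0 (unloop x) (unloop
  y).
Proof.
elim=> {x y} [x y st|x|x y _|x y w _ h1 _]; last 3 first.
- exact: rst_refl.
- exact: rst_sym.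
- exact: rst_trans.
have same x' y' : sm m n S0 x' y' -> linked m n S0 (unloop x') (unloop y').
  move=> h; rewrite /unloop -(in_loop_step h); case: ifP => _.
    exact: rst_refl.
  exact: rst_step.
case/smP: st => a [b [ha hb]].
have [[-> eb]|ne] := pselect ((a, b) = (k.+1, c0)); last first.
  by rewrite S1e // => h; apply: same; apply/smP; exists a, b.
rewrite eb S1c in hb *; rewrite /sm_at /unloop /z.
rewrite /c0 in hb *; case: (c) hb => hb.
  case=> -[-> ->]; rewrite /= !eqxx ?orbT /=.
  - by rewrite !ifF; [exact: rst_refl|lia].
  - by rewrite ifF; [apply: rst_step; apply: sm_neg_bot; rewrite ?S0d|lia].
case=> -[-> ->]; rewrite /= !eqxx ?orbT /=.
- by rewrite !ifF; [exact: rst_refl|lia].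
- by rewrite ifF; [apply: rst_step; apply: sm_pos_bot; rewrite ?S0c|lia].
Qed.

(** The components of S1 are those of S0 with the loop merged into the component of z. No boundary
    edge lies on the loop, so both states realize the same connections. *)
Lemma linked_unloop x y : linked m n S1 x y <-> linked m n S0 (unloop x)
  (unloop y).
Proof.
split=> [|L]; first exact: linked_S1_S0.
have u w : linked m n S1 w (unloop w).
  rewrite /unloop; case: ifP => [lw|_]; last exact: rst_refl.
  apply: rst_trans linked_S1_z.
  by apply: rst_sym; apply: linked_S0_S1; exact: linked_loop.
apply: rst_trans (u x) _; apply: rst_trans (linked_S0_S1 L) _.
by apply: rst_sym; exact: u.
Qed.

Lemma vpt_not_loop p : on_bdry m n n p -> in_loop (vpt m n p) = false.
Proof. by case: p => a /=; lia. Qed.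

Lemma unloop_vpt p : on_bdry m n n p -> unloop (vpt m n p) = vpt m n p.
Proof. by move=> /vpt_not_loop e; rewrite /unloop e. Qed.

Lemma matches_unloop C : matches m n S1 C <-> matches m n S0 C.
Proof.
have K p q : on_bdry m n n p -> on_bdry m n n q ->
    linked m n S1 (vpt m n p) (vpt m n q) <->
    linked m n S0 (vpt m n p) (vpt m n q).
  by move=> Bp Bq; rewrite linked_unloop !unloop_vpt.
by split=> M p q Bp Bq ne; rewrite M ?K.
Qed.

End Cancel.

Lemma closed_count_unloop m n k i (s0 s1 : kstate m n) (c : bool) :
    k.+1 < m -> i.+1 < n ->
    mark s0 k i = false -> mark s0 k i.+1 = true ->
    mark s0 k.+1 i = true -> mark s0 k.+1 i.+1 = false ->
    mark s1 k.+1 (if c then i.+1 else i) = c ->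
    (forall a b, (a, b) <> (k.+1, if c then i.+1 else i) ->
       mark s1 a b = mark s0 a b) ->
  closed_count s0 = (closed_count s1).+1.
Proof.
move=> km jn h1 h2 h3 h4 hc he.
pose z0 := if c then H k.+1 i.+2 else H k.+1 i.
have [z ez] : exists u : edge m n, edge_vtx u = z0.
  by apply: edge_vtx_surj; rewrite /z0; case: (c) => /=; lia.
have [q eq] : exists u : edge m n, edge_vtx u = H k i.+1.
  by apply: edge_vtx_surj => /=; lia.
have qE u : connect (smooth s0) q u = in_loop k i (edge_vtx u).
  apply/idP/idP => [/connect_linked L|lu].
    rewrite -(in_loop_linked km jn h1 h2 h3 h4 hc L) eq /=; lia.
  by apply/connect_linked; rewrite eq;
    exact: (linked_loop km jn h1 h2 h3 h4 hc).
apply: (@n_comp_extra _ _ _ (fun v => bdry_edge v) q z); rewrite ?qE ?ez.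
- exact: smooth_sym.
- exact: smooth_sym.
- move=> u v /=; apply/idP/idP => /connect_linked L; apply/connect_linked.
    move/(linked_unloop km jn h1 h2 h3 h4 hc he): L.
    by rewrite /unloop !qE; case: (in_loop _ _ _); case: (in_loop _ _ _);
      rewrite ?ez.
  apply/(linked_unloop km jn h1 h2 h3 h4 hc he); move: L.
  by rewrite /unloop !qE; case: (in_loop _ _ _); case: (in_loop _ _ _);
    rewrite ?ez.
- by rewrite (in_loop_z km jn h1 h2 h3 h4 hc).
- move=> v /bdry_edgeE[p Bp ev].
  by rewrite qE ev (vpt_not_loop km jn h1 h2 h3 h4 hc Bp).
Qed.

Definition expo m n (s : kstate m n) : int :=
  (\sum_c (if s c then 1 else -1))%R.

Lemma expoE m n (s : kstate m n) :
  ((pos_count s)%:Z - (neg_count s)%:Z)%R = expo s.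
Proof.
rewrite /pos_count /neg_count -!sum1_card /expo [RHS](bigID (fun c => s c)) /=.
rewrite !(big_morph Posz PoszD (erefl _)) -GRing.sumrN.
by congr (_ + _)%R; apply: eq_big => [c|c]; rewrite ?inE //; case: (s c).
Qed.

Definition upd m n (c1 c2 : 'I_m * 'I_n) (x y : bool) (s : kstate m n) :
    kstate m n :=
  [ffun c => if c == c1 then x else if c == c2 then y else s c].

Lemma mark_upd m n (c1 c2 : 'I_m * 'I_n) x y s a b :
  mark (upd c1 c2 x y s) a b =
  if (a, b) == (c1.1 : nat, c1.2 : nat) then x
  else if (a, b) == (c2.1 : nat, c2.2 : nat) then y else mark s a b.
Proof.
case: c1 c2 => i1 j1 [i2 j2] /=; rewrite /mark.
case: insubP => [i' _ <-|ha]; last first.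
  have ni (i : 'I_m) b' : ((a, b) == (i : nat, b')) = false.
    by apply/eqP => -[e _]; move: ha; rewrite e ltn_ord.
  by rewrite !ni.
case: insubP => [j' _ <-|hb]; last first.
  have nj a' (j : 'I_n) : ((nat_of_ord i', b) == (a', j : nat)) = false.
    by apply/eqP => -[_ e]; move: hb; rewrite e ltn_ord.
  by rewrite !nj.
by rewrite ffunE.
Qed.

Section Cancellation.

Variables (K : comUnitRingType) (A : K).
Hypothesis hA : A \is a GRing.unit.
Local Open Scope ring_scope.

Definition weight m n (s : kstate m n) : K :=
  A ^ expo s * (- A ^+ 2 - A ^- 2) ^+ closed_count s.

Definition wterm (C : connection) m n (s : kstate m n) : K :=
  if `[< matches m n (mark s) C >] then weight s else 0.

Lemma catalan_coefE C m n : ht C = m -> nt C = n -> nb C = n ->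
  catalan_coef A C = \sum_(s : kstate m n) wterm C s.
Proof.
move=> <- <- e; rewrite /catalan_coef big_mkcond; apply: eq_bigr => s _.
rewrite /wterm /weight expoE; congr (if _ then _ else _).
by apply/asboolP/asboolP => /(is_CsE s (erefl _) (erefl _) e).
Qed.

Lemma expo_upd m n (c1 c2 : 'I_m * 'I_n) x y (s : kstate m n) : c1 != c2 ->
  s c1 -> ~~ s c2 ->
  expo (upd c1 c2 x y s) = expo s + (if x then 1 else -1) + (if y then 1 else
    -1).
Proof.
move=> ne h1 h2; rewrite /expo (bigD1 c1) // (bigD1 c2) 1?eq_sym //=.
rewrite [in RHS](bigD1 c1) // [in RHS](bigD1 c2) 1?eq_sym //= h1 (negbTE h2).
rewrite !ffunE eqxx eq_sym (negbTE ne) eqxx.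
rewrite (eq_bigr (fun c => if s c then 1 else -1));
  first by move: (\sum_(_ | _) _) => t; case: x; case: y; lia.
by move=> c /andP[n1 n2]; rewrite ffunE (negbTE n1) (negbTE n2).
Qed.

Lemma kauffman_relation (e : int) (l : nat) (d := - A ^+ 2 - A ^- 2) :
  A ^ (e + 1 + 1) * d ^+ l + A ^ e * d ^+ l.+1 + A ^ (e - 1 - 1) * d ^+ l = 0.
Proof.
rewrite -[e + 1 + 1]addrA -[e - 1 - 1]addrA (exprzDr hA e) (exprzDr hA e (-1 -
  1)) exprS.
rewrite -[A ^ (1 + 1)]/(A ^+ 2) -[A ^ (- 1 - 1)]/(A ^- 2) /d; ring.
Qed.

(** The state s carries (+,-) and the loop. Changing the second marker (c = true) gives (+,+),
    changing the first (c = false) gives (-,-); both open the loop, so they have one closed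
    component less and exponents shifted by 2 and -2. *)
Lemma cancel_triple m n (k : nat) (i1 i2 : 'I_n) (k2 : 'I_m) (s : kstate m n) C
  :
    k2 = k.+1 :> nat -> i2 = i1.+1 :> nat ->
    mark s k i1 = false -> mark s k i2 = true -> s (k2, i1) -> ~~ s (k2, i2) ->
  wterm C (upd (k2, i1) (k2, i2) true true s) + wterm C s +
  wterm C (upd (k2, i1) (k2, i2) false false s) = 0.
Proof.
move=> ek ei h1 h2 h3 h4.
have ne : (k2, i1) != (k2, i2) :> 'I_m * 'I_n.
  by apply/eqP => -[] /(congr1 val) /=; rewrite ei; lia.
have km : (k.+1 < m)%N by rewrite -ek.
have jn : (i1.+1 < n)%N by rewrite -ei.
have m1 : mark s k.+1 i1 = true by rewrite -ek mark_ord.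
have m2 : mark s k.+1 i1.+1 = false by rewrite -ek -ei mark_ord (negbTE h4).
rewrite ei in h2.
have up c : mark (upd (k2, i1) (k2,
  i2) c c s) k.+1 (if c then i1.+1 else i1) = c
  /\ (forall a b, (a, b) <> (k.+1, if c then i1.+1 else i1 : nat) ->
      mark (upd (k2, i1) (k2, i2) c c s) a b = mark s a b).
  split=> [|a b nab]; rewrite mark_upd /= ek ei.
    by case: c; rewrite !xpair_eqE !eqxx /= ?eqxx //; case: eqP.
  case: ((a, b) =P _) nab => [[-> ->]|_]; first by case: c => // nab;
    rewrite m1.
  by case: ((a, b) =P _) => [[-> ->]|//]; case: c => // nab; rewrite m2.
have [ut1 ut2] := up true; have [uf1 uf2] := up false.
have lt := @closed_count_unloop m n k i1 s _ true km jn h1 h2 m1 m2 ut1 ut2.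
have lf := @closed_count_unloop m n k i1 s _ false km jn h1 h2 m1 m2 uf1 uf2.
have mt := @matches_unloop m n k i1 (mark s) _ km jn h1 h2 m1 m2 true ut1 ut2 C.
have mf := @matches_unloop m n k i1 (mark s) _ km jn h1 h2 m1 m2 false uf1 uf2
  C.
rewrite /wterm (asbool_equiv_eq mt) (asbool_equiv_eq mf).
case: `[< matches m n (mark s) C >]; last by rewrite !addr0.
rewrite /weight !expo_upd // [in X in _ + X + _]lt.
have -> : closed_count (upd (k2, i1) (k2, i2) false false s) =
          closed_count (upd (k2, i1) (k2, i2) true true s).
  exact: succn_inj (etrans (esym lf) lt).
exact: kauffman_relation.
Qed.

(** P does not see the two markers. Hence the states of the types (+,+), (+,-), (-,-) are all
    indexed by those of type (+,-), and the three terms over each index cancel. *)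
Lemma sum_slide m n (k : nat) (i1 i2 : 'I_n) (k2 : 'I_m) C
    (P : pred (kstate m n)) :
    k2 = k.+1 :> nat -> i2 = i1.+1 :> nat ->
    (forall s, P s -> mark s k i1 = false /\ mark s k i2 = true) ->
    (forall s x y, P (upd (k2, i1) (k2, i2) x y s) = P s) ->
  \sum_(s | P s) wterm C s =
  \sum_(s | P s && (~~ s (k2, i1) && s (k2, i2))) wterm C s.
Proof.
move=> ek ei Pm Pu; set c1 := (k2, i1); set c2 := (k2, i2).
have ne : c1 != c2 by apply/eqP => -[] /(congr1 val) /=; rewrite ei; lia.
have uu x y x' y' s : upd c1 c2 x y (upd c1 c2 x' y' s) = upd c1 c2 x y s.
  by apply/ffunP => c; rewrite !ffunE; case: eqP => // _; case: eqP.
have u1 x y s : upd c1 c2 x y s c1 = x by rewrite ffunE eqxx.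
have u2 x y s : upd c1 c2 x y s c2 = y.
  by rewrite ffunE eq_sym (negbTE ne) eqxx.
have uid (s : kstate m n) : upd c1 c2 (s c1) (s c2) s = s.
  by apply/ffunP => c; rewrite ffunE; case: eqP => [->//|_]; case: eqP => [->|].
have T x y : \sum_(s | P s && ((s c1 == x) && (s c2 == y))) wterm C s =
    \sum_(s | P s && (s c1 && ~~ s c2)) wterm C (upd c1 c2 x y s).
  rewrite (reindex_onto (upd c1 c2 x y) (upd c1 c2 true false)) /=.
    apply: eq_bigl => s; rewrite Pu u1 u2 !eqxx andbT uu -andbA; congr (_ && _).
    rewrite /=; apply/eqP/andP => [<-|[h1 h2]]; first by rewrite u1 u2.
    by rewrite -[RHS]uid h1 (negbTE h2).
  by move=> s /andP[_ /andP[/eqP<- /eqP<-]]; rewrite uu uid.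
rewrite (bigID (fun s : kstate m n =>
  s c1)) /= (bigID (fun s : kstate m n => s c2)) /=.
rewrite [X in _ + X](bigID (fun s : kstate m n =>
  s c2)) /= [X in _ + X]addrC addrA.
rewrite [X in _ + X](_ : _ = \sum_(s | P s && (~~ s c1 && s c2)) wterm C s).
  2: by apply: eq_bigl => s; rewrite andbA.
rewrite -[RHS]add0r; congr (_ + _).
have E x y : \sum_(s | P s && (if x then s c1 else ~~ s c1) &&
      (if y then s c2 else ~~ s c2)) wterm C s =
    \sum_(s | P s && (s c1 && ~~ s c2)) wterm C (upd c1 c2 x y s).
  rewrite -T; apply: eq_bigl => s; rewrite -andbA; congr (_ && (_ && _)).
    by case: x; case: (s c1).
  by case: y; case: (s c2).
rewrite (E true true) (E true false) (E false false) -!big_split /=.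
apply: big1 => s /andP[Ps /andP[h1 h2]].
have -> : upd c1 c2 true false s = s by rewrite -[RHS]uid h1 (negbTE h2).
by have [m1 m2] := Pm s Ps; exact: (cancel_triple C ek ei m1 m2 h1 h2).
Qed.

(** D records at which rows the columns of which cups are already forced to be -, +; it lets the
    cancellation proceed one pair of crossings at a time. *)
Definition settled m n (r : {ffun 'I_n -> bool}) (I : {fset nat})
    (D : nat -> nat -> bool) (s : kstate m.+1 n) : bool :=
  [forall j, s (ord0, j) == r j] &&
  all (fun i => all (fun k => D k i ==> ~~ mark s k i.-1 && mark s k i)
                    (iota 0 m.+1)) I.

Lemma settledP m n (r : {ffun 'I_n -> bool}) (I : {fset nat})
    (D : nat -> nat -> bool) (s : kstate m.+1 n) :
  reflect ((forall j, s (ord0, j) = r j) /\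
    (forall k i, (k <= m)%N -> i \in I -> D k i ->
       mark s k i.-1 = false /\ mark s k i = true)) (settled r I D s).
Proof.
apply: (iffP andP) => -[h1 h2]; split.
- by move=> j; apply/eqP/(forallP h1).
- move=> k i km iI Dk; have := allP (allP h2 i iI) k; rewrite mem_iota Dk.
  by move=> /(_ km) /andP[/negbTE].
- by apply/forallP => j; rewrite h1.
- apply/allP => i iI; apply/allP => k; rewrite mem_iota => km.
  by apply/implyP => /(h2 _ _ km iI)[-> ->].
Qed.

(** Rows are settled from the top, and within a row the cups one by one. Row 0 is settled by the
    definition of I, and each settled row provides the returns that [sum_slide] pushes through the
    next one. *)
Lemma sum_settled m n (r : {ffun 'I_n -> bool}) C (I := (rowsets r).2) :
  \sum_(s : kstate m.+1 n | [forall j, s (ord0, j) == r j]) wterm C s =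
  \sum_(s : kstate m.+1 n | settled r I (fun _ _ => true) s) wterm C s.
Proof.
have In i : i \in I -> [/\ (0 < i)%N, (i < n)%N & i.+1 \notin I].
  by move=> /(@asc_bounds n (signs r)) []; rewrite ?signs_last.
have base : \sum_(s : kstate m.+1 n | [forall j, s (ord0,
  j) == r j]) wterm C s =
    \sum_(s : kstate m.+1 n | settled r I (fun k _ => (k <= 0)%N) s) wterm C s.
  apply: eq_bigl => s; apply/forallP/settledP => [h|[h _] j]; last by rewrite h.
  split=> [j|k i _ iI]; first exact/eqP.
  rewrite leqn0 => /eqP->; have [i0 lt _] := In i iI.
  have mE j : (j < n)%N -> mark s 0 j = signs r j.+1.
    move=> hj; rewrite -[j]/(val (Ordinal hj)) signs_ord.
    by rewrite -[0%N]/(val (@ord0 m)) mark_ord; exact/eqP.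
  rewrite !mE ?prednK //; last lia.
  by move: iI; rewrite mem_asc => /and3P[_ /negbTE-> ->].
suff step k : (k <= m)%N ->
    \sum_(s : kstate m.+1 n | settled r I (fun k _ => (k <= 0)%N) s) wterm C s =
    \sum_(s : kstate m.+1 n | settled r I (fun k' _ =>
      (k' <= k)%N) s) wterm C s.
  rewrite base (step m) //; apply: eq_bigl => s.
  by apply/settledP/settledP => -[h1 h2]; split=> // k i km iI _; exact: h2.
elim: k => // k IH km; rewrite IH; last lia.
pose D (t : seq nat) k' i := (k' <= k)%N || ((k' == k.+1) && (i \in t)).
suff inner t : {subset t <= I} ->
    \sum_(s : kstate m.+1 n | settled r I (fun k' _ =>
      (k' <= k)%N) s) wterm C s =
    \sum_(s : kstate m.+1 n | settled r I (D t) s) wterm C s.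
  rewrite (inner (enum_fset I)) //; apply: eq_bigl => s.
  apply/settledP/settledP => -[h1 h2]; split=> // k' i k'm iI hD;
    apply: h2 => //.
    rewrite /D; move: hD; rewrite leq_eqVlt ltnS => /orP[/eqP->|->//].
    by rewrite eqxx iI orbT.
  by move: hD => /orP[|/andP[/eqP->]]; lia.
elim: t => [_|i t IHt sub].
  by apply: eq_bigl => s; rewrite /settled /D; do 3 (f_equal;
    try (apply: funext => ?));
    rewrite andbF orbF.
rewrite IHt; last by move=> j jt; apply: sub; rewrite inE jt orbT.
have iI : i \in I by apply: sub; rewrite inE eqxx.
have [i0 lt ni] := In i iI.
have [it|nit] := boolP (i \in t).
  apply: eq_bigl => s; rewrite /settled; congr (_ && _); apply: eq_all => j.
  apply: eq_all => k'; rewrite /D inE; case: (j =P i) => [->|_] //.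
  by rewrite it orbT.
have h1 : (i.-1 < n)%N by lia.
pose i1 := Ordinal h1; pose i2 := Ordinal lt.
have hk : (k.+1 < m.+1)%N by [].
pose k2 := Ordinal hk.
have kE b : mark b k2 i1 = b (k2, i1) /\ mark b k2 i2 = b (k2, i2).
  by rewrite !mark_ord.
have := @sum_slide m.+1 n k i1 i2 k2 C (@settled m n r I (D t)).
have ei : i2 = i1.+1 :> nat by rewrite /= prednK.
move=> /(_ (erefl _) ei) ->.
- apply: eq_bigl => s; apply/andP/settledP => [[/settledP[h2 h3]]|[h2 h3]].
    move=> /andP[h4 h5]; split=> // k' j k'm jI.
    rewrite /D inE => /orP[h6|/andP[/eqP-> /orP[/eqP->|h6]]].
    + by apply: h3; rewrite // /D h6.
    + by have := kE s; rewrite (negbTE h4) h5.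
    + by apply: h3; rewrite // /D h6 eqxx orbT.
  split; first apply/settledP; first split=> // k' j k'm jI hD.
    apply: h3 => //; rewrite /D inE; case/orP: hD => [->//|/andP[-> ->]].
    by rewrite !orbT.
  have [e1 e2] := kE s; have [] := h3 k.+1 i hk iI.
    by rewrite /D eqxx inE eqxx orbT.
  by move: e1 e2 => /= -> -> -> ->.
- move=> s /settledP[_ h2]; apply: h2 => //; first lia.
  by rewrite /D leqnn.
- move=> s x y.
  have mu a b : (a, b) <> (k.+1, i.-1) -> (a, b) <> (k.+1, i) ->
      mark (upd (k2, i1) (k2, i2) x y s) a b = mark s a b.
    by move=> n1 n2; rewrite mark_upd; do 2 case: ((a, b) =P _) => //.
  rewrite /settled; congr (_ && _).
    apply: eq_forallb => j; rewrite ffunE.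
    by do 2 case: ((ord0, j) =P _) => [[]|_] //.
  apply: eq_in_all => j jI; apply: eq_in_all => k' _.
  have [j0 jn nj] := In j jI; case hD: (D t k' j) => //=.
  (* Distinct cups occupy disjoint pairs of columns, so changing the markers of one leaves the
     constraints on the others intact. *)
  have njk : k' <> k.+1 \/ [/\ j <> i, j <> i.-1, j.-1 <> i & j.-1 <> i.-1].
    case: (k' =P k.+1) => [ek|]; last by left.
    right; move: hD; rewrite /D ek ltnn eqxx /= => jt.
    have ne : j <> i by move=> e; rewrite -e jt in nit.
    split=> // e; try lia.
      by move: ni; rewrite -(prednK i0) -e in jI * => _; move: nj;
        rewrite e prednK // iI.
    by move: ni; rewrite -e prednK // jI.
  by rewrite !mu //; case: njk => [ne|[n1 n2 n3 n4]] [] //; lia.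
Qed.

End Cancellation.

(** * Contraction of the columns of a state *)

Lemma count_lt_nth (s : seq nat) l : sorted ltn s -> l < size s ->
  count (fun c => c < nth 0 s l) s = l.
Proof.
elim: s l => // x s IH [|l] /= sx hl;
  have /allP xs := order_path_min ltn_trans sx.
  rewrite ltnn add0n; apply/eqP; rewrite -leqn0 leqNgt -has_count.
  by apply/hasPn => c /xs /= xc; rewrite -leqNgt ltnW.
by rewrite (xs _ (mem_nth 0 hl)) add1n IH // (path_sorted sx).
Qed.

Definition rowmap (n : nat) (J I : {fset nat}) (p : point) : point :=
  match p with
  | Top k => xpt n (nth 0 (free_idx n J) k.-1)
  | Bot k => Bot (nth 0 (kept n I) k.-1).+1
  | Lft k => Lft k.+1
  | Rgt k => Rgt k.+1
  end.

(* The product of [ext2] below, spelled out on mates. *)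
Definition rowext (m n : nat) (J I : {fset nat}) (C' C : connection) : Prop :=
  [/\ [/\ ht C' = m, nt C' = size (kept n I) & nb C' = size (kept n I)],
      forall p, bdry C' p -> mate C (rowmap n J I p) = rowmap n J I (mate C' p),
      forall j, j \in J -> mate C (xpt n j) = xpt n j.+1
    & forall i, i \in I -> mate C (Bot i) = Bot i.+1].

(* The state S has first row g, and in all rows its columns i and i+1 are
   marked - and + for i in I.  Contracting the first row and these columns to
   strands gives the state S' of the smaller lattice. *)
Section Contraction.

Variables (m n : nat) (g : nat -> bool).
Hypotheses (g0 : g 0) (gn : ~~ g n.+1).
Let J := desc n g.
Let I := asc n g.
Let kc := kept n I.
Let n' := size kc.
Variables S S' : nat -> nat -> bool.
Hypothesis Srow : forall b, b < n -> S 0 b = g b.+1.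
Hypothesis Scol : forall k i, k < m -> i \in I ->
  S k.+1 i.-1 = false /\ S k.+1 i = true.
Hypothesis Skept : forall k l, k < m -> l < n' -> S k.+1 (nth 0 kc l) = S' k l.

(** The number of kept columns to the left of the horizontal edge e, that is, its coordinate in the
    small lattice. *)
Let cnt (e : nat) : nat := count (fun c => c < e) kc.

Lemma cup_bounds i : i \in I -> [/\ 0 < i, i < n, i.+1 \notin I,
  i \notin J & i.-1 \notin I].
Proof.
move=> iI; have [h1 h2 h3 h4] := asc_bounds g0 gn iI; split=> //.
by apply/negP => /(asc_bounds g0 gn)[_ _ + _]; rewrite prednK ?iI.
Qed.

Lemma zero_notin_I : 0 \notin I.
Proof. by apply/negP => /cup_bounds[]. Qed.

Lemma n_notin_I : n \notin I.
Proof. by apply/negP => /cup_bounds[_]; rewrite ltnn. Qed.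

Lemma mem_kc c : (c \in kc) = [&& c.+1 \notin I, c \notin I & c < n].
Proof. exact: mem_kept. Qed.

Lemma kc_uniq : uniq kc.
Proof. by rewrite filter_uniq // iota_uniq. Qed.

Lemma cnt0 : cnt 0 = 0.
Proof. by rewrite /cnt (@eq_count _ _ pred0) ?count_pred0. Qed.

Lemma cntS e : cnt e.+1 = cnt e + (e \in kc).
Proof. exact: count_ltnS kc_uniq. Qed.

Lemma cntn : cnt n = n'.
Proof.
apply/eqP; rewrite -all_count; apply/allP => c.
by rewrite mem_kc => /and3P[].
Qed.

Lemma cnt_le e : cnt e <= n'.
Proof. exact: count_size. Qed.

Lemma nth_kc l : l < n' -> nth 0 kc l \in kc.
Proof. exact: mem_nth. Qed.

Lemma cnt_nth l : l < n' -> cnt (nth 0 kc l) = l.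
Proof. exact: count_lt_nth (kept_sorted _ _).
Qed.

Lemma nth_cnt c : c \in kc -> nth 0 kc (cnt c) = c /\ cnt c < n'.
Proof.
move=> ck; have hi : index c kc < n' by rewrite index_mem.
by rewrite -{1 3}(nth_index 0 ck) cnt_nth // nth_index.
Qed.

Lemma kept_sign c : c < n -> c \in kc \/ c.+1 \in I \/ c \in I.
Proof.
by move=> hc; rewrite mem_kc hc andbT; case: (c.+1 \in I); case: (c \in I);
  auto.
Qed.

Lemma cup_marks k i : k <= m -> i \in I -> S k i.-1 = false /\ S k i = true.
Proof.
case: k => [_|k]; last exact: Scol.
move=> iI; have [h1 h2 _ _ _] := cup_bounds iI; rewrite !Srow ?prednK //;
  last lia.
by move: iI; rewrite mem_asc => /and3P[_ /negbTE-> ->].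
Qed.

(** A label is an edge of the small lattice or, in the right summand, a boundary arc named by one of
    its ends. The cup under row k, between the columns e-1 and e, is led by the markers -, + of row
    k+1 into the horizontal strand of that row, which is row k of the small lattice; below the last
    row it is a bottom return. *)
Definition loop_label (k e : nat) : vtx + point :=
  if k < m then inl (H k (cnt e)) else inr (Bot e).

(** The edge e of the first row lies between the signs [g e] and [g e.+1]: -+ gives a cup, +- an arc
    e_j, ++ a strand going down at column e and -- one at column e-1. *)
Definition row_label (e : nat) : vtx + point :=
  if e \in I then loop_label 0 e
  else if e \in J then inr (xpt n e)
  else if g e then inl (V 0 (cnt e)) else inl (V 0 (cnt e.-1)).

Definition contract (x : vtx) : vtx + point :=
  match x with
  | inl (0, e) => row_label e
  | inl (k.+1, e) => if e \in I then loop_label k.+1 e else inl (H k (cnt e))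
  | inr (0, c) => if g c.+1 then row_label c.+1 else row_label c
  | inr (k.+1, c) => if c.+1 \in I then loop_label k c.+1
                     else if c \in I then loop_label k c else inl (V k (cnt c))
  end.

Definition linked' (x y : vtx + point) : Prop :=
  x = y \/ exists a b, [/\ x = inl a, y = inl b & linked m n' S' a b].

Lemma contract_step x y : sm m.+1 n S x y -> linked' (contract x) (contract y).
Proof.
case/smP => k [c [hk hc hs]]; have cn : cnt c.+1 = cnt c + (c \in kc) := cntS c.
case: k hk hs => [_|k hk].
  rewrite (Srow hc) /sm_at; case gc: (g c.+1) => -[[-> ->]|[-> ->]] /=; left;
    rewrite ?gc //.
    rewrite /row_label (_ : c.+1 \in I = false);
      last by rewrite mem_asc gc andbF.
    by case: ifP => // cI; rewrite mem_desc gc andbF; move: cI;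
      rewrite mem_asc gc andbT ltnW //= => /negbFE->.
  rewrite /row_label (_ : c \in I = false); last by rewrite mem_asc gc !andbF.
  by case: ifP => // _; rewrite mem_desc gc andbF.
have [ck|[cI|cI]] := kept_sign hc.
- have [e1 e2] := nth_cnt ck; rewrite ck addn1 in cn.
  have /and3P[/negbTE n1 /negbTE n2 _] : [&& c.+1 \notin I, c \notin I & c < n].
    by rewrite -mem_kc.
  have -> : S k.+1 c = S' k (cnt c) by rewrite -Skept // e1.
  rewrite /sm_at; case es: (S' _ _) => -[[-> ->]|[-> ->]] /=;
    rewrite ?n1 ?n2 ?cn; right; do 2 eexists; split; try reflexivity;
    apply: rst_step; apply/smP; exists k, (cnt c); rewrite es /=; split=> //;
    by [left|right].
- have [_ _ n1 _ n2] := cup_bounds cI; have [es _] := Scol hk cI;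
  rewrite /= in es n2.
  rewrite es /=; have nk : c \in kc = false by rewrite mem_kc cI.
  rewrite nk addn0 in cn.
  by case=> -[-> ->] /=; left;
    rewrite ?cI ?(negbTE n2) // /loop_label (hk : k < m) cn.
- have [_ _ n1 _ n2] := cup_bounds cI; have [_ es] := Scol hk cI.
  rewrite es /=; have nk : c \in kc = false by rewrite mem_kc cI andbF.
  rewrite nk addn0 in cn.
  by case=> -[-> ->] /=; left;
    rewrite ?cI ?(negbTE n1) // /loop_label (hk : k < m) cn.
Qed.

Lemma linked'_sym x y : linked' x y -> linked' y x.
Proof.
by case=> [->|[a [b [-> -> L]]]]; [left|right; exists b, a; split=> //;
  exact: rst_sym].
Qed.

Lemma linked'_trans x y w : linked' x y -> linked' y w -> linked' x w.
Proof.
case=> [->//|[a [b [-> -> L]]]] [<-|[b' [c [[<-] -> L']]]]; right.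
  by exists a, b.
by exists a, c; split=> //; exact: rst_trans L L'.
Qed.

Lemma contract_linked x y :
  linked m.+1 n S x y -> linked' (contract x) (contract y).
Proof.
elim=> {x y} [x y|x|x y _|x y w _ h1 _]; first exact: contract_step.
- by left.
- exact: linked'_sym.
- exact: linked'_trans.
Qed.

(** A section of [contract]: among the edges of row k+1 between two kept columns it picks the one
    next to the left column, or the edge 0 at the left side. *)
Definition expand (y : vtx) : vtx :=
  match y with
  | inl (k, l) => H k.+1 (if l is l'.+1 then (nth 0 kc l').+1 else 0)
  | inr (k, l) => V k.+1 (nth 0 kc l)
  end.

Lemma link k c x y : k <= m -> c < n -> sm_at k c (S k c) x y ->
  linked m.+1 n S x y /\ linked m.+1 n S y x.
Proof.
move=> hk hc h; have L : linked m.+1 n S x y.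
  by apply: rst_step; apply/smP; exists k, c.
by split=> //; exact: rst_sym.
Qed.

Lemma loop_links k i : k <= m -> i \in I ->
  linked m.+1 n S (H k i) (V k.+1 i.-1) /\ linked m.+1 n S (H k i) (V k.+1 i).
Proof.
move=> hk iI; have [s1 s2] := cup_marks hk iI;
  have [i0 hi _ _ _] := cup_bounds iI.
have hi' : i.-1 < n by lia.
have [] := @link k i.-1 (H k i.-1.+1) (V k.+1 i.-1) hk hi'.
  by rewrite s1 /=; right.
have [] := @link k i (H k i) (V k.+1 i) hk hi; first by rewrite s2; right.
by rewrite prednK.
Qed.

Lemma through_links k i : k < m -> i \in I ->
  linked m.+1 n S (H k i) (H k.+1 i.-1) /\ linked m.+1 n S (H k i) (H k.+1
    i.+1).
Proof.
move=> hk iI; have [l1 l2] := loop_links (ltnW hk) iI.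
have [s1 s2] := cup_marks hk iI; have [i0 hi _ _ _] := cup_bounds iI.
have hi' : i.-1 < n by lia.
split; [apply: rst_trans l1 _|apply: rst_trans l2 _].
  by have [] := @link k.+1 i.-1 (V k.+1 i.-1) (H k.+1 i.-1) hk hi';
    rewrite ?s1 /=; auto.
by have [] := @link k.+1 i (V k.+1 i) (H k.+1 i.+1) hk hi; rewrite ?s2 /=; auto.
Qed.

(** In row k+1 the edges on the two sides of a deleted pair of columns are joined through the cup
    hanging from row k. So all edges between consecutive kept columns, apart from those inside
    deleted pairs, represent one edge of the small lattice. *)
Lemma chain k e : k < m -> e <= n -> e \notin I ->
  linked m.+1 n S (H k.+1 e) (expand (H k (cnt e))).
Proof.
move=> hk; elim/ltn_ind: e => -[|c] IH hc nI.
  by rewrite cnt0; exact: rst_refl.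
have [ck|[cI|cI]] := kept_sign hc; last 2 first.
- by rewrite cI in nI.
- have [i0 hi _ nJ n2] := cup_bounds cI; have [l1 l2] := through_links hk cI.
  apply: rst_trans (_ : linked _ _ _ (H k.+1 c.+1) (H k c)) _;
    first exact: rst_sym.
  apply: rst_trans l1 _.
  have ec : cnt c.+1 = cnt c.-1.
    by rewrite cntS -[in LHS](prednK i0) cntS !mem_kc prednK // cI /= andbF
      !addn0.
  by rewrite ec; apply: IH => //; lia.
by rewrite cntS ck addn1 /= (nth_cnt ck).1; exact: rst_refl.
Qed.

Definition good_label (x : vtx) (t : vtx + point) : Prop :=
  match t with
  | inl y => vvalid m n' y /\ linked m.+1 n S x (expand y)
  | inr p => linked m.+1 n S x (vpt m.+1 n p) /\
     ((exists2 j, j \in J & p = xpt n j) \/ (exists2 i, i \in I & p = Bot i))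
  end.

Lemma good_label_trans x y t : linked m.+1 n S x y -> good_label y t ->
  good_label x t.
Proof.
by move=> L; case: t => z [] /= h1 h2; split=> //; exact: rst_trans L _.
Qed.

Lemma good_loop_label k e : k <= m -> e \in I ->
  good_label (H k e) (loop_label k e).
Proof.
move=> hk eI; have [e0 he _ _ ne] := cup_bounds eI; rewrite /loop_label;
  case: ltnP => km /=.
  have [l1 _] := through_links km eI; split; first by rewrite km cnt_le.
  apply: rst_trans l1 _; have -> : cnt e = cnt e.-1.
    by rewrite -[in LHS](prednK e0) cntS mem_kc prednK // eI addn0.
  by apply: chain => //; lia.
have -> : k = m by lia.
by have [l1 _] := loop_links (leqnn m) eI; split=> //; right; exists e.
Qed.

Lemma good_row_label e : e <= n -> good_label (H 0 e) (row_label e).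
Proof.
move=> he; rewrite /row_label; case: (boolP (e \in I)) => eI.
  exact: good_loop_label.
case: (boolP (e \in J)) => eJ.
  split; last by left; exists e.
  rewrite /xpt; case: eqP => [->|e0]; first exact: rst_refl.
  rewrite he /=; have e1 : e.-1 < n by lia.
  have ep : 0 < e by lia.
  have ge : g e.-1.+1 by move: eJ; rewrite prednK // mem_desc => /and3P[].
  have [] := @link 0 e.-1 (V 0 e.-1) (H 0 e.-1.+1) (leq0n m) e1.
    by rewrite Srow // ge; left.
  by rewrite prednK.
move: eI eJ; rewrite mem_asc mem_desc he /=; case ge: (g e) => /=;
  [move=> _|move=> ge1 _].
  rewrite negbK => ge1; have en : e < n.
    by rewrite ltn_neqAle he andbT; apply: contraNneq gn => <-.
  have ek : e \in kc by rewrite mem_kc !mem_asc ge ge1 !andbF.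
  have [h1 h2] := nth_cnt ek; split; first by [].
  rewrite /= h1; have [] // := @link 0 e (H 0 e) (V 1 e) (leq0n m) en.
  by rewrite Srow // ge1; right.
have e0 : 0 < e by case: (e) ge => //; rewrite g0.
have e1 : e.-1 < n by lia.
have ek : e.-1 \in kc by rewrite mem_kc !mem_asc prednK // ge (negbTE ge1)
  !andbF.
have [h1 h2] := nth_cnt ek; split; first by [].
rewrite /= h1; have [] := @link 0 e.-1 (H 0 e.-1.+1) (V 1 e.-1) (leq0n m) e1.
  by rewrite Srow // (_ : g _ = false) ?prednK //; right; rewrite ?prednK.
by rewrite prednK.
Qed.

Lemma contractP x : vvalid m.+1 n x -> good_label x (contract x).
Proof.
case: x => -[[|k] c] /= vx.
- exact: good_row_label.
- have /andP[hk hc] := vx; case: ifP => cI; first exact: good_loop_label.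
  by split=> /=; [rewrite -ltnS hk cnt_le|apply: chain; rewrite ?cI].
- have hk := leq0n m; have hc : c < n := vx.
  case gc: (g c.+1).
    apply: good_label_trans (good_row_label hc).
    by have [] // := @link 0 c (V 0 c) (H 0 c.+1) hk hc; rewrite Srow // gc;
      left.
  apply: good_label_trans (good_row_label (ltnW hc)).
  by have [] // := @link 0 c (V 0 c) (H 0 c) hk hc; rewrite Srow // gc; left.
- have /andP[hk hc] := vx; case: (boolP (c.+1 \in I)) => cI.
    have [l1 _] := loop_links hk cI.
    by apply: good_label_trans (good_loop_label hk cI); exact: rst_sym.
  case: (boolP (c \in I)) => cI'.
    have [_ l1] := loop_links hk cI'.
    by apply: good_label_trans (good_loop_label hk cI'); exact: rst_sym.
  have ck : c \in kc by rewrite mem_kc cI cI'.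
  have [h1 h2] := nth_cnt ck; split=> /=; first by rewrite h2 andbT.
  by rewrite h1; exact: rst_refl.
Qed.

Lemma expand_linked y y' : linked m n' S' y y' ->
  linked m.+1 n S (expand y) (expand y').
Proof.
elim=> {y y'} [y y' /smP[k [l [hk hl]]]|y|y y' _|x y z _ h1 _]; last 3 first.
- exact: rst_refl.
- exact: rst_sym.
- exact: rst_trans.
have ck := nth_kc hl; set c := nth 0 kc l in ck.
have /and3P[n1 n2 hc] : [&& c.+1 \notin I,
  c \notin I & c < n] by rewrite -mem_kc.
have ch : linked m.+1 n S (H k.+1 c) (expand (H k l)).
  by rewrite -(cnt_nth hl) -/c; apply: chain => //; exact: ltnW.
have ch' := rst_sym _ _ _ _ ch.
rewrite -Skept // -/c /sm_at; case es: (S k.+1 c) => -[[-> ->]|[-> ->]].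
- by have [] // := @link k.+1 c (V k.+1 c) (H k.+1 c.+1) hk hc; rewrite es;
  left.
- apply: rst_trans ch' _.
  by have [] // := @link k.+1 c (H k.+1 c) (V k.+2 c) hk hc; rewrite es; right.
- apply: rst_trans ch.
  by have [] // := @link k.+1 c (V k.+1 c) (H k.+1 c) hk hc; rewrite es; left.
- by have [] // := @link k.+1 c (H k.+1 c.+1) (V k.+2 c) hk hc; rewrite es;
  right.
Qed.

Lemma contract_expand y : vvalid m n' y -> contract (expand y) = inl y.
Proof.
case: y => -[k l] /= /andP[hk hl].
- case: l hl => [|l] hl; first by rewrite (negbTE zero_notin_I) cnt0.
  have := nth_kc hl; rewrite mem_kc => /and3P[/negbTE-> _ _].
  by rewrite cntS nth_kc // cnt_nth // addn1.
- by have := nth_kc hl; rewrite mem_kc => /and3P[/negbTE-> /negbTE-> _];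
  rewrite cnt_nth.
Qed.

(** Linked edges have linked labels; conversely each edge is linked to the representative of its
    label, which [expand] or the named boundary point provides. *)
Lemma linkedE x y : vvalid m.+1 n x -> vvalid m.+1 n y ->
  linked m.+1 n S x y <-> linked' (contract x) (contract y).
Proof.
move=> vx vy; split=> [|L]; first exact: contract_linked.
have := contractP vx; have := contractP vy.
case: L => [->|[a [b [-> -> L]]]]; last first.
  move=> /= [_ Ly] [_ Lx]; apply: rst_trans Lx _.
  by apply: rst_trans (expand_linked L) _; exact: rst_sym.
by case: (contract y) => z /= [h1 h2] [h3 h4];
  [apply: rst_trans h4 _|apply: rst_trans h3 _]; exact: rst_sym.
Qed.

Let rho := rowmap n J I.

Lemma size_free : size (free_idx n J) = n'.
Proof. exact: size_free_kept. Qed.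

Lemma rowmap_bdry p : on_bdry m n' n' p -> on_bdry m.+1 n n (rho p).
Proof.
case: p => k /= hk; [| |lia|lia].
  have : nth 0 (free_idx n J) k.-1 \in free_idx n J.
    by apply: nth_free_idx; rewrite size_free; lia.
  by rewrite mem_free_idx => /and3P[_ _ le]; exact: xpt_bdry.
have : nth 0 kc k.-1 \in kc by apply: nth_kc; lia.
by rewrite mem_kc => /and3P[].
Qed.

Lemma contract_xpt i : i <= n.+1 -> contract (vpt m.+1 n (xpt n i)) =
  if g i then row_label i else row_label i.-1.
Proof.
move=> hi; rewrite /xpt; case: (i =P 0) => [->|i0]; first by rewrite g0.
case: (leqP i n) => le; first by rewrite /= prednK //; lia.
by have -> : i = n.+1; [lia|rewrite (negbTE gn)].
Qed.

Lemma contract_rowmap p : on_bdry m n' n' p ->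
  contract (vpt m.+1 n (rho p)) = inl (vpt m n' p).
Proof.
case: p => k hk; rewrite /on_bdry in hk.
- have hk' : k.-1 < n' by lia.
  have : nth 0 (free_idx n J) k.-1 \in free_idx n J.
    by apply: nth_free_idx; rewrite size_free.
  rewrite mem_free_idx => /and3P[f1 f2 f3]; rewrite /rho /= contract_xpt //.
  have := nth_free_kept g0 gn hk'; rewrite -/J -/I -/kc /=.
  set i := nth 0 (free_idx n J) k.-1 in f1 f2 f3 *.
  have ck := nth_kc hk'; have e := cnt_nth hk'; set c := nth 0 kc _ in ck e *.
  rewrite /row_label; case gi: (g i) => ei.
    have -> : i \in I = false by rewrite mem_asc gi andbF.
    by rewrite (negbTE f1) -[i]/(i.+1.-1) ei /= e.
  have i0 : i == 0 = false by apply/negP => /eqP i0; rewrite i0 g0 in gi.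
  rewrite i0 /= in f2; rewrite (negbTE f2) ei /=.
  have -> : c.+1 \in I = false by move: ck; rewrite mem_kc => /and3P[/negbTE].
  move: f2; rewrite mem_desc ei /= e.
  have -> : c.+1.+1 = i by move: i0 ei; case: (i) => //= ? _ ->.
  rewrite gi andbT; case: (g c.+1) => //.
  by rewrite (_ : c.+1 <= n) //; move: i0 ei f3; case: (i) => //= ? _ ->.
- have hk' : k.-1 < n' by lia.
  have := nth_kc hk'; rewrite mem_kc /= => /and3P[/negbTE-> /negbTE-> _].
  by rewrite cnt_nth.
- case: k hk => // k _ /=.
  by rewrite (negbTE zero_notin_I) cnt0.
- by case: k hk => // k _ /=; rewrite (negbTE n_notin_I) cntn.
Qed.

Lemma contract_e j : j \in J -> contract (vpt m.+1 n (xpt n j)) = inr (xpt n j)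
  /\
  contract (vpt m.+1 n (xpt n j.+1)) = inr (xpt n j).
Proof.
move=> jJ; have /and3P[h1 h2 h3] : [&& j <= n,
  g j & ~~ g j.+1] by rewrite -mem_desc.
rewrite !contract_xpt ?(leqW h1) // h2 (negbTE h3) /= /row_label jJ.
by rewrite mem_asc h2 andbF.
Qed.

Lemma contract_cup i : i \in I -> contract (vpt m.+1 n (Bot i)) = inr (Bot i) /\
  contract (vpt m.+1 n (Bot i.+1)) = inr (Bot i).
Proof.
move=> iI; have [i0 _ /negbTE n1 _ _] := cup_bounds iI.
by rewrite /= prednK // n1 iI /loop_label ltnn.
Qed.

Lemma row_cases p : on_bdry m.+1 n n p ->
  [\/ exists2 p', on_bdry m n' n' p' & rho p' = p,
      exists2 j, j \in J & p = xpt n j \/ p = xpt n j.+1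
    | exists2 i, i \in I & p = Bot i \/ p = Bot i.+1].
Proof.
move=> Bp; case: (topmap_cases J Bp) => [[p' Bp' e]|]; last by constructor 2.
rewrite size_free in Bp'; case: p' Bp' e => k hk e.
- by constructor 1; exists (Top k).
- have hk' : k.-1 < n by move: hk => /=; lia.
  have ek : k = k.-1.+1 by move: hk => /=; lia.
  rewrite -e /= ek; case: (kept_sign hk') => [ck|[iI|iI]].
  + constructor 1; exists (Bot (cnt k.-1).+1);
    last by rewrite /= (nth_cnt ck).1.
    by rewrite /= (nth_cnt ck).2.
  + by constructor 3; exists k.-1.+1 => //; left.
  + by constructor 3; exists k.-1 => //; right.
- by constructor 1; exists (Lft k).
- by constructor 1; exists (Rgt k).
Qed.

Lemma rowmap_inj : {in on_bdry m n' n' &, injective rho}.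
Proof.
have xB i k : xpt n i <> Bot k by rewrite /xpt; case: eqP => //; case: ifP.
have xL i k : 0 < k -> xpt n i <> Lft k.+1.
  by rewrite /xpt => k0; case: eqP => [_ [e]|_]; [lia|case: ifP].
have xR i k : 0 < k -> xpt n i <> Rgt k.+1.
  by rewrite /xpt => k0; case: eqP => // _; case: ifP => // _ [e]; lia.
have fu : uniq (free_idx n J) by rewrite filter_uniq // iota_uniq.
have fT k : 0 < k <= n' -> nth 0 (free_idx n J) k.-1 <= n.+1.
  move=> hk; have : nth 0 (free_idx n J) k.-1 \in free_idx n J.
    by apply: nth_free_idx; rewrite size_free; lia.
  by rewrite mem_free_idx => /and3P[].
move=> [i|i|i|i] [j|j|j|j]; rewrite ?unfold_in /= => hi hj e //;
  try by case: e => ->.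
- move/xpt_inj: e => /(_ (fT _ hi) (fT _ hj)) /eqP.
  by rewrite nth_uniq ?size_free //; [move/eqP => ?; f_equal; lia|lia|lia].
- by case: (xB _ _ e).
- by case: (@xL (nth 0 (free_idx n J) i.-1) j) => //; case/andP: hj.
- by case: (@xR (nth 0 (free_idx n J) i.-1) j) => //; case/andP: hj.
- by case: (xB _ _ (esym e)).
- have hi' : i.-1 < n' by lia.
  have hj' : j.-1 < n' by lia.
  case: e => /eqP; rewrite nth_uniq ?kc_uniq // => /eqP eij.
  by f_equal; lia.
- by case: (@xL (nth 0 (free_idx n J) j.-1) i) => //; case/andP: hi.
- by case: (@xR (nth 0 (free_idx n J) j.-1) i) => //; case/andP: hi.
Qed.

Lemma row_arc C p : (forall j, j \in J -> mate C (xpt n j) = xpt n j.+1) ->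
    (forall i, i \in I -> mate C (Bot i) = Bot i.+1) ->
    on_bdry m.+1 n n p ->
  (exists2 p', on_bdry m n' n' p' & rho p' = p) \/
  exists p1, [/\ p = p1 \/ p = mate C p1, contract (vpt m.+1 n p1) = inr p1
    & contract (vpt m.+1 n (mate C p1)) = inr p1].
Proof.
move=> hJ hI /row_cases[|[j jJ jE]|[i iI iE]]; first by left.
  by right; exists (xpt n j); rewrite hJ //; have [] := contract_e jJ.
by right; exists (Bot i); rewrite hI //; have [] := contract_cup iI.
Qed.

Lemma linked_vpt p q : on_bdry m.+1 n n p -> on_bdry m.+1 n n q ->
  linked m.+1 n S (vpt m.+1 n p) (vpt m.+1 n q) <->
  linked' (contract (vpt m.+1 n p)) (contract (vpt m.+1 n q)).
Proof. by move=> Bp Bq; apply: linkedE; exact: vpt_valid. Qed.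

Lemma linked_rowmap p q : on_bdry m n' n' p -> on_bdry m n' n' q ->
  linked m.+1 n S (vpt m.+1 n (rho p)) (vpt m.+1 n (rho q)) <->
  linked m n' S' (vpt m n' p) (vpt m n' q).
Proof.
move=> Bp Bq; rewrite linked_vpt ?rowmap_bdry // !contract_rowmap //.
split=> [[[->]|[a [b [[->] [->]]]]]|L] //; first exact: rst_refl.
by right; do 2 eexists; split; last exact: L.
Qed.

(** Boundary points outside the image of [rowmap] are ends of arcs indexed by J or I. Their labels
    lie in the right summand, so among boundary points the smoothing links them to their partners
    only, as C does. *)
Lemma matches_rowext C' C : rowext m n J I C' C ->
  matches m.+1 n S C <-> matches m n' S' C'.
Proof.
move=> [[e1 e2 e3] hr hJ hI].
have BE p : bdry C' p = on_bdry m n' n' p by rewrite /bdry e1 e2 e3.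
have mB p : on_bdry m n' n' p -> on_bdry m n' n' (mate C' p).
  by rewrite -!BE; exact: mate_bdry.
have mE p q : on_bdry m n' n' p -> on_bdry m n' n' q ->
    mate C (rho p) = rho q <-> mate C' p = q.
  move=> Bp Bq; rewrite hr ?BE //; split=> [|->//].
  by apply: rowmap_inj => //; exact: mB.
split=> M p q Bp Bq ne.
  rewrite -mE // M ?rowmap_bdry ?linked_rowmap //.
  by move=> e; apply: ne; exact: rowmap_inj e.
case: (row_arc hJ hI Bp) => [[p' Bp' ep]|[p1 [pE c1 c2]]].
  case: (row_arc hJ hI Bq) => [[q' Bq' eq]|[q1 [qE d1 d2]]].
    rewrite -ep -eq mE // linked_rowmap //; apply: M => // e.
    by apply: ne; rewrite -ep -eq e.
  have cq : contract (vpt m.+1 n q) = inr q1 by case: qE => ->.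
  rewrite linked_vpt // cq -ep contract_rowmap //; split; last first.
    by case=> [//|[a [b []]]].
  move=> e; move: cq; rewrite -e hr ?BE // contract_rowmap //; exact: mB.
have cp : contract (vpt m.+1 n p) = inr p1 by case: pE => ->.
rewrite linked_vpt // cp; split=> [<-|].
  by left; case: pE => ->; rewrite ?mateK ?c1 ?c2.
case=> [cq|[a [b [//]]]].
case: (row_arc hJ hI Bq) => [[q' Bq' eq]|[q1 [qE d1 d2]]].
  by move: cq; rewrite -eq contract_rowmap.
have eq1 : p1 = q1 by move: cq; case: qE => ->; rewrite ?d1 ?d2 => -[].
move: qE pE ne; rewrite -eq1 => -[->|->] [->|->] ne //.
exact: mateK.
Qed.

Lemma matches_arcs C : matches m.+1 n S C ->
  (forall j, j \in J -> mate C (xpt n j) = xpt n j.+1) /\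
  (forall i, i \in I -> mate C (Bot i) = Bot i.+1).
Proof.
move=> M; split=> [j jJ|i iI].
  have hj : j <= n by move: jJ; rewrite mem_desc => /andP[].
  have [c1 c2] := contract_e jJ.
  have B1 := @xpt_bdry m n n j (leqW hj); have B2 := @xpt_bdry m n n j.+1 hj.
  apply/M => //; first by move/xpt_inj => /(_ (leqW hj) hj); lia.
  by apply/linked_vpt => //; rewrite c1 c2; left.
have [i0 hi _ _ _] := cup_bounds iI; have [c1 c2] := contract_cup iI.
have B1 : on_bdry m.+1 n n (Bot i) by rewrite /= i0 ltnW.
have B2 : on_bdry m.+1 n n (Bot i.+1) by rewrite /= hi.
apply/M => //; first by case; lia.
by apply/linked_vpt => //; rewrite c1 c2; left.
Qed.

Lemma bdry_linked y : vvalid m n' y ->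
  (exists2 p, on_bdry m.+1 n n p & linked m.+1 n S (expand y) (vpt m.+1 n p))
    <->
  (exists2 p, on_bdry m n' n' p & linked m n' S' y (vpt m n' p)).
Proof.
move=> vy; have ey := contract_expand vy; split=> [[p Bp L]|[p Bp L]].
  have {}L := contract_linked L; rewrite ey in L.
  case: (row_cases Bp) => [[p' Bp' e]|[j jJ jE]|[i iI iE]].
  - exists p' => //; rewrite -e contract_rowmap // in L.
    by case: L => [[<-]|[a [b [[->] [->]]]]] //; exact: rst_refl.
  - have [c1 c2] := contract_e jJ.
    by case: jE L => ->; rewrite ?c1 ?c2 => -[//|[a [b []]]].
  - have [c1 c2] := contract_cup iI.
    by case: iE L => ->; rewrite ?c1 ?c2 => -[//|[a [b []]]].
exists (rho p); first exact: rowmap_bdry.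
apply: rst_trans (expand_linked L) _.
have := contractP (vpt_valid (rowmap_bdry Bp)); rewrite contract_rowmap //.
by case=> _; exact: rst_sym.
Qed.

(** [expand] is an adjunction on the closed components: an edge whose label lies in the right
    summand is linked to a boundary point, so it does not lie on a closed component. *)
Lemma closed_count_contract (s : kstate m.+1 n) (s' : kstate m n') :
  mark s = S -> mark s' = S' -> closed_count s = closed_count s'.
Proof.
move=> eS eS'.
have vE y : vvalid m n' y -> vvalid m.+1 n (expand y).
  case: y => -[k l] /= /andP[hk hl].
    by rewrite ltnS hk; case: l hl => //= l /nth_kc; rewrite mem_kc => /and3P[].
  by rewrite ltnS hk; move/nth_kc: hl; rewrite mem_kc => /and3P[].
have hP (u : edge m n') : {v : edge m.+1 n | edge_vtx v = expand (edge_vtx u)}.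
  by apply/cid/edge_vtx_surj/vE/edge_vtx_valid.
pose h u := sval (hP u);
  have hE u : edge_vtx (h u) = expand (edge_vtx u) := svalP (hP u).
rewrite /closed_count; set a := [pred u | _]; set a' := [pred u | _].
have cla : closed (smooth s) a.
  move=> u v uv; rewrite !inE; congr (~~ _); apply: eq_existsb => x;
    congr (_ && _).
  by apply: (same_connect (smooth_sym s)); exact: connect1.
have radj : rel_adjunction h (smooth s) (smooth s') a.
  split=> [u ua|u v _].
    suff : exists u', connect (smooth s) u (h u') by move/cid.
    have := contractP (edge_vtx_valid u); case: (contract (edge_vtx u)) => y /=.
      case=> vy L; have [u' eu'] := edge_vtx_surj vy.
      by exists u'; apply/connect_linked; rewrite hE eu' eS.
    case=> L pE; move: ua; rewrite inE => /negP[]; apply/closedE.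
    exists y; last by rewrite eS.
    case: pE => -[i iI ->]; last by have [i0 hi _ _ _] := cup_bounds iI;
      rewrite /= i0 ltnW.
    by apply: xpt_bdry; move: iI; rewrite mem_desc => /andP[/leqW].
  apply/idP/idP => /connect_linked L; apply/connect_linked.
    by rewrite !hE eS; apply: expand_linked; rewrite -eS'.
  rewrite !hE eS in L; have := contract_linked L.
  rewrite !contract_expand ?edge_vtx_valid // eS'.
  by case=> [[->]|[x [y [[->] [->]]]]] //; exact: rst_refl.
rewrite (adjunction_n_comp h (smooth_sym s) (smooth_sym s') cla radj).
apply: eq_n_comp_r => u; rewrite !inE; congr (~~ _).
by apply/idP/idP => /closedE hu; apply/closedE; move: hu; rewrite hE eS eS';
  apply bdry_linked; exact: edge_vtx_valid.
Qed.

End Contraction.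

(** * Expansion along the first row *)

Section RowReduction.

Variables (m n : nat) (r : {ffun 'I_n -> bool}).
Let I := (rowsets r).2.
Let kc := kept n I.

Lemma signs_end : ~~ signs r n.+1.
Proof. by rewrite signs_last. Qed.

Lemma row_cup_bounds i : i \in I -> [/\ 0 < i, i < n,
  i.+1 \notin I & i.-1 \notin I].
Proof. by move=> iI; have [] :=
  cup_bounds (erefl : signs r 0) signs_end iI. Qed.

(** With [restrict], a bijection from the states of the small lattice onto the settled states with
    first row [r]: the columns i-1 and i, for i in I, are filled with - and +. *)
Definition extend (s' : kstate m (size kc)) : kstate m.+1 n :=
  [ffun c : 'I_m.+1 * 'I_n => if c.1 == ord0 then r c.2
             else if c.2.+1 \in I then false
             else if (c.2 : nat) \in I then true
             else mark s' c.1.-1 (index (c.2 : nat) kc)].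

Definition restrict (s : kstate m.+1 n) : kstate m (size kc) :=
  [ffun c : 'I_m * 'I_(size kc) => mark s c.1.+1 (nth 0 kc c.2)].

Lemma mark_extend s' k b : k <= m -> b < n -> mark (extend s') k b =
  if k is k'.+1 then
    if b.+1 \in I then false else if b \in I then true
    else mark s' k' (index b kc)
  else signs r b.+1.
Proof.
move=> hk hb; have -> : signs r b.+1 = r (Ordinal hb) :=
  signs_ord r (Ordinal hb).
have := mark_ord (extend s') (Ordinal (hk : k < m.+1)) (Ordinal hb).
move=> /= ->; rewrite ffunE /=; case: k hk => [|k] hk.
  by rewrite (_ : Ordinal _ = ord0) //; exact: val_inj.
by case: eqP => // /(congr1 val).
Qed.

Lemma settled_extend s' : settled r I (fun _ _ => true) (extend s').
Proof.
apply/settledP; split=> [j|k i hk iI _]; first by rewrite ffunE eqxx.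
have [i0 hi n1 n2] := row_cup_bounds iI; have hi' : i.-1 < n by lia.
rewrite !mark_extend //; case: k hk => [|k] _.
  by rewrite prednK //; move: iI; rewrite mem_asc => /and3P[_ /negbTE-> ->].
by rewrite prednK // iI (negbTE n1).
Qed.

Lemma extendK : cancel extend restrict.
Proof.
move=> s'; apply/ffunP => -[k l]; rewrite ffunE /=.
have : nth 0 kc l \in kc by exact: mem_nth.
rewrite mem_kept => /and3P[/negbTE n1 /negbTE n2 h].
by rewrite mark_extend // n1 n2 index_uniq ?mark_ord // filter_uniq ?iota_uniq.
Qed.

Lemma restrictK s : settled r I (fun _ _ => true) s -> extend (restrict s) = s.
Proof.
move=> /settledP[h1 h2]; apply/ffunP => -[k b]; rewrite ffunE /=.
case: eqP => [->|/eqP k0]; first by rewrite h1.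
have kp : 0 < k by rewrite lt0n; apply: contraNneq k0 => e; apply/eqP/val_inj.
have km : k <= m by rewrite -ltnS.
case: ifP => [bI|n1].
  by have [+ _] := h2 k b.+1 km bI isT; rewrite /= mark_ord.
case: ifP => [bI|n2]; first by have [_ +] := h2 k b km bI isT;
  rewrite mark_ord => ->.
have bk : (b : nat) \in kc by rewrite mem_kept n1 n2 ltn_ord.
have hl : index (b : nat) kc < size kc by rewrite index_mem.
have hk : k.-1 < m by rewrite prednK.
have := mark_ord (restrict s) (Ordinal hk) (Ordinal hl) => /= ->.
by rewrite ffunE /= nth_index // prednK // mark_ord.
Qed.

(** Deleted columns come in pairs contributing -1 + 1. Instead of pairing them, the indicator x of I
    is telescoped: a deleted column b contributes x b - x (b+1), and neither 0 nor n lies in I. *)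
Lemma sum_row_kept (f : nat -> int) :
    (forall i, i \in I -> f i.-1 = -1 /\ f i = 1)%R ->
  (\sum_(b < n) f b = \sum_(l < size kc) f (nth 0%N kc l))%R.
Proof.
move=> fI; pose x i : int := (i \in I)%:R%R.
have -> : (\sum_(b < n) f b = \sum_(b < n | (b : nat) \in kc) f b +
    \sum_(0 <= b < n) (x b - x b.+1))%R.
  rewrite [in RHS]big_mkcond big_mkord -big_split /=; apply: eq_bigr => b _.
  rewrite mem_kept ltn_ord andbT /x.
  case: (boolP (b.+1 \in I)) => [b1|_].
    by have [_ _ _ /negbTE-> ] := row_cup_bounds b1; have [-> _] := fI _ b1.
  case: (boolP ((b : nat) \in I)) => [b1|_] /=; last by rewrite subrr addr0.
  by have [_ ->] := fI _ b1.
rewrite -[X in (_ + X)%R]opprK -sumrN (eq_bigr (fun b => x b.+1 - x b)%R);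
  last first.
  by move=> b _; rewrite opprB.
rewrite telescope_sumr // /x.
have -> : n \in I = false by apply/negbTE/negP => /row_cup_bounds[];
  rewrite ltnn.
have -> : 0 \in I = false by apply/negbTE/negP => /row_cup_bounds[].
rewrite subrr oppr0 addr0 -(big_mkord (fun b => b \in kc) f) /index_iota subn0.
rewrite -(big_mkord predT (fun l =>
  f (nth 0 kc l))) -(big_nth 0 predT f) -big_filter.
apply: perm_big; apply: uniq_perm; rewrite ?filter_uniq ?iota_uniq //.
by move=> b; rewrite mem_filter mem_iota andb_idr // mem_kept => /and3P[].
Qed.

Lemma expo_extend s' :
  (expo (extend s') = \sum_(i < n) (if r i then 1 else -1) + expo s')%R.
Proof.
pose e (b : bool) : int := (if b then 1 else -1)%R.
have expoM p q (s : kstate p q) : expo s = (\sum_(i < p) \sum_(j < q) e (mark s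
  i j))%R.
  rewrite /expo pair_bigA /=; apply: eq_bigr => -[i j] _ /=.
  by rewrite mark_ord.
rewrite !expoM big_ord_recl; congr (_ + _)%R.
  by apply: eq_bigr => j _; rewrite mark_extend // -signs_ord.
apply: eq_bigr => k _;
  rewrite (sum_row_kept (f := fun b => e (mark (extend s') _ b))).
  apply: eq_bigr => l _; have : nth 0 kc l \in kc by exact: mem_nth.
  rewrite mem_kept => /and3P[/negbTE n1 /negbTE n2 h].
  by rewrite lift0 mark_extend // n1 n2 index_uniq // filter_uniq ?iota_uniq.
move=> i iI; have /settledP[_ h2] := settled_extend s'.
by have [-> ->] := h2 (lift ord0 k) i (ltn_ord k) iI isT.
Qed.

Variables (K : comUnitRingType) (A : K).
Hypothesis hA : A \is a GRing.unit.
Let J := (rowsets r).1.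

Let contr (s' : kstate m (size kc)) : (forall b,
  b < n -> mark (extend s') 0 b = signs r b.+1) /\
   (forall k i, k < m -> i \in I -> mark (extend s') k.+1 i.-1 = false /\
      mark (extend s') k.+1 i = true) /\
   (forall k l, k < m -> l < size kc ->
      mark (extend s') k.+1 (nth 0 kc l) = mark s' k l).
Proof.
split; [|split].
- by move=> b hb; rewrite mark_extend.
- move=> k i hk iI; have /settledP[_ h2] := settled_extend s'.
  exact: h2.
- move=> k l hk hl; have : nth 0 kc l \in kc by exact: mem_nth.
  rewrite mem_kept => /and3P[/negbTE n1 /negbTE n2 h].
  by rewrite mark_extend // n1 n2 index_uniq // filter_uniq ?iota_uniq.
Qed.

Lemma wterm_extend C C' s' : rowext m n J I C' C ->
  (wterm A C (extend s') =
   A ^ (\sum_(i < n) (if r i then 1 else -1)) * wterm A C' s')%R.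
Proof.
move=> E; have [h1 [h2 h3]] := contr s'.
have M := @matches_rowext m n (signs r) isT signs_end _ _ h1 h2 h3 C' C E.
rewrite /wterm (asbool_equiv_eq M).
case: `[< matches m (size kc) (mark s') C' >]; last by rewrite mulr0.
rewrite /weight expo_extend (exprzDr hA) mulrA; congr (_ * _ ^+ _)%R.
exact: (@closed_count_contract m n (signs r) isT signs_end _ _ h1 h2 h3).
Qed.

Lemma sum_row_rowext C C' : rowext m n J I C' C ->
  (\sum_(s : kstate m.+1 n | [forall j, s (ord0, j) == r j]) wterm A C s =
   A ^ (\sum_(i < n) (if r i then 1 else -1)) * catalan_coef A C')%R.
Proof.
move=> E; have [[e1 e2 e3] _ _ _] := E.
rewrite (sum_settled hA) -/I (reindex_onto extend restrict restrictK).
rewrite (catalan_coefE A e1 e2 e3) mulr_sumr; apply: eq_big => [s'|s' _].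
  by rewrite settled_extend extendK eqxx.
exact: wterm_extend.
Qed.

(** A settled state realizing C would force in C all the arcs named by J and I, by
    [matches_arcs]. *)
Lemma sum_row_zero C :
    ~ ((forall j, j \in J -> mate C (xpt n j) = xpt n j.+1) /\
       (forall i, i \in I -> mate C (Bot i) = Bot i.+1)) ->
  (\sum_(s : kstate m.+1 n | [forall j, s (ord0, j) == r j]) wterm A C s = 0)%R.
Proof.
move=> nE; rewrite (sum_settled hA) -/I; apply: big1 => s /restrictK es.
rewrite -es /wterm; case: asboolP => // M; case: nE.
have [h1 [h2 h3]] := contr (restrict s).
exact: (@matches_arcs m n (signs r) isT signs_end _ _ h1 h2 h3 C M).
Qed.

End RowReduction.

(* C = psi_n^{-1}(J) *_v C' *_v phi_n^{-1}(I), that is, C' = (C^J)_I. *)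
Definition ext2 (J I : {fset nat}) (C' C : connection) : Prop :=
  exists X T, [/\ is_phi_inv (nb C) I T, extT J X C & extB T C' X].

Section Cups.

Variables (n : nat) (w : {fset nat} * {fset nat}).
Hypothesis hw : w \in Dset n.

(** Every pair in D_n comes from a sign sequence, so this and several of the following facts are
    inherited from descents and ascents. *)
Lemma Dset_in_U : in_U n w.1.
Proof. by case: (rowsets_surj hw) => r <-; apply: desc_in_U;
  rewrite ?signs_last. Qed.

Lemma Dset_I i : i \in w.2 -> [/\ 0 < i, i < n & i.+1 \notin w.2].
Proof.
by case: (rowsets_surj hw) => r <- /(@asc_bounds n (signs r)) [];
  rewrite ?signs_last.
Qed.

Lemma Dset_posset : posset w.2.
Proof. by apply/negP => /Dset_I[]. Qed.

Lemma Dset_card : #|` w.1| = #|` w.2|.+1.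
Proof.
case: w hw => J I; rewrite mem_Dset => /and3P[_ _ /andP[/eqP]].
by rewrite !size_sort.
Qed.

Lemma Dset_cups : exists T, [/\ is_phi_inv n w.2 T, nt T = size (kept n w.2),
      forall i, i \in w.2 -> mate T (Bot i) = Bot i.+1,
      forall j, bot_return T j -> j \in w.2 \/ j.-1 \in w.2
    & forall k, 0 < k <= nt T -> tau T k = (nth 0 (kept n w.2) k.-1).+1].
Proof.
by apply: cups_exist;
  [exact: Dset_posset|move=> i /Dset_I[]|move=> i /Dset_I[]].
Qed.

Lemma Dset_size : size (free_idx n w.1) = size (kept n w.2).
Proof. by case: (rowsets_surj hw) => r <-; apply: size_free_kept;
  rewrite ?signs_last. Qed.

(** The map [rowmap] is [topmap] after [botmap], since the feet of the through strands of the cup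
    state are the kept columns. *)
Lemma ext2_rowext m C C' : ht C = m.+1 -> nt C = n -> nb C = n ->
  ext2 w.1 w.2 C' C -> rowext m n w.1 w.2 C' C.
Proof.
move=> e1 e2 e3 [X [T [HT ET EB]]]; rewrite e3 in HT.
have [T' [HT' nT cT _ tT]] := Dset_cups.
have eT := is_phi_inv_uniq HT HT'; rewrite -{T' HT'}eT in nT cT tT.
have [_ fB mB] := extB_embeds EB; have [_ _ mT] := extT_embeds ET.
have fX := fB; rewrite e2 in mT.
case: (ET) (EB) => _ [h1 h2 h3] eJ _ [bT [h4 h5 h6 h7] rI _].
have rE p : bdry C' p -> rowmap n w.1 w.2 p = topmap n w.1 (botmap T p).
  by case: p => //= k hk; rewrite tT // -h6.
split.
- by rewrite -nT h6 -h5 h2 e2 Dset_size; split=> //; lia.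
- move=> p Bp; rewrite !rE //; last exact: mate_bdry.
  rewrite mT; first by rewrite mB.
  by case: (extB_embeds EB) => + _ _; exact.
- by move=> j jJ; have [] := has_e_sym (eJ j jJ); rewrite e2.
- move=> i iI; have [i0 hi _] := Dset_I iI.
  have Bi : bdry X (Bot i) by rewrite /bdry /= h3 e3; lia.
  have := mT (Bot i) Bi; rewrite /= => ->; rewrite rI ?cT //.
  by rewrite /bot_return cT // -h7 h3 e3; lia.
Qed.

Lemma ext2_exists m C : ht C = m.+1 -> nt C = n -> nb C = n ->
    (forall j, j \in w.1 -> mate C (xpt n j) = xpt n j.+1) ->
    (forall i, i \in w.2 -> mate C (Bot i) = Bot i.+1) ->
  exists C', ext2 w.1 w.2 C' C.
Proof.
move=> e1 e2 e3 hJ hI; have [T [HT nT cT rT _]] := Dset_cups.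
have [X EX] : exists X, extT w.1 X C.
  apply: extT_remove; rewrite ?e1 ?e2 //; first exact: Dset_in_U.
  by move=> j jJ; rewrite /has_e e2 hJ.
case: (HT) => bT nbT _; case: (EX) => _ [h1 h2 h3] _ _.
have [_ _ mX] := extT_embeds EX.
have hX i : i \in w.2 -> mate X (Bot i) = Bot i.+1.
  move=> iI; have [i0 hi _] := Dset_I iI.
  have Bi : bdry X (Bot i) by rewrite /bdry /= h3 e3; lia.
  have Bj : bdry X (Bot i.+1) by rewrite /bdry /= h3 e3; lia.
  have [_ inj _] := extT_embeds EX; apply: inj => //; first exact: mate_bdry.
  by rewrite -mX //= hI.
have [C' EC'] : exists C', extB T C' X.
  apply: extB_remove => //; first by rewrite h3 e3.
  move=> j rj; have j0 : 0 < j.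
    by move: rj; rewrite /bot_return; case: (mate _ _) => // _ /andP[].
  case: (rT j rj) => jI; first by rewrite hX ?cT.
  have e : Bot j = mate T (Bot j.-1) by rewrite cT ?prednK.
  have e' : Bot j = mate X (Bot j.-1) by rewrite hX ?prednK.
  by rewrite {1}e' e !mateK.
by exists C', X, T; rewrite e3.
Qed.

End Cups.

(** The states are grouped by their first row. F stands for the coefficient of (C^J)_I, with value 0
    if this connection does not exist; K_0 thus stays out of the expansion. *)
Lemma row_expansion (K : comUnitRingType) (A : K) (hA : A \is a GRing.unit)
    m n C (F : {fset nat} * {fset nat} -> K) :
    ht C = m.+1 -> nt C = n -> nb C = n ->
    (forall w C', w \in Dset n -> ext2 w.1 w.2 C' C -> F w = catalan_coef A C')
      ->
    (forall w, w \in Dset n -> ~ (exists C', ext2 w.1 w.2 C' C) -> F w = 0%R) ->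
  (catalan_coef A C = \sum_(w <- Dset n)
    A ^ (- n%:Z + 2%:Z * ((sum_elts w.1)%:Z - (sum_elts w.2)%:Z)) * F w)%R.
Proof.
move=> e1 e2 e3 F1 F0; rewrite (catalan_coefE A e1 e2 e3) big_Dset.
rewrite (partition_big (fun s : kstate m.+1 n => [ffun j =>
  s (ord0, j)]) predT) //=.
apply: eq_bigr => r _; rewrite -sum_signs.
have hw := rowsets_Dset r.
rewrite (eq_bigl (fun s : kstate m.+1 n => [forall j, s (ord0, j) == r j]));
  last first.
  move=> s; apply/eqP/forallP => [<- j|h]; first by rewrite ffunE.
  by apply/ffunP => j; rewrite ffunE; exact/eqP.
have [[C' E]|nE] := pselect (exists C', ext2 (rowsets r).1 (rowsets r).2 C' C).
  rewrite (F1 _ C' hw E); apply: sum_row_rowext => //.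
  exact: (ext2_rowext hw e1 e2 e3 E).
rewrite (F0 _ hw nE) mulr0; apply: sum_row_zero => // -[h1 h2].
by apply: nE; exact: (ext2_exists hw e1 e2 e3 h1 h2).
Qed.

(** * Arcs of products, and comparison of the two sides *)

Lemma mem_top_arcs C j : (j \in top_arcs C) = (j <= nt C) && has_e C j.
Proof. by rewrite in_fset -[LHS]/((j \in iota 0 _) && has_e C j) mem_iota. Qed.

Lemma mem_Hset R w : (w \in Hset R) = (w \in Dset (nt R)) && (w.1 `<=` top_arcs
  R).
Proof. by rewrite /Hset in_fset. Qed.

Lemma is_vprod_mate S T C p q : is_vprod S T C -> bdry C p -> bdry C q -> p <>
  q ->
  glued S T (outer S p) (outer S q) -> mate C p = q.
Proof. by case=> _ _ M Bp Bq ne L; apply/M. Qed.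

(** If the strand at x'_i went up to the junction, then S, having no bottom returns, would lead it
    to its top or a side, so it could not come back to the bottom. *)
Lemma is_vprod_roof_cup S T C i k : is_vprod S T C -> roof S ->
  0 < i <= nb C -> mate C (Bot i) = Bot k -> mate T (Bot i) = Bot k.
Proof.
move=> Vp rS hi e; case: (Vp) => n1 [h1 h2 h3] _.
have Bi : bdry C (Bot i) by [].
have Bi' : bdry T (Bot i) by rewrite /bdry /= -h3.
have := mate_bdry Bi'; case eT: (mate T (Bot i)) => [j|j|j|j] Bj.
- have hj : 0 < j <= nb S by rewrite n1.
  have Bj' := mate_bdry (hj : bdry S (Bot j)).
  have L : glued S T (inr (Bot i)) (inl (mate S (Bot j))).
    apply: rst_trans (_ : glued S T _ (inr (Top j))) _.
      by rewrite -eT; exact: (glued_mate S T (inr (Bot i))).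
    apply: rst_trans (_ : glued S T _ (inl (Bot j))) _.
      by apply: rst_sym; apply: rst_step; constructor.
    exact: (glued_mate S T (inl (Bot j))).
  have := rS j; rewrite /bot_return hj.
  case eS: (mate S (Bot j)) L Bj' => [l|l|l|l] L Bl // _.
  + have : mate C (Bot i) = Top l by apply: (is_vprod_mate Vp) => //;
    rewrite /bdry /= h2.
    by rewrite e.
  + have : mate C (Bot i) = Lft l.
      move: Bl; rewrite /bdry /= => Bl; apply: (is_vprod_mate Vp) => //.
        by rewrite /bdry /= h1; lia.
      by rewrite /= ifT //; lia.
    by rewrite e.
  + have : mate C (Bot i) = Rgt l.
      move: Bl; rewrite /bdry /= => Bl; apply: (is_vprod_mate Vp) => //.
        by rewrite /bdry /= h1; lia.
      by rewrite /= ifT //; lia.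
    by rewrite e.
- rewrite -e; symmetry; apply: (is_vprod_mate Vp) => //.
  + by move: Bj; rewrite /bdry /= h3.
  + by move=> [ij]; apply: (mate_neq Bi'); rewrite eT ij.
  + by have := glued_mate S T (inr (Bot i)); rewrite /= eT.
- have : mate C (Bot i) = Lft (ht S + j).
    move: Bj; rewrite /bdry /= => Bj; apply: (is_vprod_mate Vp) => //.
      by rewrite /bdry /= h1; lia.
    have := glued_mate S T (inr (Bot i)); rewrite /= eT ifF; last lia.
    by rewrite addKn.
  by rewrite e.
- have : mate C (Bot i) = Rgt (ht S + j).
    move: Bj; rewrite /bdry /= => Bj; apply: (is_vprod_mate Vp) => //.
      by rewrite /bdry /= h1; lia.
    have := glued_mate S T (inr (Bot i)); rewrite /= eT ifF; last lia.
    by rewrite addKn.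
  by rewrite e.
Qed.

(** If the arc of S at x_j went down to the junction, then T, having no top returns, would lead it
    to the bottom or to a side point of index greater than ht S >= 1. But x_{j+1} is a top point or
    y'_1. *)
Lemma is_vprod_floor_e S T C j : is_vprod S T C -> floor T -> 0 < ht S ->
  j <= nt C -> has_e C j -> has_e S j.
Proof.
move=> Vp fT hS hj /eqP e; case: (Vp) => n1 [h1 h2 h3] _; apply/eqP.
rewrite h2 in e hj.
have xB k : k <= (nt S).+1 -> bdry S (xpt (nt S) k) /\ bdry C (xpt (nt S) k).
  move=> hk; split; rewrite /bdry; first by rewrite -(prednK hS);
    exact: xpt_bdry.
  by rewrite h1 h2 -(prednK hS) addSn; exact: xpt_bdry.
have [Bp Bp'] := xB j (leqW hj); have [Bq Bq'] := xB j.+1 hj.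
set p := xpt _ j in e Bp Bp' *; set q := xpt _ j.+1 in e Bq Bq' *.
have op : outer S p = inl p by exact: outer_xpt.
have gm : glued S T (outer S p) (inl (mate S p)).
  by rewrite op; exact: (glued_mate S T (inl p)).
have fin s : bdry C s -> p <> s -> glued S T (outer S p) (outer S s) -> q = s.
  by move=> Bs ne L; rewrite -e; exact: (is_vprod_mate Vp _ _ ne L).
have Bm := mate_bdry Bp; have pm : p <> mate S p by move/esym/(mate_neq Bp).
have side k : xpt (nt S) j.+1 <> Bot k /\ (1 < k -> xpt (nt S) j.+1 <> Lft k) /\
    (1 < k -> xpt (nt S) j.+1 <> Rgt k).
  rewrite /xpt /=; case: ifP => _; split=> //; split=> // k1 [ek]; lia.
have pside k : p <> Bot k by rewrite /p /xpt; case: eqP => // _; case: ifP.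
have pside2 k : 1 < k -> p <> Lft k /\ p <> Rgt k.
  rewrite /p /xpt => k1; case: eqP => _; first by split=> // -[ek]; lia.
  by case: ifP => _; split=> // -[ek]; lia.
symmetry; case em: (mate S p) gm Bm pm => [k|k|k|k] gm Bm pm.
- by apply: fin => //; rewrite /bdry /= h2.
- have hk : 0 < k <= nt T by rewrite -n1.
  have L : glued S T (outer S p) (inr (mate T (Top k))).
    apply: rst_trans gm _; apply: rst_trans (_ : glued S T _ (inr (Top k))) _.
      by apply: rst_step; constructor.
    exact: (glued_mate S T (inr (Top k))).
  have := mate_bdry (hk : bdry T (Top k)); have := fT k; rewrite /top_return hk.
  case eT: (mate T (Top k)) L => [l|l|l|l] L // _ Bl.
  + have [ne _] := side l; case: ne; apply: (fin (Bot l)) => //.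
    by move: Bl; rewrite /bdry /= h3.
  + have hl : 0 < l <= ht T by [].
    have [_ [ne _]] := side (ht S + l); case: ne; first lia.
    apply: fin; first by rewrite /bdry /= h1; lia.
      by have [] := pside2 (ht S + l) ltac:(lia).
    by rewrite /= ifF ?addKn //; lia.
  + have hl : 0 < l <= ht T by [].
    have [_ [_ ne]] := side (ht S + l); case: ne; first lia.
    apply: fin; first by rewrite /bdry /= h1; lia.
      by have [] := pside2 (ht S + l) ltac:(lia).
    by rewrite /= ifF ?addKn //; lia.
- have hk : 0 < k <= ht S by [].
  apply: fin => //; first by rewrite /bdry /= h1; lia.
  by rewrite /= ifT //; lia.
- have hk : 0 < k <= ht S by [].
  apply: fin => //; first by rewrite /bdry /= h1; lia.
  by rewrite /= ifT //; lia.
Qed.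

Lemma extT_roof J R1 R : extT J R1 R -> roof R -> roof R1.
Proof.
case=> _ [_ _ eb] _ mE rR i; apply: contraT.
rewrite negbK /bot_return; case e: (mate R1 (Bot i)) => [|k||] // hi.
have := rR i; have := mE (Bot i) hi; rewrite /= e /= => eR.
by rewrite /bot_return eR -eb hi.
Qed.

Lemma extB_floor_below T C' C : extB T C' C -> floor C -> floor C'.
Proof.
case=> _ [_ e2 _ _] _ mE fC i; apply: contraT.
rewrite negbK /top_return; case e: (mate C' (Top i)) => [k|||] // hi.
have := fC i; have := mE (Top i) hi; rewrite /= e /= => eC.
by rewrite /top_return eC e2 hi.
Qed.

Lemma extB_assoc T0 T P F0 F G : extB T0 T P -> extB T0 F0 F -> extB T G F0 ->
  bottom T -> extB P G F.
Proof.
move=> EP EF EG bT; apply: vprod_bottomP; first exact: (extB_bottom EP bT).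
by apply/(vprod_extB _ EP EF); exact: vprod_bottom.
Qed.

Section Products.

Variables (J I I0 : {fset nat}) (R R1 F : connection).
Hypotheses (pI : posset I) (pI0 : posset I0) (ER : extT J R1 R).

(** The bottom state of I (+) I0 factors through those of I and I0. The first gives F_{I0} back from
    G, and C is rebuilt from C' by inserting the returns of I and then the arcs of J. *)
Lemma product_extend G C' : rem_bot (Some F) (oplus I I0) = Some G ->
    is_vprod R1 G C' ->
  exists F0 C, [/\ rem_bot (Some F) I0 = Some F0, is_vprod R F0 C
    & ext2 J I C' C].
Proof.
move=> /rem_botP[P HP EG] VC'.
have [T0 [T [P' [HT0 HT HP' E]]]] := in_L_oplus pI pI0 (ex_intro _ P HP).
rewrite -(is_phi_inv_uniq HP HP') in E; case: (HT) (HT0) => bT eT _ [bT0 eT0 _].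
have eG : nb G = nt T by case: EG => _ [_ _ -> _] _ _;
  case: E => _ [_ -> _ _] _ _.
have [F0 EF0] := extB_insert bT eG.
have eF0 : nb F0 = nt T0 by rewrite -eT; case: EF0 => _ [_ _ _ ->].
have [F' EF'] := extB_insert bT0 eF0.
have eF := extB_uniq_above (extB_assoc E EF' EF0 bT) EG; rewrite eF in EF'.
have eX : nb C' = nt T by rewrite -eG; case: VC' => _ [].
have [X EX] := extB_insert bT eX.
have VX : is_vprod R1 F0 X by apply/(vprod_extB R1 EF0 EX).
have [UR [h1 h2 h3] _ _] := ER.
have nX : nt X = size (free_idx (nt R) J) by rewrite -h2; case: VX => _ [].
have [C nC EC] := extT_insert UR nX.
have VC : is_vprod R F0 C by apply/(vprod_extT F0 ER EC).
exists F0, C; split=> //; first by apply/rem_botP; exists T0.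
exists X, T; split=> //; have -> : nb C = nt T0 by rewrite -eF0;
  case: VC => _ [].
exact: HT.
Qed.

(** As R1 has no bottom returns, the returns that I demands at the bottom of R1 *_v F0 are already
    returns of F0; they can be split off F0, which gives the quotient of F by I (+) I0. *)
Lemma product_restrict F0 C C' : roof R -> rem_bot (Some F) I0 = Some F0 ->
    is_vprod R F0 C -> ext2 J I C' C ->
  exists2 G, rem_bot (Some F) (oplus I I0) = Some G & is_vprod R1 G C'.
Proof.
move=> rR /rem_botP[T0 HT0 EF0] VC [X [T [HT EX EC']]].
have nC : nt R = nt C by case: VC => _ [_ -> _].
have VX : is_vprod R1 F0 X by apply/(vprod_extT F0 ER EX).
have eX : nb X = nb F0 by case: VX => _ [].
have eC : nb C = nb F0 by case: VC => _ [].
have [bT eT _] := HT; case: (EC') => _ [k1 k2 k3 k4] rI _.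
have [G EG] : exists G, extB T G F0.
  apply: extB_remove => //; first by rewrite eT.
  move=> i ri; have hi : 0 < i <= nb X.
    by rewrite k4; move: ri; rewrite /bot_return; case: (mate _ _).
  have := rI i ri; case e: (mate T (Bot i)) => [|k||] //; move: ri;
    rewrite /bot_return e // => _ eXi.
  exact: is_vprod_roof_cup VX (extT_roof ER rR) hi eXi.
have eT0 : nt T0 = nb F0 by case: EF0 => _ [].
have [P EP] : exists P, extB T0 T P.
  by apply: extB_insert; [case: HT0|rewrite eT eC].
exists G; last by apply/(vprod_extB R1 EG EC').
apply/rem_botP; exists P; last exact: (extB_assoc EP EF0 EG bT).
have HT' : is_phi_inv (nt T0) I T by rewrite eT0 -eC.
split; first exact: (extB_bottom EP bT).
  by case: EP => _ [_ _ _ ->] _ _; case: HT0.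
exact: (oplus_extB HT0 HT' EP).
Qed.

(** The top loses 2(|J| - 1) points and the bottom 2|I|, the same number. *)
Lemma ext2_balanced C C' : #|` J| = #|` I|.+1 -> ext2 J I C' C ->
  (nt C' == nb C') = (nt C == nb C).
Proof.
move=> cJ [X [T [[bT eT pT] [UJ [h1 h2 h3] _ _] [_ [k1 k2 k3 k4] _ _]]]].
have := size_free_idx UJ; have := card_phi bT; rewrite pT; lia.
Qed.

End Products.

Lemma Hset_extT R w : 0 < ht R -> w \in Hset R -> exists R1, extT w.1 R1 R.
Proof.
move=> hR; rewrite mem_Hset => /andP[hw /fsubsetP sub].
apply: extT_remove => //; first exact: Dset_in_U hw.
by move=> j /sub; rewrite mem_top_arcs => /andP[].
Qed.

Lemma W_le_Hset R I0 w R1 : in_W (R, I0) -> w \in Hset R -> extT w.1 R1 R ->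
  W_le (R, I0) (R1, oplus w.2 I0).
Proof.
move=> -[/= rR pI0] hw ER; move: hw; rewrite mem_Hset => /andP[hw _].
rewrite /= in rR pI0; have pI := Dset_posset hw; set I := w.2 in pI *.
have [T [U [P [HT HU HP E]]]] := oplus_exists pI pI0 (leqnn _).
set N := maxn _ _ in HT HP.
have pP : posset (oplus I I0) by apply: (@in_L_posset N); exists P.
case: (HU) (HT) (HP) => bU eU pU [bT eT pT] [bP eP pPh].
have [UJ [h1 h2 h3] _ _] := ER.
split=> /=.
- by split; split=> //; exact: extT_roof ER rR.
- split.
    exists N; split; [by exists P|by exists T|rewrite (phi_inv_Some HP)].
    by have -> : rem_bot (Some P) I0 = Some U; [apply/rem_botP; exists T;
      rewrite ?eP|].
  (* [ominus] works at the least width of I (+) I0. By [in_L_oplus] the product still factors at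
     that width, so removing I0 gives back I, which lies in L_n because its cups fit. *)
  have : in_L (minwidth (oplus I I0)) (oplus I I0) by apply/minwidthP.
  move=> /(in_L_oplus pI pI0)[T' [U' [P' [HT' HU' HP' E']]]].
  rewrite /ominus (phi_inv_Some HP').
  have -> : rem_bot (Some P') I0 = Some U'.
    by apply/rem_botP; exists T' => //; case: HP' => _ -> _.
  case: HU' => _ _ /= ->; have [Q [HQ _ _ _ _]] := Dset_cups hw.
  by exists Q.
- have := card_phi_extB E bU; rewrite pPh pT pU.
  have := size_free_idx UJ; have := Dset_card hw; rewrite -/I h2.
  by move: (size _) (#|` _|) (#|` I|) (#|` I0|) => ? ? ? ? -> + ->; lia.
- by [].
Qed.

Local Open Scope ring_scope.

Lemma big_Hset (V : nmodType) R (f : {fset nat} * {fset nat} -> V) :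
  \sum_(w <- Hset R) f w = \sum_(w <- Dset (nt R)) (if w \in Hset R then f w
    else 0).
Proof.
rewrite -big_mkcond -big_filter; apply: perm_big; apply: uniq_perm.
- exact: fset_uniq.
- by rewrite filter_uniq ?fset_uniq.
- by move=> w; rewrite mem_filter mem_Hset; case: (w \in Dset _);
  rewrite ?andbT ?andbF.
Qed.

Theorem proposition3p11
    (K : comUnitRingType) (A : K) (hA : A \is a GRing.unit)
    (R : connection) (I0 : {fset nat}) (n : nat)
    (hW : in_W (R, I0)) (hn : nt R = n) (hht : (1 <= ht R)%N) :
  (forall J I : {fset nat}, (J, I) \in Hset R ->
     exists2 R' : connection,
       rem_top R J = Some R' & W_le (R, I0) (R', oplus I I0))
  /\
  (forall F : option connection, floor_or_K0 F ->
     Theta A (Some R) I0 F =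
     \sum_(w <- Hset R)
        A ^ (- n%:Z + 2%:Z * ((sum_elts w.1)%:Z - (sum_elts w.2)%:Z))
        * Theta A (rem_top R w.1) (oplus w.2 I0) F).
Proof.
have [rR pI0] := hW; split=> [J I hw|F fF].
  have [R1 ER] := Hset_extT hht hw; exists R1; first exact: rem_top_extT ER.
  exact: W_le_Hset hW hw ER.
case: F fF => [F|_]; last first.
  by rewrite /Theta /= big1 // => w _; case: (rem_top R w.1) => [?|] /=;
    rewrite mulr0.
move=> /= fF.
have termE w : w \in Hset R -> exists2 R1, extT w.1 R1 R &
    Theta A (rem_top R w.1) (oplus w.2 I0) (Some F) =
    coef A (vprod (Some R1) (rem_bot (Some F) (oplus w.2 I0))).
  move=> hw; have [R1 ER] := Hset_extT hht hw; exists R1 => //.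
  by rewrite /Theta (rem_top_extT ER).
have HD w : w \in Hset R -> w \in Dset (nt R) by rewrite mem_Hset => /andP[].
have vprodP S G C : vprod (Some S) G = Some C ->
    exists2 G', G = Some G' & is_vprod S G' C.
  by case: G => // G' /vprod_SomeP; exists G'.
(* Either R *_v F_{I0} is a Catalan state C, or the left side is 0. In the second case a right-hand
   product with as many top as bottom points would produce such a C. *)
have [[F0 [C [eF0 VC eC]]]|nC] := pselect (exists F0 C,
    [/\ rem_bot (Some F) I0 = Some F0, is_vprod R F0 C & nt C = nb C]);
      last first.
  have z w : w \in Hset R -> Theta A (rem_top R w.1) (oplus w.2 I0) (Some F) =
    0.
    move=> hw; have [R1 ER ->] := termE w hw.
    case eV: (vprod _ _) => [C'|] //=; have [G eG VC'] := vprodP _ _ _ eV.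
    have [F0 [C [eF0 VC EC]]] :=
      product_extend (Dset_posset (HD w hw)) pI0 ER eG VC'.
    rewrite (ext2_balanced (Dset_card (HD w hw)) EC); case: eqP => // eC.
    by case: nC; exists F0, C.
  rewrite big_seq big1; last by move=> w hw; rewrite z ?mulr0.
  rewrite /Theta; case eV: (vprod _ _) => [C|] //=.
  have [F0 eF0 VC] := vprodP _ _ _ eV.
  by case: eqP => // eC; case: nC; exists F0, C.
have -> : Theta A (Some R) I0 (Some F) = catalan_coef A C.
  by rewrite /Theta eF0 (proj2 (vprod_SomeP _ _ _) VC) /= eC eqxx.
have [m hm] : exists m, ht C = m.+1.
  by exists (ht C).-1; case: VC => _ [-> _ _] _; rewrite prednK // addn_gt0 hht.
have nC : nt C = n by rewrite -hn; case: VC => _ [].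
have fF0 : floor F0.
  by have /rem_botP[T _ E] := eF0; exact: extB_floor_below E fF.
(* Pairs of D_n outside H(R) are given the value 0, which cuts the sum down to H(R). It must then be
   checked that a pair for which (C^J)_I exists lies in H(R); this is where F having no top returns
   enters. *)
rewrite (row_expansion hA (m := m) (n := n) (C := C) (F := fun w =>
  if w \in Hset R then Theta A (rem_top R w.1) (oplus w.2 I0) (Some F) else 0))
    -?eC //.
- rewrite big_Hset hn; apply: eq_bigr => w _.
  by case: ifP => _; rewrite ?mulr0.
- move=> w C' hw EC.
  have hw' : w \in Hset R.
    rewrite mem_Hset hn hw; apply/fsubsetP => j jJ.
    have [X [T [_ [[_ Un _] _ eJ _] _]]] := EC.
    have hj : (j <= nt C)%N by exact: Un.
    rewrite mem_top_arcs hn -nC hj /=.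
    exact: is_vprod_floor_e VC fF0 hht hj (eJ j jJ).
  rewrite hw'; have [R1 ER ->] := termE w hw'.
  have [G -> VC'] := product_restrict ER rR eF0 VC EC.
  by rewrite (proj2 (vprod_SomeP _ _ _) VC') /= (ext2_balanced (Dset_card hw)
    EC) eC eqxx.
- move=> w hw nE; case: ifP => // hw'; have [R1 ER ->] := termE w hw'.
  case eV: (vprod _ _) => [C'|] //=; have [G eG VC'] := vprodP _ _ _ eV.
  have [F0' [C2 [eF0' VC2 EC]]] :=
    product_extend (Dset_posset hw) pI0 ER eG VC'.
  case: nE; exists C'; have eF : F0' = F0 by move: eF0'; rewrite eF0 => -[].
  by rewrite eF in VC2; rewrite -(is_vprod_uniq VC2 VC).
Qed.
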